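(* Let $X=(X_t)_{t\ge0}$ be a one-dimensional Lévy process with $\mu:=\mathbb{E}X_1\neq0$, and assume that the centred process is in the domain of attraction of an $\alpha$-stable law with $\alpha\in(1,2]$, i.e. $(X_T-\mu T)/a_T\xrightarrow{d}S_\alpha(1)$ as $T\to\infty$ for some positive function $a_T=T^{1/\alpha}l(T)$ with $l$ slowly varying at infinity, where $(S_\alpha(t))_{t\ge0}$ is an $\alpha$-stable process. (a) Suppose $\mu>0$. Then $$\bigg(\frac{1}{a_T}\Big(\Upsilon_T^\frown-\sqrt{1+\mu^2}\,T\Big),\ \frac{\overline C_T^\frown-\mu T}{a_T},\ \frac{C_T^\frown(T)-\mu T}{a_T}\bigg)\xrightarrow{d}S_\alpha(1)\bigg(\frac{\mu}{\sqrt{1+\mu^2}},1,1\bigg),\qquad\text{as }T\to\infty.$$ (b) Suppose $\mu<0$ and let $(\overline X_\infty,\gamma_\infty^\frown)$ be the a.s. finite limit of the supremum and its time $(\overline C_T^\frown,\gamma_T^\frown)$ as $T\to\infty$. Then $$\bigg(\frac{1}{a_T}\Big(\Upsilon_T^\frown-\sqrt{1+\mu^2}\,T\Big),\ \overline C_T^\frown,\ \frac{C_T^\frown(T)-\mu T}{a_T},\ \gamma_T^\frown\bigg)\xrightarrow{d}\bigg(\frac{\mu}{\sqrt{1+\mu^2}}S_\alpha(1),\ \overline X_\infty,\ S_\alpha(1),\ \gamma_\infty^\frown\bigg)$$ as $T\to\infty$, where $S_\alpha(1)$ and $(\overline X_\infty,\gamma_\infty^\frown)$ are independent.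
   Context: Stable laws and processes are understood to be non-degenerate. For a Lévy process $X$ and $T>0$, the concave majorant $C_T^\frown:[0,T]\to\mathbb{R}$ is the pointwise smallest concave function with $C_T^\frown(t)\ge X_t$ for all $t\in[0,T]$. $\Upsilon_T^\frown$ is the length of the graph of $t\mapsto C_T^\frown(t)$ over $[0,T]$; $\overline C_T^\frown:=\sup_{t\in[0,T]}C_T^\frown(t)=\sup_{t\in[0,T]}X_t$; $\gamma_T^\frown$ is the (first) time in $[0,T]$ at which $C_T^\frown$ attains its supremum. *)

(* Defs.v *)
From HB Require Import structures.
From mathcomp Require Import all_boot all_order all_algebra.
From mathcomp Require Import all_classical all_reals all_analysis.

Set Implicit Arguments.
Unset Strict Implicit.
Unset Printing Implicit Defensive.

Import Order.TTheory GRing.Theory Num.Theory.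
Import numFieldNormedType.Exports.

Local Open Scope classical_set_scope.
Local Open Scope ring_scope.

Definition same_law d1 d2 d (Om1 : measurableType d1) (Om2 : measurableType d2)
    (V : measurableType d) (R : realType)
    (P : probability Om1 R) (Q : probability Om2 R)
    (Y : Om1 -> V) (Z : Om2 -> V) : Prop :=
  forall B : set V, measurable B -> P (Y @^-1` B) = Q (Z @^-1` B).

(* Taking [B i = setT] for some indices gives the product rule for every
   subfamily. *)
Definition mutually_independent d (Om : measurableType d) (R : realType)
    (P : probability Om R) (n : nat) (Y : 'I_n -> Om -> R) : Prop :=
  forall B : 'I_n -> set R, (forall i, measurable (B i)) ->
    P (\bigcap_i (Y i @^-1` B i)) = (\prod_(i < n) P (Y i @^-1` B i))%E.

(* Time is [0, +oo[; the values [X t] for [t < 0] play no role. Stochastic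
   continuity is not listed: it follows from the other axioms. *)
Record levy_process d (Om : measurableType d) (R : realType)
    (P : probability Om R) (X : R -> {RV P >-> R}) : Prop := LevyProcess {
  levy_start : {ae P, forall w, X 0 w = 0};
  levy_indep : forall (n : nat) (t : nat -> R), 0 <= t 0%N ->
    (forall i, t i <= t i.+1) ->
    mutually_independent P
      (fun (i : 'I_n) (w : Om) => X (t i.+1) w - X (t i) w);
  levy_stationary : forall s h : R, 0 <= s -> 0 <= h ->
    same_law P P (fun w => X (s + h) w - X s w) (X h);
  levy_cadlag : {ae P, forall w,
    (forall t, 0 <= t -> X s w @[s --> t^'+] --> X t w) /\
    (forall t, 0 < t -> cvg (X s w @[s --> t^'-]))} }.
Arguments levy_process {d Om R} P X.

(* Stability in the wide sense: the scaling identity is up to a drift [b t].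
   Its one-dimensional marginals determine it since both sides are Lévy
   processes. *)
Record stable_process d (Om : measurableType d) (R : realType)
    (P : probability Om R) (alpha : R) (S : R -> {RV P >-> R}) : Prop :=
  StableProcess {
  stable_levy : levy_process P S;
  stable_nondegenerate : ~ exists c : R, {ae P, forall w, S 1 w = c};
  stable_scaling : forall c : R, 0 < c -> exists b : R, forall t : R, 0 <= t ->
    same_law P P (S (c * t)) (fun w => c `^ alpha^-1 * S t w + b * t) }.
Arguments stable_process {d Om R} P alpha S.

Definition slowly_varying (R : realType) (l : R -> R) : Prop :=
  (exists M : R, measurable_fun `[M, +oo[%classic l /\
     forall x, M <= x -> 0 < l x) /\
  forall c : R, 0 < c -> l (c * x) / l x @[x --> +oo] --> (1 : R).

(* Convergence in distribution as the real parameter [T] tends to [+oo]; the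
   limit [Z] may live on another probability space. *)
Definition cvg_in_law d1 d2 (Om1 : measurableType d1) (Om2 : measurableType d2)
    (R : realType) (V : topologicalType)
    (P : probability Om1 R) (Q : probability Om2 R)
    (Y : R -> Om1 -> V) (Z : Om2 -> V) : Prop :=
  forall f : V -> R, continuous f -> (exists M : R, forall v, `|f v| <= M) ->
    ('E_P[f \o Y T])%E @[T --> +oo] --> ('E_Q[f \o Z])%E.

Section concave_majorant.
Context {R : realType}.
Implicit Types (T t : R) (x f : R -> R) (s : seq R).

Definition concave_on T f : Prop :=
  convex_function (`[0, T]%classic : set R^o) (fun t => - f t).

Definition majorizes T x f : Prop := forall t, t \in `[0, T] -> x t <= f t.

(* The pointwise smallest concave function above [x] on [0, T], obtained as the
   infimum of all of them (see [concave_majorantP]); only its values on [0, T]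
   are meaningful. *)
Definition concave_majorant T x t : R :=
  inf [set f t | f in [set f | concave_on T f /\ majorizes T x f]].

(* Length of the polygonal line inscribed in the graph of [f] at the points of
   the partition [a :: s]. *)
Definition polygon_length (a b : R) f s : R :=
  let p := nth b (a :: s) in
  \sum_(0 <= n < size s)
    Num.sqrt ((p n.+1 - p n) ^+ 2 + (f (p n.+1) - f (p n)) ^+ 2).

Definition graph_length (a b : R) f : R :=
  sup [set polygon_length a b f s | s in itv_partition a b].

Definition majorant_length T x : R := graph_length 0 T (concave_majorant T x).

Definition majorant_sup T x : R := sup (concave_majorant T x @` `[0, T]%classic).

(* First time of maximum. For a càdlàg [x] the supremum fails to be attained
   only if [x] jumps downwards at the time [T]. *)
Definition majorant_argmax T x : R :=
  inf [set t | t \in `[0, T] /\ concave_majorant T x t = majorant_sup T x].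

End concave_majorant.

Lemma concave_majorantP (R : realType) (T : R) (x : R -> R) :
    (exists M, forall t : R, t \in `[0, T] -> x t <= M) ->
  [/\ concave_on T (concave_majorant T x),
      majorizes T x (concave_majorant T x) &
      forall f, concave_on T f -> majorizes T x f ->
        majorizes T (concave_majorant T x) f].
Proof.
move=> [M xM].
have ne t : [set f t | f in [set f | concave_on T f /\ majorizes T x f]] !=set0.
  exists M, (fun=> M); split=> // p a b _ _ /=.
  by rewrite convmm.
have lb t f : t \in `[0, T] -> concave_on T f -> majorizes T x f ->
    concave_majorant T x t <= f t.
  move=> tT cf mf; apply: ge_inf; last by exists f.
  by exists (x t) => _ [g [_ mg] <-]; exact: mg.
have mx : majorizes T x (concave_majorant T x).
  move=> t tT; apply: lb_le_inf; first exact: ne.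
  by move=> _ [g [_ mg] <-]; exact: mg.
split=> // [p a b aT bT|f cf mf t tT]; last exact: lb.
rewrite -convN lerN2; apply: lb_le_inf; first exact: ne.
move=> _ [f [cf mf] <-].
apply: (@le_trans _ _ (conv p (f a : R^o) (f b : R^o))).
  rewrite !convRE; apply: lerD; apply: ler_wpM2l => //.
  - by apply: lb => //; move: aT; rewrite inE.
  - by rewrite /unstable.onem subr_ge0.
  - by apply: lb => //; move: bT; rewrite inE.
by have := cf p a b aT bT; rewrite /= -convN lerN2.
Qed.

(* Main.v *)
(** The centred process [Y t = X t - mu * t] at a large time [T] has size [a T],
    and [a T = o(T)].  Tightness of [Y T / a T], the independence of increments and
    Ottaviani's inequality bound [sup_(t <= T) |Y t|] by [L * a T] outside a small
    event.  Comparing with the largest of [N] independent increments gives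
    [P(|Y T| > x) = O(1/N)] when [x] is of order [a (N * T)], and since [a] grows
    by a factor less than [2] along doublings, these tails are summable along a
    geometric sequence of times: for every slope [th > 0], outside a small event,
    [Y] increases by at most [x + th * t] from time [0], and likewise backwards
    from [T].

    On such paths everything is deterministic.  The concave majorant of [Y] is
    below [x + th * t] and [Y T + x + th * (T - t)].  A chord with time step [t] on
    which it increases by [w] has length [k * t + mu / k * w] up to
    [min (2 * |w|, w^2 / t)]: chords of slope at most [th] contribute at most [th]
    times the total variation, and by concavity the steeper ones lie near the
    ends of the interval, where the linear bounds control them by [x].  Hence the
    length is [k * T + mu / k * Y T] up to [3 * th * L * a T + 6 * x], which is
    negligible against [a T] when [th] is small.  If [mu > 0] the final value and
    the supremum are within [x] of [X T]; if [mu < 0] the supremum and its time are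
    functions of the path on a bounded time interval.

    In the latter case the joint convergence is Renyi's mixing property: the limit
    law of [Y T / a T] does not change under conditioning on an event [A].  This holds
    for events determined before a fixed time, because [a] is unbounded, and the
    events for which it holds form a lambda-system. *)

From HB Require Import structures.
Require Import Defs.
From mathcomp Require Import all_boot all_order all_algebra.
From mathcomp Require Import all_classical all_reals all_analysis.
From mathcomp Require Import measurable_realfun.
From mathcomp Require Import lra ring zify.

Set Implicit Arguments.
Unset Strict Implicit.
Unset Printing Implicit Defensive.

Import Order.TTheory GRing.Theory Num.Theory.
Import numFieldNormedType.Exports.

Local Open Scope classical_set_scope.
Local Open Scope ring_scope.

(** * Expectations without measurability *)

(** The length, supremum and maximum time of the majorant are not shown to be measurable in the
    outcome. Events are therefore bounded through measurable covers, and expectations of such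
    functionals are compared by monotonicity alone, against a measurable approximation. A maximal
    inequality on [0, T] needs control of [Y t] on the scale [a T] for all [t <= T], but tightness
    of [Y t / a t] does not give it: [a] is not assumed monotone, and the comparison of [a t] with
    [a T] is itself deduced from the maximal inequality. The circle is broken by independence: [Y t]
    and [Y T - Y t] are independent with a tight sum, so each is tight up to a centring constant.
    These constants are almost additive in [t] and almost zero at [T], hence all of order [a T]. No
    moment or tail bound on the jumps is available for the linear bounds. Probability is gained by
    lengthening time: [2 ^ n] blocks of length [b ^ n] are considered together, with [b] so large
    that the supremum over all of them is still [o(b ^ n)]; a single block is then exceptional with
    probability of order [2 ^ -n]. *)

Section integral_no_measurability.
Context d (Om : measurableType d) (R : realType) (P : probability Om R).

(** The integral of a nonnegative function is a supremum over the simple functions below it, hence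
    monotone for arbitrary functions; positive and negative parts give the general case. *)
Lemma le_integral_nomeas (f g : Om -> \bar R) :
  (forall w, f w <= g w)%E -> (\int[P]_w f w <= \int[P]_w g w)%E.
Proof.
have ge0 (u v : Om -> \bar R) : (forall w, 0 <= u w)%E ->
    (forall w, u w <= v w)%E -> (\int[P]_w u w <= \int[P]_w v w)%E.
  move=> u0 uv; have v0 w : (0 <= v w)%E by exact: le_trans (uv w).
  rewrite !ge0_integralTE//; apply: le_ereal_sup => _ [h hu <-].
  by exists h => // w; exact: le_trans (uv w).
move=> fg; rewrite integralE [leRHS]integralE; apply: leeB; apply: ge0 => // w.
  rewrite !funeposE ge_max; apply/andP; split.
    by apply: (le_trans (fg w)); rewrite le_max lexx.
  by rewrite le_max lexx orbT.
rewrite !funenegE ge_max; apply/andP; split.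
  by rewrite le_max leeN2 fg.
by rewrite le_max lexx orbT.
Qed.

Lemma le_expectation_nomeas (F G : Om -> R) :
  (forall w, F w <= G w) -> ('E_P[F] <= 'E_P[G])%E.
Proof.
move=> FG; rewrite unlock; apply: le_integral_nomeas => w.
by rewrite lee_fin.
Qed.

End integral_no_measurability.

(** Outer probability, witnessed by a measurable cover: the bad events involve suprema over
    intervals and concave majorants, whose measurability is not discussed. *)
Definition outer_le d (Om : measurableType d) (R : realType)
    (P : probability Om R) (A : set Om) (e : R) : Prop :=
  exists B, [/\ measurable B, A `<=` B & (P B <= e%:E)%E].

Section outer_le.
Context d (Om : measurableType d) (R : realType) (P : probability Om R).
Implicit Types (A B : set Om) (e : R).

Lemma outer_le_measurable A e : measurable A -> (P A <= e%:E)%E ->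
  outer_le P A e.
Proof. by move=> mA PA; exists A; split. Qed.

Lemma outer_leW A B e e' : A `<=` B -> e <= e' -> outer_le P B e ->
  outer_le P A e'.
Proof.
move=> AB ee' [C [mC BC PC]]; exists C; split => //; first exact: subset_trans BC.
by apply: (le_trans PC); rewrite lee_fin.
Qed.

Lemma outer_leU A B e e' : outer_le P A e -> outer_le P B e' ->
  outer_le P (A `|` B) (e + e').
Proof.
move=> [C [mC AC PC]] [D [mD BD PD]]; exists (C `|` D); split.
- exact: measurableU.
- exact: setUSS.
- rewrite EFinD; apply: le_trans (leeD PC PD).
  exact: measureU2.
Qed.

Lemma outer_le_negligible A : P.-negligible A -> outer_le P A 0.
Proof. by move=> [B [mB PB AB]]; exists B; split => //; rewrite PB. Qed.

Lemma outer_le_bigcup (A : nat -> set Om) (e : R) :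
  (forall n, outer_le P (A n) (e / (2 ^ n.+1)%:R)) -> outer_le P (\bigcup_n A n) e.
Proof.
move=> PA; have [B PB] := choice PA; exists (\bigcup_n B n); split.
- by apply: bigcupT_measurable => n; have [] := PB n.
- by apply: subset_bigcup => n _; have [] := PB n.
- have e0 : 0 <= e.
    have [_ _ h] := PB 0%N.
    have : (0 <= (e / (2 ^ 1)%:R)%:E)%E by apply: le_trans h; exact: measure_ge0.
    by rewrite lee_fin pmulr_lge0// invr_gt0 ltr0n expn_gt0.
  apply: le_trans (epsilon_trick0 xpredT e0).
  apply: le_trans (measure_sigma_subadditive _ _ _ (@subset_refl _ _)) _ => //.
  + by move=> n; have [] := PB n.
  + by apply: bigcupT_measurable => n; have [] := PB n.
  + by apply: lee_nneseries => [n _ _|n _]; [exact: measure_ge0|have [] := PB n].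
Qed.

Lemma outer_le_bigcup_nd (A : nat -> set Om) (e : R) :
  (forall n, measurable (A n)) -> nondecreasing_seq A ->
  (forall n, (P (A n) <= e%:E)%E) -> outer_le P (\bigcup_n A n) e.
Proof.
move=> mA ndA PA; exists (\bigcup_n A n); split => //.
  exact: bigcupT_measurable.
have := @nondecreasing_cvg_mu _ _ _ P A mA (bigcupT_measurable _ mA) ndA.
move=> /[dup] /cvgP cP /cvg_lim <-//.
by apply: lime_le => //; exact: nearW.
Qed.

Lemma outer_le_negligible0 A : (forall e, 0 < e -> outer_le P A e) ->
  P.-negligible A.
Proof.
move=> PA; have /choice[B PB] : forall n : nat, exists B,
    [/\ measurable B, A `<=` B & (P B <= (n.+1%:R^-1)%:E)%E].
  by move=> n; apply: PA; rewrite invr_gt0.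
have mB : measurable (\bigcap_n B n).
  by apply: bigcapT_measurable => n; have [] := PB n.
exists (\bigcap_n B n); split => //; last first.
  by move=> w Aw n _; have [_ h _] := PB n; exact: h.
apply/eqP; rewrite eq_le measure_ge0 andbT; apply/lee_addgt0Pr => e e0.
rewrite add0e; have [n ne] : exists n : nat, n.+1%:R^-1 < e.
  have := near_infty_natSinv_lt (PosNum e0) => -[n _ h].
  by exists n; apply: (h n) => /=.
have [mBn _ h] := PB n; apply: (@le_trans _ _ (P (B n))).
  by apply: le_measure; rewrite ?inE//; exact: bigcap_inf.
by apply: (le_trans h); rewrite lee_fin ltW.
Qed.

End outer_le.

Section real_valued_expectation.
Context d (Om : measurableType d) (R : realType) (P : probability Om R).

Lemma bounded_integrable (G : Om -> R) (M : R) : measurable_fun setT G ->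
  (forall w, `|G w| <= M) -> P.-integrable setT (EFin \o G).
Proof.
move=> mG GM; apply: (@le_integrable _ _ _ P setT measurableT _ (EFin \o cst M)).
- exact/measurable_EFinP.
- move=> w _ /=; rewrite lee_fin; apply: (le_trans (GM w)); exact: ler_norm.
- exact: finite_measure_integrable_cst.
Qed.

Lemma bounded_Lfun1 (G : Om -> R) (M : R) : measurable_fun setT G ->
  (forall w, `|G w| <= M) -> G \in Lfun P 1.
Proof. by move=> mG GM; apply/Lfun1_integrable; exact: bounded_integrable GM. Qed.

Lemma bounded_expectation_fin_num (F : Om -> R) (M : R) :
  (forall w, `|F w| <= M) -> ('E_P[F] \is a fin_num)%E.
Proof.
move=> FM.
have lo : ('E_P[cst (- M)%R] <= 'E_P[F])%E.
  by apply: le_expectation_nomeas => w; have := FM w; rewrite ler_norml => /andP[].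
have hi : ('E_P[F] <= 'E_P[cst M])%E.
  by apply: le_expectation_nomeas => w; have := FM w; rewrite ler_norml => /andP[].
rewrite !expectation_cst in lo hi.
by move: lo hi; case: ('E_P[F])%E => [r _ _| |]//=; rewrite leNgt ltry.
Qed.

Lemma le_fine_expectation (F G : Om -> R) (M N : R) :
  (forall w, `|F w| <= M) -> (forall w, `|G w| <= N) ->
  (forall w, F w <= G w) -> fine 'E_P[F]%E <= fine 'E_P[G]%E.
Proof.
move=> FM GM FG; apply: fine_le; try exact: bounded_expectation_fin_num.
exact: le_expectation_nomeas.
Qed.

(* Only [G] is measurable: the expectations of suprema over uncountable sets are
   controlled in this way without discussing their measurability. *)
Lemma expectation_approx (F G : Om -> R) (M de e : R) (A : set Om) :
  measurable_fun setT G -> (forall w, `|F w| <= M) -> (forall w, `|G w| <= M) ->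
  0 <= M -> 0 <= de -> outer_le P A e ->
  (forall w, ~ A w -> `|F w - G w| <= de) ->
  `|fine 'E_P[F] - fine 'E_P[G]| <= de + 2 * M * e.
Proof.
move=> mG FM GM M0 de0 [B [mB AB PB]] FG.
(* [b] dominates the error everywhere: [de], plus [2 * M] on the cover [B]. Additivity of the
   expectation is applied to the measurable [G] and [b] only; [F] is squeezed between [G - b] and
   [G + b]. *)
pose b : Om -> R := fun w => de + 2 * M * \1_B w.
have mI : measurable_fun setT (\1_B : Om -> R) by exact: measurable_indic.
have mb : measurable_fun setT b.
  by apply: measurable_funD => //; apply: measurable_funM.
have bB w : `|b w| <= de + 2 * M.
  have i0 : 0 <= \1_B w :> R by rewrite indicE; case: (_ \in _).
  have i1 : \1_B w <= 1 :> R by rewrite indicE; case: (_ \in _).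
  rewrite ger0_norm /b; last by rewrite addr_ge0// !mulr_ge0.
  by rewrite lerD2l ler_piMr// mulr_ge0.
have Eb : (fine 'E_P[b] <= de + 2 * M * e).
  have -> : ('E_P[b] = de%:E + (2 * M)%:E * P B)%E.
    rewrite /b (_ : (fun w => _) = cst de \+ (2 * M) \o* \1_B); last first.
      by apply/funext => w /=; rewrite mulrC.
    rewrite expectationD ?expectation_cst.
    - rewrite expectationZl ?expectation_indic//.
      by apply: (@bounded_Lfun1 _ 1) => // w; rewrite indicE; case: (_ \in _); rewrite ?normr1 ?normr0.
    - exact: (@bounded_Lfun1 _ `|de|).
    - apply: (@bounded_Lfun1 _ (2 * M)) => // [|w /=].
        exact: measurable_funM.
      by rewrite indicE; case: (_ \in _); rewrite ?mul1r ?mul0r ?normr0 ?mulr_ge0// ger0_norm// mulr_ge0.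
  have PBf : (P B \is a fin_num)%E by rewrite fin_num_measure.
  rewrite -(fineK PBf) -EFinM -EFinD /= lerD2l ler_wpM2l ?mulr_ge0//.
  by rewrite -lee_fin fineK.
have FGb w : `|F w - G w| <= b w.
  rewrite /b indicE; case: (boolP (w \in B)) => wB.
    rewrite mulr1 (le_trans (ler_normB _ _))//.
    by have := FM w; have := GM w; lra.
  rewrite mulr0 addr0; apply: FG => Aw; move: wB; rewrite notin_setE.
  by apply; exact: AB.
have MM : 0 <= M + (de + 2 * M) by rewrite !addr_ge0// mulr_ge0.
have GbM w : `|(G \+ b) w| <= M + (de + 2 * M).
  by rewrite (le_trans (ler_normD _ _))// lerD.
have GbM' w : `|(G \- b) w| <= M + (de + 2 * M).
  by rewrite (le_trans (ler_normB _ _))// lerD.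
have LG : G \in Lfun P 1 by exact: bounded_Lfun1 GM.
have Lb : b \in Lfun P 1 by exact: bounded_Lfun1 bB.
have EGf := bounded_expectation_fin_num GM.
have Ebf := bounded_expectation_fin_num bB.
have h1 : fine 'E_P[F] <= fine 'E_P[G \+ b].
  apply: (le_fine_expectation FM GbM) => w /=.
  by have := FGb w; rewrite ler_norml; lra.
have h2 : fine 'E_P[G \- b] <= fine 'E_P[F].
  apply: (le_fine_expectation GbM' FM) => w /=.
  by have := FGb w; rewrite ler_norml; lra.
rewrite expectationD// fineD// in h1.
rewrite expectationB// fineB// in h2.
by rewrite ler_norml; lra.
Qed.

End real_valued_expectation.

(** * Length of concave majorants *)

Section concave_functions.
Context {R : realType}.
Implicit Types (T : R) (f h x : R -> R).

(** Cross-multiplying the chord inequality removes the division by [u - s]: degenerate triples are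
    allowed and later uses reduce to polynomial arithmetic. *)
Lemma concave_onP T f : concave_on T f <->
  forall s t u : R, 0 <= s -> s <= t -> t <= u -> u <= T ->
    (u - t) * f s + (t - s) * f u <= (u - s) * f t.
Proof.
split=> [cf s t u s0 st tu uT|cf p a b].
  have [su|us] := ltP s u; last first.
    have -> : u = s by lra.
    have -> : t = s by lra.
    lra.
  have us0 : 0 < u - s by lra.
  have p01 : 0 <= (u - t) / (u - s) <= 1.
    by rewrite divr_ge0 ?ler_pdivrMr//= ?mul1r; lra.
  have pE : (Itv01 (andP p01).1 (andP p01).2)%:num = (u - t) / (u - s) by [].
  set p : {i01 R} := Itv01 _ _ in pE.
  have convE : (conv p (s : R^o) (u : R^o) : R) = t.
    by rewrite convRE pE /unstable.onem; field; lra.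
  have := cf p s u.
  rewrite !inE/= !in_itv/= s0 uT (le_trans st (le_trans tu uT)) (le_trans s0 (le_trans st tu)).
  move=> /(_ isT isT); rewrite -convN lerN2 !convRE pE /unstable.onem => h.
  have {}h : (u - t) / (u - s) * f s + (1 - (u - t) / (u - s)) * f u <= f t.
    by rewrite -[in leRHS]convE.
  rewrite -(ler_pM2l us0) in h; apply: le_trans h.
  by rewrite le_eqVlt; apply/orP; left; apply/eqP; field; lra.
rewrite !inE/= !in_itv/= => /andP[a0 aT] /andP[b0 bT].
have p0 : 0 <= p%:num by []. have p1 : p%:num <= 1 by [].
rewrite -convN lerN2 !convRE /unstable.onem.
have -> : f (conv p a b) = f (p%:num * a + (1 - p%:num) * b) by [].
set q := p%:num in p0 p1 *.
have [ab|ab|->] := ltgtP a b; last by rewrite (_ : q * b + (1 - q) * b = b); [lra|ring].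
- have := cf a (q * a + (1 - q) * b) b a0.
  have h1 : a <= q * a + (1 - q) * b by nra.
  have h2 : q * a + (1 - q) * b <= b by nra.
  move=> /(_ h1 h2 bT) h.
  have ba : 0 < b - a by lra.
  rewrite -(ler_pM2l ba); apply: le_trans h; lra.
- have := cf b (q * a + (1 - q) * b) a b0.
  have h1 : b <= q * a + (1 - q) * b by nra.
  have h2 : q * a + (1 - q) * b <= a by nra.
  move=> /(_ h1 h2 aT) h.
  have ba : 0 < a - b by lra.
  rewrite -(ler_pM2l ba); apply: le_trans h; lra.
Qed.

Lemma concave_on_affine T (a b : R) : concave_on T (fun t => a + b * t).
Proof. by apply/concave_onP => s t u *; lra. Qed.

Lemma concave_on_addl T f (b : R) :
  concave_on T f -> concave_on T (fun t => f t - b * t).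
Proof.
move=> /concave_onP cf; apply/concave_onP => s t u s0 st tu uT.
by have := cf s t u s0 st tu uT; lra.
Qed.

Lemma concave_majorant_le T x f t : (exists M, forall t : R, 0 <= t <= T -> x t <= M) ->
  concave_on T f -> (forall t : R, 0 <= t <= T -> x t <= f t) ->
  0 <= t <= T -> concave_majorant T x t <= f t.
Proof.
move=> xM cf xf tT; have [|_ _] := @concave_majorantP R T x; first exact: xM.
by apply.
Qed.

Lemma le_concave_majorant T x t : (exists M, forall t : R, 0 <= t <= T -> x t <= M) ->
  0 <= t <= T -> x t <= concave_majorant T x t.
Proof.
by move=> xM tT; have [|_ + _] := @concave_majorantP R T x; [exact: xM|apply].
Qed.

Lemma concave_on_concave_majorant T x :
  (exists M, forall t : R, 0 <= t <= T -> x t <= M) ->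
  concave_on T (concave_majorant T x).
Proof. by move=> xM; have [|//] := @concave_majorantP R T x; exact: xM. Qed.

Lemma concave_unimodal T h (p q r s : R) : concave_on T h ->
  0 <= p -> p < q -> q <= r -> r < s -> s <= T -> h q <= h p -> h s <= h r.
Proof.
move=> /concave_onP ch p0 pq qr rs sT hqp.
have h1 := ch p q r p0 (ltW pq) qr (le_trans (ltW rs) sT).
have h2 := ch q r s (le_trans p0 (ltW pq)) qr (ltW rs) sT.
have h3 : h r <= h q by nra.
(* For [r = q] the triple [q, r, s] is degenerate and yields nothing, so [p, q, s] is used
   instead. *)
have [qr'|rq] := ltP q r; first nra.
have rE : r = q by lra.
rewrite {}rE in rs h1 h2 h3 *.
have := ch p q s p0 (ltW pq) (ltW rs) sT; nra.
Qed.

End concave_functions.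

(** * Increments along a partition *)

Section path_sums.
Context {R : realType}.
Implicit Types (F : R -> R -> R) (a b : R) (s : seq R).

(** Indexed like [polygon_length], so that the length of an inscribed polygon is an instance by
    conversion. [b] is the default value of [nth] and is never returned, since the indices stay
    within [a :: s]. *)
Definition path_sum F b a s : R :=
  \sum_(0 <= n < size s) F (nth b (a :: s) n) (nth b (a :: s) n.+1).

Lemma path_sum_nil F b a : path_sum F b a [::] = 0.
Proof. by rewrite /path_sum big_geq. Qed.

Lemma path_sum_cons F b a c s :
  path_sum F b a (c :: s) = F a c + path_sum F b c s.
Proof. by rewrite /path_sum /= big_nat_recl. Qed.

Lemma path_sum_telescope (g : R -> R) b a s :
  path_sum (fun u v => g v - g u) b a s = g (last a s) - g a.
Proof.
elim: s a => [|c s ih] a; first by rewrite path_sum_nil subrr.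
by rewrite path_sum_cons ih/=; lra.
Qed.

Lemma path_sum_le F G b a s : path <%R a s ->
  (forall u v, a <= u -> u < v -> v <= last a s -> F u v <= G u v) ->
  path_sum F b a s <= path_sum G b a s.
Proof.
elim: s a => [|c s ih] a; first by rewrite !path_sum_nil.
move=> /= /andP[ac cs] FG; rewrite !path_sum_cons.
have cl : c <= last c s.
  elim: s c {ih ac FG} cs => //= e s ih c /andP[ce es].
  by apply: le_trans (ih _ es); exact: ltW.
apply: lerD; first exact: FG.
by apply: ih => // u v cu uv vl; apply: FG => //; apply: le_trans cu; exact: ltW.
Qed.

Lemma path_sumD F G b a s :
  path_sum (fun u v => F u v + G u v) b a s = path_sum F b a s + path_sum G b a s.
Proof. by rewrite /path_sum big_split. Qed.

Lemma path_sumZ (k : R) F b a s :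
  path_sum (fun u v => k * F u v) b a s = k * path_sum F b a s.
Proof. by rewrite /path_sum big_distrr. Qed.

Lemma concave_path_sum_le0 T h b a0 a s : concave_on T h -> 0 <= a0 -> a0 < a ->
  path <%R a s -> last a s <= T -> h a <= h a0 ->
  path_sum (fun u v => Num.max 0 (h v - h u)) b a s <= 0.
Proof.
move=> ch a00 a0a pa lT ha.
apply: (@le_trans _ _ (path_sum (fun _ _ => 0) b a s)); last by rewrite /path_sum big1.
apply: path_sum_le => // u v au uv vl; rewrite ge_max lexx subr_le0/=.
exact: (concave_unimodal ch a00 a0a au uv (le_trans vl lT)).
Qed.

(** A concave function increases and then decreases: its positive increments telescope until the
    first step that does not increase, and vanish afterwards. The bound is thus uniform over
    partitions. *)
Lemma concave_path_sum_pos T h M b a s : concave_on T h -> 0 <= a ->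
  path <%R a s -> last a s <= T -> (forall t : R, 0 <= t <= T -> h t <= M) ->
  path_sum (fun u v => Num.max 0 (h v - h u)) b a s <= M - h a.
Proof.
move=> ch + + + hM; elim: s a => [|c s ih] a a0 /=.
  by move=> _ aT; rewrite path_sum_nil subr_ge0 hM// a0.
move=> /andP[ac cs] lT; rewrite path_sum_cons.
have [hac|hca] := leP (h c) (h a).
  have := concave_path_sum_le0 b ch a0 ac cs lT hac.
  have aT : a <= T.
    apply: le_trans lT; apply: (le_trans (ltW ac)).
    elim: s c {ih ac hac} cs => //= e s ih c /andP[ce es].
    by apply: le_trans (ih _ es); exact: ltW.
  have := hM a; rewrite a0 aT => /(_ isT).
  by rewrite (_ : Num.max 0 (h c - h a) = 0); [lra|apply/max_idPl; lra].
have := ih c (le_trans a0 (ltW ac)) cs lT.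
by rewrite (_ : Num.max 0 (h c - h a) = h c - h a); [lra|apply/max_idPr; lra].
Qed.

End path_sums.

(** * Length of one chord, expanded around the slope [mu] *)

Section segment_length.
Context {R : realType}.
Variables mu k : R.
Hypothesis kE : k = Num.sqrt (1 + mu ^+ 2).

Lemma sqrt1Dsqr_sqr : k ^+ 2 = 1 + mu ^+ 2.
Proof. by rewrite kE sqr_sqrtr// addr_ge0// sqr_ge0. Qed.

Lemma sqrt1Dsqr_ge1 : 1 <= k.
Proof. by rewrite kE -[leLHS]sqrtr1 ler_wsqrtr// lerDl sqr_ge0. Qed.

Lemma sqrt1Dsqr_ge_norm : `|mu| <= k.
Proof. by rewrite kE -sqrtr_sqr ler_wsqrtr// lerDr. Qed.

Lemma mu_div_norm : `|mu / k| <= 1.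
Proof.
have k2 := sqrt1Dsqr_sqr; have k1 := sqrt1Dsqr_ge1; have mu_le_k := sqrt1Dsqr_ge_norm.
have k0 : 0 < k by lra.
by rewrite normrM normfV (gtr0_norm k0) ler_pdivrMr// mul1r.
Qed.

Lemma le_of_sqr (u v : R) : 0 <= v -> u ^+ 2 <= v ^+ 2 -> u <= v.
Proof. by move=> v0 uv; have [//|vu] := leP u v; nra. Qed.

Lemma sqrt_le (u v : R) : 0 <= v -> u <= v ^+ 2 -> Num.sqrt u <= v.
Proof.
move=> v0 uv; rewrite -[leRHS]ger0_norm// -sqrtr_sqr; exact: ler_wsqrtr.
Qed.

(** The left side is the scalar product of the chord [(t, mu * t + w)] with the unit vector
    [(1, mu) / k], so this is the Cauchy-Schwarz inequality. *)
Lemma segment_length_ge (t w : R) : 0 <= t ->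
  k * t + mu / k * w <= Num.sqrt (t ^+ 2 + (mu * t + w) ^+ 2).
Proof.
have k2 := sqrt1Dsqr_sqr; have k1 := sqrt1Dsqr_ge1; have mu_le_k := sqrt1Dsqr_ge_norm.
move=> t0; have k0 : k != 0 by rewrite gt_eqF//; lra.
have -> : k * t + mu / k * w = (t + mu * (mu * t + w)) / k.
  apply: (mulIf k0); rewrite mulfVK// mulrDl.
  by rewrite -(mulrA (mu / k)) (mulrC w) mulrA divfK//; have := k2; nra.
have kp : 0 < k by lra.
rewrite ler_pdivrMr//; apply: le_of_sqr; first by rewrite mulr_ge0 ?sqrtr_ge0// ltW.
rewrite exprMn sqr_sqrtr; last by rewrite addr_ge0// sqr_ge0.
rewrite k2; move: (mu * t + w) => z.
have := sqr_ge0 (mu * t - z); nra.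
Qed.

(** For steep chords: the triangle inequality gives [k * t + |w|], and [mu / k * w >= - |w|] because
    [|mu / k| <= 1]. *)
Lemma segment_length_le1 (t w : R) : 0 < t ->
  Num.sqrt (t ^+ 2 + (mu * t + w) ^+ 2) <= k * t + mu / k * w + 2 * `|w|.
Proof.
have k2 := sqrt1Dsqr_sqr; have k1 := sqrt1Dsqr_ge1; have mu_le_k := sqrt1Dsqr_ge_norm.
move=> t0; have m1 := mu_div_norm.
have hw : `|mu / k * w| <= `|w| by rewrite normrM ler_piMl.
have hw' : - `|w| <= mu / k * w by have := ler_norml (mu / k * w) `|w|; rewrite hw => /esym/andP[].
apply: (@le_trans _ _ (k * t + `|w|)); last lra.
apply: sqrt_le; first by rewrite addr_ge0// mulr_ge0//; lra.
have w2 : `|w| ^+ 2 = w ^+ 2 by rewrite real_normK// num_real.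
have h1 : mu * w <= k * `|w|.
  by apply: (le_trans (ler_norm _)); rewrite normrM ler_wpM2r.
have h2 := k2; have [q qE] : exists q : R, q = `|w| by eexists.
rewrite -{}qE in w2 h1 *.
have : t * (mu * w) <= t * (k * q) by rewrite ler_wpM2l// ltW.
have : k ^+ 2 * t ^+ 2 = (1 + mu ^+ 2) * t ^+ 2 by rewrite h2.
by rewrite (_ : (k * t + q) ^+ 2 = k ^+ 2 * t ^+ 2 + 2 * (t * (k * q)) + q ^+ 2); [lra|ring].
Qed.

(** For flat chords: a second-order expansion in the slope excess [s = w / t]. After division by [t]
    and squaring, the gap is [s ^ 2 * ((s + m) ^ 2 + 2 * k - 1)] with [m = mu / k], nonnegative
    because [k >= 1]. *)
Lemma segment_length_le2 (t w : R) : 0 < t ->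
  Num.sqrt (t ^+ 2 + (mu * t + w) ^+ 2) <= k * t + mu / k * w + w ^+ 2 / t.
Proof.
have k2 := sqrt1Dsqr_sqr; have k1 := sqrt1Dsqr_ge1; have mu_le_k := sqrt1Dsqr_ge_norm.
move=> t0; have m1 := mu_div_norm; have kp : 0 < k by lra.
have [s wE] : exists s, w = s * t by exists (w / t); rewrite divfK// gt_eqF.
have [m mE] : exists m, m = mu / k by exists (mu / k).
rewrite -mE in m1 *.
have muE : mu = m * k by rewrite mE divfK// gt_eqF.
have m2 : k ^+ 2 * m ^+ 2 = k ^+ 2 - 1.
  by rewrite -exprMn mulrC -muE k2; lra.
have m2' : m ^+ 2 <= 1 by rewrite -[m ^+ 2]real_normK ?num_real// expr_le1.
have -> : k * t + m * w + w ^+ 2 / t = t * (k + m * s + s ^+ 2).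
  by rewrite wE; field; rewrite gt_eqF.
have pos : 0 <= k + m * s + s ^+ 2.
  have := sqr_ge0 (s + m / 2); have : (s + m / 2) ^+ 2 = s ^+ 2 + m * s + m ^+ 2 / 4 by field.
  by lra.
apply: sqrt_le; first by rewrite mulr_ge0// ltW.
rewrite wE muE (_ : m * k * t + s * t = (m * k + s) * t); last by ring.
rewrite [X in X <= _](_ : _ = t ^+ 2 * (1 + (m * k + s) ^+ 2)); last by ring.
rewrite exprMn ler_wpM2l ?sqr_ge0//.
have [->|s0] := eqVneq s 0; first by have := m2; rewrite !(mulr0, addr0, expr0n)/= exprMn; lra.
rewrite -subr_ge0 (_ : _ - _ = (k ^+ 2 - 1 - k ^+ 2 * m ^+ 2) +
  s ^+ 2 * ((s + m) ^+ 2 + (2 * k - 1))); last by ring.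
rewrite m2 subrr add0r mulr_ge0 ?sqr_ge0// addr_ge0 ?sqr_ge0//; lra.
Qed.

(** The quadratic bound is used for [|w| <= 2 * t] and the linear one beyond. The excess over slope
    [th] is written with positive parts because these are increments of the tilted functions
    [g - th * t] and [- g - th * t], whose sums along a partition can be controlled by concavity. *)
Lemma segment_length_le (th t w : R) : 0 <= th -> 0 < t ->
  Num.sqrt (t ^+ 2 + (mu * t + w) ^+ 2) <= k * t + mu / k * w +
    (th * `|w| + 2 * Num.max 0 (w - th * t) + 2 * Num.max 0 (- w - th * t)).
Proof.
have k2 := sqrt1Dsqr_sqr; have k1 := sqrt1Dsqr_ge1; have mu_le_k := sqrt1Dsqr_ge_norm.
move=> th0 t0; have l1 := segment_length_le1 w t0.
have l2 := segment_length_le2 w t0.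
have [S SE] : exists S : R, S = Num.sqrt (t ^+ 2 + (mu * t + w) ^+ 2) by eexists.
rewrite -SE in l1 l2 *.
have [M1 M1E] : exists M : R, M = Num.max 0 (w - th * t) by eexists.
have [M2 M2E] : exists M : R, M = Num.max 0 (- w - th * t) by eexists.
have M1a : 0 <= M1 by rewrite M1E le_max lexx.
have M2a : 0 <= M2 by rewrite M2E le_max lexx.
have M1b : w - th * t <= M1 by rewrite M1E le_max lexx orbT.
have M2b : - w - th * t <= M2 by rewrite M2E le_max lexx orbT.
rewrite -M1E -M2E.
have M12 : `|w| - th * t <= M1 + M2.
  by have [w0|w0] := ger0P w; lra.
have tht : 0 <= th * t by rewrite mulr_ge0// ltW.
have w2 : w ^+ 2 = `|w| ^+ 2 by rewrite real_normK// num_real.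
have : 0 <= `|w| by []. rewrite w2 in l2.
have [q qE] : exists q : R, q = `|w| by eexists.
rewrite -qE in l1 l2 M12 *; move=> q0.
have [wt|wt] := leP q (th * t).
  have : q ^+ 2 / t <= th * q by rewrite ler_pdivrMr// expr2 mulrAC ler_wpM2r.
  lra.
have [wt2|wt2] := leP q (2 * t).
  have : q ^+ 2 / t <= th * q + 2 * (q - th * t).
    rewrite ler_pdivrMr//; nra.
  lra.
have : 2 * (th * t) <= th * q by nra.
lra.
Qed.

End segment_length.

(** * The majorant of a single good path *)

Section majorant_length_bounds.
Context {R : realType}.
Variables (mu k T A e th : R) (x f y g : R -> R).
Hypotheses (T0 : 0 < T) (e0 : 0 <= e) (th0 : 0 <= th) (x0 : x 0 = 0).
Hypotheses (kE : k = Num.sqrt (1 + mu ^+ 2)) (fE : f = concave_majorant T x).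
Hypotheses (yE : forall t, y t = x t - mu * t) (gE : forall t, g t = f t - mu * t).
Hypothesis yA : forall t : R, 0 <= t <= T -> `|y t| <= A.
Hypothesis ye : forall t : R, 0 <= t <= T -> y t <= e + th * t.
Hypothesis yT : forall t : R, 0 <= t <= T -> y t <= y T + e + th * (T - t).

Lemma majorant_bounded : exists M, forall t : R, 0 <= t <= T -> x t <= M.
Proof.
exists (A + `|mu| * T) => t tT; have := yA tT; rewrite ler_norml yE => /andP[_].
have [t0 t1] := andP tT.
have : mu * t <= `|mu| * T.
  apply: (le_trans (ler_norm _)); rewrite normrM (ger0_norm t0).
  by rewrite ler_wpM2l.
lra.
Qed.

Let T_in : 0 <= T <= T. Proof. by rewrite lexx ltW. Qed.
Let z_in : (0 : R) <= 0 <= T. Proof. by rewrite lexx ltW. Qed.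

(** An affine bound on [y] becomes, after the drift is restored, an affine and hence concave
    function above [x], so it also lies above the majorant. [gA], [ge] and [gT] differ only in the
    affine function. *)
Let gA (t : R) : 0 <= t <= T -> g t <= A.
Proof.
move=> tT; have : f t <= A + mu * t.
  rewrite fE. refine (concave_majorant_le majorant_bounded (@concave_on_affine R T A mu) _ tT) => s sT.
  by have := yA sT; rewrite ler_norml yE; lra.
by rewrite gE; lra.
Qed.

Let ge (t : R) : 0 <= t <= T -> g t <= e + th * t.
Proof.
move=> tT; have : f t <= e + (mu + th) * t.
  rewrite fE.
  refine (concave_majorant_le majorant_bounded (@concave_on_affine R T e (mu + th)) _ tT) => s sT.
  by have := ye sT; rewrite yE; lra.
by rewrite gE; lra.
Qed.

Let gT (t : R) : 0 <= t <= T -> g t <= y T + e + th * (T - t).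
Proof.
move=> tT; have : f t <= (y T + e + th * T) + (mu - th) * t.
  rewrite fE.
  refine (concave_majorant_le majorant_bounded (@concave_on_affine R T _ (mu - th)) _ tT) => s sT.
  by have := yT sT; rewrite !yE; lra.
by rewrite gE; lra.
Qed.

Let yg (t : R) : 0 <= t <= T -> y t <= g t.
Proof. by move=> tT; have := le_concave_majorant majorant_bounded tT; rewrite yE gE fE; lra. Qed.

Lemma majorant_end : x T <= f T <= x T + e.
Proof. by have := yg T_in; have := gT T_in; rewrite !gE !yE; lra. Qed.

(** The backward bound reads [f t <= x T + e - (mu - th) * (T - t)], and for [th <= mu] its right
    side is largest at [t = T]. *)
Lemma majorant_sup_drift : th <= mu -> x T <= majorant_sup T x <= x T + e.
Proof.
rewrite /majorant_sup -fE.
move=> thmu; have ub t : 0 <= t <= T -> f t <= x T + e.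
  move=> tT; have := gT tT; rewrite gE yE.
  have : (mu - th) * (T - t) >= 0 by rewrite mulr_ge0; lra.
  lra.
apply/andP; split.
  have /andP[h _] := majorant_end; apply: (le_trans h).
  apply: ub_le_sup; last by exists T => //=; rewrite in_itv/=.
  exists (x T + e); apply/ubP => _ [t /= + <-]; rewrite in_itv/= => tT; exact: ub.
apply: sup_le_ub; first by exists (f 0), 0 => //=; rewrite in_itv/=.
by apply/ubP => _ [t /= + <-]; rewrite in_itv/= => tT; exact: ub.
Qed.

Let cg : concave_on T g.
Proof.
have -> : g = (fun t => f t - mu * t) by apply/funext.
by apply: concave_on_addl; rewrite fE; exact: concave_on_concave_majorant majorant_bounded.
Qed.

(** Origin of the [5 + th] multiples of [e]: one from replacing [g T - g 0] by [y T], two from the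
    steep ascents, two from the steep descents, and [th] from the total variation. *)
Let polygon_le s : path <%R 0 s -> last 0 s = T ->
  polygon_length 0 T f s <= k * T + mu / k * y T + 3 * th * A + (5 + th) * e.
Proof.
move=> ps lT.
have lT' : last 0 s <= T by rewrite lT.
pose Q u v : R := th * `|g v - g u| + 2 * Num.max 0 ((g v - th * v) - (g u - th * u))
  + 2 * Num.max 0 (- (g v - g u) - th * (v - u)).
have tele h : path_sum (fun u v => h v - h u) T 0 s = h T - h 0.
  by rewrite path_sum_telescope lT.
have step1 : polygon_length 0 T f s <=
    path_sum (fun u v => ((k * v + mu / k * g v) - (k * u + mu / k * g u)) + Q u v) T 0 s.
  rewrite -[leLHS]/(path_sum (fun u v => Num.sqrt ((v - u) ^+ 2 + (f v - f u) ^+ 2)) T 0 s).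
  apply: path_sum_le => // u v u0 uv vT.
  have d0 : 0 < v - u by lra.
  have := segment_length_le kE (g v - g u) th0 d0.
  rewrite (_ : mu * (v - u) + (g v - g u) = f v - f u); last by rewrite !gE; lra.
  move=> h; apply: (le_trans h); rewrite /Q le_eqVlt; apply/orP; left; apply/eqP.
  by rewrite (_ : g v - g u - th * (v - u) = g v - th * v - (g u - th * u)); [ring|ring].
have absE (h : R -> R) u v : `|h v - h u| = 2 * Num.max 0 (h v - h u) - (h v - h u).
  by have [h0|h0] := ger0P (h v - h u); lra.
(* Total variation is twice the positive variation minus the net increment; then [g <= A],
   [g 0 >= 0] and [g T >= - A] are used. *)
have sum_abs : path_sum (fun u v => `|g v - g u|) T 0 s <= 3 * A + e.
  have -> : (fun u v => `|g v - g u|) =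
      (fun u v => 2 * Num.max 0 (g v - g u) + (-1) * (g v - g u)).
    by apply/funext => u; apply/funext => v; rewrite absE; ring.
  rewrite path_sumD !path_sumZ tele.
  have := concave_path_sum_pos T cg (lexx 0) ps lT' gA.
  have := yg z_in; rewrite (yE 0) x0 mulr0 subrr => g00.
  have := yg T_in; have := gT T_in; have := yA T_in; rewrite ler_norml => /andP[h1 h2].
  lra.
(* Steep ascents are the positive increments of the concave function [g - th * t], which starts at
   or above 0 and stays below [e]. *)
have sum_p : path_sum (fun u v => Num.max 0 ((g v - th * v) - (g u - th * u))) T 0 s <= e.
  have h t : 0 <= t <= T -> g t - th * t <= e by move=> tT; have := ge tT; lra.
  have := concave_path_sum_pos T (concave_on_addl th cg) (lexx 0) ps lT' h.
  have := yg z_in; rewrite (yE 0) x0 mulr0 subrr; lra.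
(* Steep descents are the negative increments of [g + th * t]. By [max 0 (- z) = max 0 z - z] they
   equal the positive variation minus the net increment, and the backward bound leaves at most
   [y T + e - g T <= e]. *)
have sum_m : path_sum (fun u v => Num.max 0 (- (g v - g u) - th * (v - u))) T 0 s <= e.
  have cg' := concave_on_addl (- th) cg.
  have -> : (fun u v => Num.max 0 (- (g v - g u) - th * (v - u))) =
    (fun u v => Num.max 0 ((g v - (- th) * v) - (g u - (- th) * u)) +
      (-1) * ((g v - (- th) * v) - (g u - (- th) * u))).
    apply/funext => u; apply/funext => v.
    set z := g v - - th * v - (g u - - th * u).
    rewrite (_ : - (g v - g u) - th * (v - u) = - z); last by rewrite /z; ring.
    have [h0|h0] := leP 0 z; first by rewrite (max_idPl _); lra.
    by rewrite (max_idPr _); lra.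
  have h t : 0 <= t <= T -> g t - (- th) * t <= y T + e + th * T.
    by move=> tT; have := gT tT; lra.
  rewrite path_sumD path_sumZ (tele (fun t => g t - (- th) * t)).
  have := concave_path_sum_pos T cg' (lexx 0) ps lT' h.
  have := yg T_in; lra.
apply: (le_trans step1).
rewrite path_sumD (tele (fun t => k * t + mu / k * g t)) !path_sumD !path_sumZ.
have m1 := mu_div_norm kE.
have h3 : mu / k * (g T - g 0) <= mu / k * y T + e.
  have d : `|g T - g 0 - y T| <= e.
    have := yg T_in; have := gT T_in; have := yg z_in; have := ge z_in.
    rewrite (yE 0) x0 mulr0 subrr => *; rewrite ler_norml; lra.
  have : `|mu / k * (g T - g 0 - y T)| <= e.
    by rewrite normrM; apply: le_trans d; rewrite ler_piMl.
  by rewrite ler_norml => /andP[_]; lra.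
have : th * path_sum (fun u v => `|g v - g u|) T 0 s <= th * (3 * A + e).
  by rewrite ler_wpM2l.
lra.
Qed.

(** Every inscribed polygon obeys the upper bound; for the lower bound the single chord from 0 to
    [T] is enough. *)
Lemma majorant_length_approx :
  `|majorant_length T x - (k * T + mu / k * y T)| <= 3 * th * A + (5 + th) * e.
Proof.
have ub : ubound [set polygon_length 0 T f s | s in itv_partition 0 T]
    (k * T + mu / k * y T + 3 * th * A + (5 + th) * e).
  by apply/ubP => _ [s [ps /eqP lT] <-]; exact: polygon_le.
have mem : [set polygon_length 0 T f s | s in itv_partition 0 T]
    (polygon_length 0 T f [:: T]).
  by exists [:: T] => //; exact: itv_partition1.
have h1 : majorant_length T x <= k * T + mu / k * y T + 3 * th * A + (5 + th) * e.
  rewrite /majorant_length /graph_length -fE.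
  by apply: sup_le_ub => //; exists (polygon_length 0 T f [:: T]).
have h2 : polygon_length 0 T f [:: T] <= majorant_length T x.
  rewrite /majorant_length /graph_length -fE.
  by apply: ub_le_sup => //; eexists; exact: ub.
have h3 : k * T + mu / k * (g T - g 0) <= polygon_length 0 T f [:: T].
  have := segment_length_ge kE (g T - g 0) (ltW T0).
  rewrite /polygon_length /= big_nat1/= subr0.
  by rewrite (_ : mu * T + (g T - g 0) = f T - f 0)//; rewrite !gE; lra.
have m1 := mu_div_norm kE.
have h4 : mu / k * y T - e <= mu / k * (g T - g 0).
  have d : `|g T - g 0 - y T| <= e.
    have := yg T_in; have := gT T_in; have := yg z_in; have := ge z_in.
    rewrite (yE 0) x0 mulr0 subrr => *; rewrite ler_norml; lra.
  have : `|mu / k * (g T - g 0 - y T)| <= e.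
    by rewrite normrM; apply: le_trans d; rewrite ler_piMl.
  by rewrite ler_norml => /andP[]; lra.
have A0 : 0 <= A by apply: le_trans (yA T_in).
have := mulr_ge0 th0 A0; have := mulr_ge0 th0 e0.
by rewrite ler_norml; lra.
Qed.

End majorant_length_bounds.

(** * Maximal inequality for Levy processes *)

Section independence_tools.
Context d (Om : measurableType d) (R : realType) (P : probability Om R).

(** Inequalities between deterministic constants, such as centrings, are obtained by evaluating at
    one outcome that avoids all the bad events. *)
Lemma outer_le_ex (A : set Om) (e : R) : outer_le P A e -> e < 1 -> exists w, ~ A w.
Proof.
move=> [B [mB AB PB]] e1; apply: contrapT => /forallNP hA.
have BT : B = setT by apply/seteqP; split => // w _; apply: AB; exact: contrapT (hA w).
by move: PB; rewrite BT probability_setT lee_fin leNgt e1.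
Qed.

Lemma outer_leP (A : set Om) (e : R) : measurable A ->
  outer_le P A e <-> (P A <= e%:E)%E.
Proof.
move=> mA; split=> [[B [mB AB PB]]|]; last exact: outer_le_measurable.
by apply: le_trans PB; apply: le_measure; rewrite ?inE.
Qed.

Lemma indep_lambda_system (C : set Om) : measurable C ->
  lambda_system setT [set A | measurable A /\ (P (A `&` C) = P A * P C)%E].
Proof.
move=> mC; split => //.
- by split => //; rewrite setTI probability_setT mul1e.
- move=> A B BA [mA hA] [mB hB]; split; first exact: measurableD.
  have fin (D : set Om) : measurable D -> (P D < +oo)%E.
    by move=> mD; rewrite (le_lt_trans (probability_le1 P mD))// ltry.
  have -> : (A `\` B) `&` C = (A `&` C) `\` B by apply/seteqP; split => w /=; tauto.
  rewrite measureD//; [|exact: measurableI|exact/fin/measurableI].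
  rewrite measureD//; last exact: fin.
  have -> : A `&` C `&` B = B `&` C.
    by apply/seteqP; split => w /=; have := BA w; tauto.
  have -> : A `&` B = B by apply/setIidr.
  change ((P (A `&` C) - P (B `&` C))%E = ((P A - P B) * P C)%E).
  rewrite hA hB muleBl//.
    by rewrite fin_num_measure.
  by rewrite fin_num_adde_defr// fin_num_measure.
- move=> F ndF mF; split; first by apply: bigcupT_measurable => n; have [] := mF n.
  have mFn n : measurable (F n) by have [] := mF n.
  have mU : measurable (\bigcup_n F n) by exact: bigcupT_measurable.
  have h1 : P (F n `&` C) @[n --> \oo] --> P (\bigcup_n F n `&` C).
    rewrite setI_bigcupl; apply: nondecreasing_cvg_mu.
    + by move=> n; exact: measurableI.
    + by apply: bigcupT_measurable => n; exact: measurableI.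
    + by move=> m n mn; apply/subsetPset; apply: setSI; apply/subsetPset; exact: ndF.
  have h2 : (P (F n) * P C)%E @[n --> \oo] --> (P (\bigcup_n F n) * P C)%E.
    apply: cvgeZr; first by rewrite fin_num_measure.
    exact: nondecreasing_cvg_mu.
  have e : (fun n => P (F n `&` C)) = (fun n => (P (F n) * P C)%E).
    by apply/funext => n; have [] := mF n.
  by rewrite e in h1; exact: cvg_unique h1 h2.
Qed.

(** By Fubini, if for every value [v] of [V] the event [D < |U + v|] had probability at least
    [2 * eta], then so would [D < |U + V|]. Some [v] is therefore good and [c = - v] works; the
    factor 2 provides the strict inequality. *)
Lemma indep_concentration (U V : Om -> R) (D eta : R) :
  measurable_fun setT U -> measurable_fun setT V ->
  (forall B B', measurable B -> measurable B' ->
     (P (U @^-1` B `&` V @^-1` B') = P (U @^-1` B) * P (V @^-1` B'))%E) ->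
  0 < eta -> outer_le P [set w | D < `|U w + V w|] eta ->
  exists c, outer_le P [set w | D < `|U w - c|] (2 * eta).
Proof.
move=> mU mV UV eta0 hUV; apply: contrapT => /forallNP hc.
pose VU w := (V w, U w).
have mVU : measurable_fun setT VU by exact: measurable_fun_pair.
pose fV : {RV P >-> R} := HB.pack V (isMeasurableFun.Build _ _ _ _ V mV).
pose fU : {RV P >-> R} := HB.pack U (isMeasurableFun.Build _ _ _ _ U mU).
pose fVU : {RV P >-> (R * R)%type} := HB.pack VU (isMeasurableFun.Build _ _ _ _ VU mVU).
pose S := [set z : R * R | D < `|z.2 + z.1|].
have mS : measurable S.
  rewrite -[S]setTI.
  have mf : measurable_fun setT (fun z : R * R => `|z.2 + z.1|).
    by apply: measurableT_comp => //; apply: measurable_funD.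
  have := mf measurableT `]D, +oo[%classic (measurable_itv _).
  by congr measurable; apply/seteqP; split => z /=; rewrite in_itv/= andbT.
have prodE := @product_measure_unique _ _ _ _ _ (distribution P fV) (distribution P fU)
  (distribution P fVU).
have {}prodE : ((distribution P fV \x distribution P fU) S = distribution P fVU S)%E.
  apply: prodE => // A B mA mB.
  rewrite /distribution/= /pushforward muleC -UV//; congr (P _).
  by apply/seteqP; split => w /= [].
have mUc c : measurable [set w | D < `|U w - c|].
  have mf : measurable_fun setT (fun w => `|U w - c|).
    by apply: measurableT_comp => //; apply: measurable_funB.
  have := mf measurableT `]D, +oo[%classic (measurable_itv _).
  by rewrite setTI; congr measurable; apply/seteqP; split => z /=; rewrite in_itv/= andbT.
have lo v : ((2 * eta)%:E <= (distribution P fU \o xsection S) v)%E.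
  rewrite leNgt; apply/negP => h; apply: (hc (- v)).
  apply/outer_leP; first exact: mUc.
  apply: le_trans (ltW h); rewrite /= /distribution /pushforward le_eqVlt; apply/orP; left.
  apply/eqP; congr (P _); apply/seteqP; split => w /=.
    by rewrite opprK => hw; rewrite /xsection/= inE /S/=.
  by rewrite /xsection/= inE /S/= opprK.
have : ((2 * eta)%:E <= (distribution P fV \x distribution P fU) S)%E.
  rewrite /product_measure1/=.
  have -> : ((2 * eta)%:E = \int[distribution P fV]_x (cst (2 * eta)%:E) x)%E.
    transitivity ((2 * eta)%:E * 1)%E; first by rewrite mule1.
    rewrite integral_cst//; congr (_ * _)%E; exact/esym/(probability_setT (distribution P fV)).
  by apply: le_integral_nomeas => v; exact: lo.
rewrite prodE /distribution/= /pushforward; apply/negP; rewrite -ltNge.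
apply: (@le_lt_trans _ _ eta%:E); last by rewrite lte_fin; lra.
have -> : fVU @^-1` S = [set w | D < `|U w + V w|] by [].
apply/outer_leP => //.
have mf : measurable_fun setT (fun w => `|U w + V w|).
  by apply: measurableT_comp => //; apply: measurable_funD.
have := mf measurableT `]D, +oo[%classic (measurable_itv _).
by rewrite setTI; congr measurable; apply/seteqP; split => z /=; rewrite in_itv/= andbT.
Qed.

End independence_tools.

(** * Independence of the centred increments and Ottaviani's inequality on a grid *)

Section levy.
Context d (Om : measurableType d) (R : realType) (P : probability Om R).
Variables (X : R -> {RV P >-> R}) (mu : R).
Hypothesis hX : levy_process P X.

Definition centred (t : R) (w : Om) : R := X t w - mu * t.
Local Notation Y := centred.

Lemma measurable_centred t : measurable_fun setT (Y t).
Proof. by apply: measurable_funB => //; exact: measurable_funPT. Qed.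

Lemma measurable_centred_incr s t : measurable_fun setT (fun w => Y s w - Y t w).
Proof. by apply: measurable_funB; exact: measurable_centred. Qed.

Lemma measurable_preimage (f : Om -> R) (B : set R) :
  measurable_fun setT f -> measurable B -> measurable (f @^-1` B).
Proof. by move=> mf mB; rewrite -[_ @^-1` _]setTI; exact: mf. Qed.

Lemma measurable_norm_gt (f : Om -> R) (x : R) :
  measurable_fun setT f -> measurable [set w | x < `|f w|].
Proof.
move=> mf; have mf' : measurable_fun setT (fun w => `|f w|) by exact: measurableT_comp.
have := measurable_preimage mf' (measurable_itv `]x, +oo[).
by congr measurable; apply/seteqP; split => z /=; rewrite in_itv/= andbT.
Qed.

Lemma centred_stationary s h (B : set R) : 0 <= s -> 0 <= h -> measurable B ->
  P [set w | B (Y (s + h) w - Y s w)] = P [set w | B (Y h w)].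
Proof.
move=> s0 h0 mB.
have mB' : measurable [set z : R | B (z - mu * h)].
  have mf : measurable_fun setT (fun z : R => z - mu * h) by exact: measurable_funB.
  by have := mf measurableT _ mB; rewrite setTI.
have := levy_stationary hX s0 h0 mB'; rewrite /preimage/= => <-.
congr (P _); apply/seteqP; split => w /=; rewrite /Y.
  by rewrite (_ : X (s + h) w - mu * (s + h) - (X s w - mu * s) = X (s + h) w - X s w - mu * h)//; ring.
by rewrite (_ : X (s + h) w - mu * (s + h) - (X s w - mu * s) = X (s + h) w - X s w - mu * h)//; ring.
Qed.

Lemma centred_independent (n : nat) (t : nat -> R) (B : nat -> set R) :
  0 <= t 0%N -> (forall i, t i <= t i.+1) -> (forall i, measurable (B i)) ->
  (P [set w | forall i, (i < n)%N -> B i (Y (t i.+1) w - Y (t i) w)%R] =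
   \prod_(i < n) P [set w | B i (Y (t i.+1) w - Y (t i) w)%R])%E.
Proof.
move=> t0 tS mB.
pose B' (i : 'I_n) := [set z : R | B i (z - mu * (t i.+1 - t i))].
have mB' i : measurable (B' i).
  have mf : measurable_fun setT (fun z : R => z - mu * (t i.+1 - t i)).
    exact: measurable_funB.
  by have := mf measurableT _ (mB i); rewrite setTI.
have E i w : B i (Y (t i.+1) w - Y (t i) w) = B i (X (t i.+1) w - X (t i) w - mu * (t i.+1 - t i)).
  by congr (B i _); rewrite /Y; ring.
have := @levy_indep _ _ _ _ _ hX n t t0 tS B' mB'.
rewrite (_ : \bigcap_i _ = [set w | forall i, (i < n)%N -> B i (Y (t i.+1) w - Y (t i) w)%R]); last first.
  apply/seteqP; split => w /= h.
    by move=> i iltn; have := h (Ordinal iltn) I; rewrite E.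
  by move=> i _; rewrite /B'/= -E; exact: h.
move=> ->; apply: eq_bigr => i _; congr (P _).
by apply/seteqP; split => w; rewrite /B' /= -E.
Qed.

(** The pi-system of cylinders on the first [n] increments along [t]; it generates their
    sigma-algebra, in which the value at the initial time is not included. *)
Definition incr_boxes (t : nat -> R) (n : nat) : set (set Om) :=
  [set [set w | forall i, (i < n)%N -> B i (Y (t i.+1) w - Y (t i) w)%R] |
    B in [set B : nat -> set R | forall i, measurable (B i)]].

Lemma incr_boxes_measurable t n A : incr_boxes t n A -> measurable A.
Proof.
move=> [B mB <-].
rewrite (_ : [set w | _] = \bigcap_(i in `I_n) ((fun w => Y (t i.+1) w - Y (t i) w) @^-1` B i))//.
apply: bigcap_measurableType => i _; apply: measurable_preimage => //.
exact: measurable_centred_incr.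
Qed.

Lemma setI_closed_incr_boxes t n : setI_closed (incr_boxes t n).
Proof.
move=> _ _ [B mB <-] [C mC <-]; exists (fun i => B i `&` C i).
  by move=> i; exact: measurableI.
apply/seteqP; split => w /=.
  by move=> h; split => i /h[].
by move=> [h1 h2] i iltn; split; [exact: h1|exact: h2].
Qed.

(** On a box the last increment is just one more independent increment, once [T] is appended to the
    grid; the pi-lambda theorem extends this to the generated sigma-algebra. *)
Lemma block_independence (t : nat -> R) (n : nat) (T : R) (A : set Om) (B : set R) :
  0 <= t 0%N -> (forall i, t i <= t i.+1) -> t n <= T ->
  <<s incr_boxes t n >> A -> measurable B ->
  (measurable A /\ P (A `&` [set w | B (Y T w - Y (t n) w)%R]) =
   P A * P [set w | B (Y T w - Y (t n) w)%R])%E.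
Proof.
move=> t0 tS tT sA mB.
have mC : measurable [set w | B (Y T w - Y (t n) w)%R].
  exact: measurable_preimage (measurable_centred_incr _ _) mB.
suff : <<s incr_boxes t n >> `<=` [set A | measurable A /\
    (P (A `&` [set w | B (Y T w - Y (t n) w)%R]) =
    P A * P [set w | B (Y T w - Y (t n) w)%R])%E] by apply.
apply: (lambda_system_subset (@setI_closed_incr_boxes t n) (indep_lambda_system P mC)) => //.
move=> _ [C mC' <-]; split.
  by apply: (@incr_boxes_measurable t n); exists C.
(* The grid is [t] up to index [n] and constantly [T] afterwards, so increment number [n] is
   [Y T - Y (t n)], and [C'] constrains it by [B]. *)
pose t' i := if (i <= n)%N then t i else T.
pose C' i := if (i < n)%N then C i else B.
have t'S i : t' i <= t' i.+1.
  rewrite /t'; case: (leqP i.+1 n) => [h|h]; first by rewrite (ltnW h).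
  case: (leqP i n) => // h'; have -> // : i = n.
  by apply/eqP; rewrite eqn_leq h' -ltnS.
have mC'' i : measurable (C' i) by rewrite /C'; case: ifP.
have t'0 : 0 <= t' 0%N by [].
have := centred_independent n.+1 t'0 t'S mC''.
rewrite (_ : [set w | _] = [set w | forall i, (i < n)%N -> C i (Y (t i.+1) w - Y (t i) w)]
  `&` [set w | B (Y T w - Y (t n) w)%R]); last first.
  apply/seteqP; split => w /=.
    move=> h; split.
      move=> i iltn; have := h i (ltnW iltn).
      by rewrite /C' /t' iltn (ltnW iltn).
    by have := h n (ltnSn n); rewrite /C' /t' ltnn leqnn.
  move=> [h1 h2] i; rewrite ltnS leq_eqVlt => /predU1P[->|iltn].
    by rewrite /C' /t' ltnn leqnn.
  by rewrite /C' /t' iltn (ltnW iltn); exact: h1.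
move=> ->; rewrite big_ord_recr/= /C' /t' !ltnn leqnn; congr (_ * _)%E.
rewrite centred_independent//; apply: eq_bigr => i _.
by rewrite ltn_ord (ltnW (ltn_ord i)).
Qed.

Lemma incr_measurable_boxes t n i B : (i < n)%N -> measurable B ->
  <<s incr_boxes t n >> [set w | B (Y (t i.+1) w - Y (t i) w)].
Proof.
move=> iltn mB; apply: sub_sigma_algebra.
exists (fun j => if j == i then B else setT).
  by move=> j; case: ifP.
apply/seteqP; split => w /=.
  by move=> /(_ i iltn); rewrite eqxx.
by move=> h j _; case: eqP => [->|].
Qed.

Lemma partial_sum_measurable_boxes t n j : (j <= n)%N ->
  @measurable_fun _ _ (g_sigma_algebraType (incr_boxes t n)) R setT
    (fun w => Y (t j) w - Y (t 0%N) w).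
Proof.
elim: j => [_|j ih jn].
  by under eq_fun do rewrite subrr; exact: measurable_cst.
rewrite (_ : (fun w => _) = (fun w => (Y (t j.+1) w - Y (t j) w) + (Y (t j) w - Y (t 0%N) w))).
  apply: measurable_funD; last by apply: ih; exact: ltnW.
  by move=> _ B mB; rewrite setTI; exact: incr_measurable_boxes.
by apply/funext => w; rewrite subrKA.
Qed.

(** Decomposition at the first passage above [2 * x]: the remaining increment is independent of the
    past and at most [x] with probability at least 1/2, in which case the final increment still
    exceeds [x]. *)
Lemma ottaviani_grid (s T x : R) (N : nat) : 0 <= s -> 0 <= T -> (0 < N)%N ->
  (forall j, (j <= N)%N -> outer_le P [set w | x < `|Y (j%:R * T / N%:R) w|] 2^-1) ->
  (P [set w | exists2 j, (j <= N)%N & (2 * x < `|Y (s + j%:R * T / N%:R) w - Y s w|)%R] <=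
   2%:E * P [set w | x < `|Y T w|]%R)%E.
Proof.
move=> s0 T0 N0 hN.
pose t i := s + i%:R * T / N%:R.
have tE0 : t 0%N = s by rewrite /t !mul0r addr0.
have tEN : t N = s + T by rewrite /t mulrAC divff ?mul1r// pnatr_eq0 -lt0n.
have tS i : t i <= t i.+1.
  by rewrite /t lerD2l ler_wpM2r ?invr_ge0// ler_wpM2r// ler_nat.
have mY a b (z : R) := @measurable_norm_gt _ z (measurable_centred_incr a b).
pose F := [set w | x < `|Y (t N) w - Y s w|]%R.
have PF : P F = P [set w | x < `|Y T w|]%R.
  rewrite /F tEN; apply: (@centred_stationary s T [set z | x < `|z|]%R) => //.
  have := @measurable_norm_gt.
  have mf : measurable_fun setT (fun z : R => `|z|) by [].
  move=> _; have := mf measurableT `]x, +oo[%classic (measurable_itv _).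
  by rewrite setTI; congr measurable; apply/seteqP; split => z /=; rewrite in_itv/= andbT.
(* Passage strictly before index [j], so that [E N.+1] covers all the indices up to [N]. The claim
   is proved by induction on [j], the new part [A] being the first passage at [j]. *)
pose E j := [set w | exists2 i, (i < j)%N & (2 * x < `|Y (t i) w - Y s w|)%R].
suff main j : (j <= N.+1)%N -> measurable (E j) /\
    (P (E j) <= 2%:E * P (E j `&` F))%E.
  have [mE hE] := main N.+1 (leqnn _); apply: (le_trans hE).
  rewrite -PF; apply: lee_wpmul2l => //; apply: le_measure; rewrite ?inE.
  - by apply: measurableI => //; exact: mY.
  - exact: mY.
  - exact: subIsetr.
elim: j => [_|j ih jN].
  have -> : E 0%N = set0 by apply/seteqP; split => w //= [].
  by split=> //; rewrite set0I measure0 mule0.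
have [mE hE] := ih (ltnW jN).
pose A := [set w | 2 * x < `|Y (t j) w - Y s w|]%R `\` E j.
have EA : E j.+1 = E j `|` A.
  apply/seteqP; split => w /=.
    move=> [i]; rewrite ltnS leq_eqVlt => /predU1P[->|ij] h.
      by have [|n] := pselect (E j w); [left|right].
    by left; exists i.
  move=> [[i ij h]|[h _]]; last by exists j.
  by exists i => //; exact: leqW.
have mA : measurable A by apply: measurableD.
have EA0 : E j `&` A = set0 by apply/seteqP; split => w //= [? []].
have sD (i : nat) : (i <= j)%N ->
    @measurable _ (g_sigma_algebraType (incr_boxes t j)) [set w | 2 * x < `|Y (t i) w - Y s w|]%R.
  move=> ij; have := @partial_sum_measurable_boxes t j i ij; rewrite tE0 => mf.
  have mf' : @measurable_fun _ _ (g_sigma_algebraType (incr_boxes t j)) R setT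
    (fun w => `|Y (t i) w - Y s w|) by exact: measurableT_comp.
  have := mf' measurableT `]2 * x, +oo[%classic (measurable_itv _).
  by rewrite setTI; congr measurable; apply/seteqP; split => z /=; rewrite in_itv/= andbT.
have sA : <<s incr_boxes t j >> A.
  have : @measurable _ (g_sigma_algebraType (incr_boxes t j)) A; last by [].
  apply: measurableD; first exact: sD.
  rewrite (_ : E j = \bigcup_(i in `I_j) [set w | 2 * x < `|Y (t i) w - Y s w|]%R); last first.
    by apply/seteqP; split => w [i ij h]; exists i.
  by apply: bigcup_measurable => i /= /ltnW; exact: sD.
pose B := [set z : R | `|z| <= x].
have mB : measurable B.
  rewrite (_ : B = `[- x, x]%classic) //.
  by apply/seteqP; split => z; rewrite /B /= in_itv/= ler_norml.
have tjN : t j <= t N.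
  by rewrite /t lerD2l ler_wpM2r ?invr_ge0// ler_wpM2r// ler_nat -ltnS.
have t00 : 0 <= t 0%N by rewrite tE0.
have [_ hAC] := block_independence t00 tS tjN sA mB.
pose C := [set w | B (Y (t N) w - Y (t j) w)].
have mC : measurable C by exact: measurable_preimage (measurable_centred_incr _ _) mB.
(* By stationarity the remaining increment has the law of [Y] after [N - j] grid steps, where the
   hypothesis applies. *)
have PC : ((2^-1)%:E <= P C)%E.
  have CE : C = ~` [set w | x < `|Y (t N) w - Y (t j) w|]%R.
    by apply/seteqP; split => w /=; rewrite /C/B/=; [move=> h; apply/negP; rewrite -leNgt|
      move=> /negP; rewrite -leNgt].
  rewrite CE (probability_setC P (mY (t N) (t j) x)).
  have h0 : 0 <= t j by rewrite (le_trans s0)// /t lerDl divr_ge0// mulr_ge0.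
  have tNE : t N = t j + (N - j)%:R * T / N%:R.
    rewrite /t natrB -1?ltnS//; ring.
  have h1 : 0 <= (N - j)%:R * T / N%:R by rewrite divr_ge0// mulr_ge0.
  have mG : measurable [set z : R | x < `|z|]%R.
    have mf : measurable_fun setT (fun z : R => `|z|) by [].
    have := mf measurableT `]x, +oo[%classic (measurable_itv _).
    by rewrite setTI; congr measurable; apply/seteqP; split => z /=; rewrite in_itv/= andbT.
  have := centred_stationary h0 h1 mG; rewrite -tNE /= => ->.
  have /outer_leP : outer_le P [set w | x < `|Y ((N - j)%:R * T / N%:R) w|] 2^-1.
    by apply: hN; rewrite leq_subr.
  move=> /(_ (measurable_norm_gt _ (measurable_centred _))) h.
  rewrite leeBrDr; last by rewrite ge0_fin_numE// (le_lt_trans h)// ltry.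
  apply: (le_trans (leeD2l _ h)); rewrite -EFinD lee_fin; lra.
have PA : (P A <= 2%:E * P (A `&` F))%E.
  have h1 : (P (A `&` C) <= P (A `&` F))%E.
    apply: le_measure; rewrite ?inE; [exact: measurableI|by apply: measurableI; [|exact: mY]|].
    move=> w [[h1 h2] h3]; split => //; rewrite /F /=.
    move: h1 h3; rewrite /C /B /= => h1 h3.
    have := ler_normB (Y (t N) w - Y s w) (Y (t N) w - Y (t j) w).
    rewrite (_ : Y (t N) w - Y s w - (Y (t N) w - Y (t j) w) = Y (t j) w - Y s w); last by ring.
    lra.
  apply: (@le_trans _ _ (2%:E * (P A * (2^-1)%:E))%E).
    rewrite muleCA -EFinM divff// mule1//.
  rewrite lee_pmul2l//; apply: le_trans h1; rewrite hAC; exact: lee_wpmul2l.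
rewrite EA; split; first exact: measurableU.
rewrite measureU// setIUl measureU//.
- rewrite muleDr//; last first.
    by rewrite fin_num_adde_defl// fin_num_measure//; apply: measurableI => //; exact: mY.
  exact: leeD.
- by apply: measurableI => //; exact: mY.
- by apply: measurableI => //; exact: mY.
- by rewrite setIACA EA0 set0I.
Qed.

End levy.

(** * From dyadic grids to continuous time *)

Section dyadic.
Context {R : realType}.

Lemma exp2_gt (x : R) : exists n : nat, x < (2 ^ n)%:R.
Proof.
exists (Num.truncn x).+1; apply: lt_le_trans (truncnS_gt x) _.
by rewrite ler_nat; exact/ltnW/ltn_expl.
Qed.

Lemma dyadic_between (T u v : R) : 0 < T -> 0 <= u -> u < v -> v <= T ->
  exists n j, [/\ (j <= 2 ^ n)%N, u < j%:R * T / (2 ^ n)%:R & j%:R * T / (2 ^ n)%:R < v].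
Proof.
move=> T0 u0 uv vT; have vu : 0 < v - u by lra.
have [n hn] := exp2_gt (T / (v - u)).
have N0 : (0 : R) < (2 ^ n)%:R by rewrite ltr0n expn_gt0.
pose j := (Num.truncn (u * (2 ^ n)%:R / T)).+1.
have h1 : u < j%:R * T / (2 ^ n)%:R.
  rewrite ltr_pdivlMr// -ltr_pdivrMr//; exact: truncnS_gt.
have h2 : j%:R * T / (2 ^ n)%:R < v.
  have hj : j%:R <= u * (2 ^ n)%:R / T + 1.
    rewrite -[j]addn1 natrD lerD2r.
    have x0 : 0 <= u * (2 ^ n)%:R / T by rewrite divr_ge0 ?mulr_ge0// ltW.
    by have /andP[] := truncn_itv x0.
  rewrite ltr_pdivrMr//; apply: (@le_lt_trans _ _ ((u * (2 ^ n)%:R / T + 1) * T)).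
    by rewrite ler_wpM2r// ltW.
  rewrite mulrDl divfK ?gt_eqF// mul1r.
  rewrite ltr_pdivrMr// in hn; nra.
exists n, j; split => //.
have : j%:R * T / (2 ^ n)%:R < T by lra.
rewrite ltr_pdivrMr// mulrC ltr_pM2l// ltr_nat; exact: ltnW.
Qed.

End dyadic.

Section levy.
Context d (Om : measurableType d) (R : realType) (P : probability Om R).
Variables (X : R -> {RV P >-> R}) (mu : R).
Hypothesis hX : levy_process P X.
Local Notation Y := (centred X mu).

Definition regular_path (w : Om) : Prop :=
  X 0 w = 0 /\ forall t, 0 <= t -> X s w @[s --> t^'+] --> X t w.

Lemma irregular_negligible : P.-negligible [set w | ~ regular_path w].
Proof.
have h1 := levy_start hX; have h2 := levy_cadlag hX.
have : {ae P, forall w, regular_path w}.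
  by apply: filterS2 h1 h2 => w ? [? _].
by [].
Qed.

Lemma outer_le_regular (A : set Om) (e : R) :
  outer_le P [set w | regular_path w /\ A w] e -> outer_le P A e.
Proof.
move=> h; have := outer_leU h (outer_le_negligible irregular_negligible).
rewrite addr0; apply: outer_leW => // w Aw.
by have [r|nr] := pselect (regular_path w); [left|right].
Qed.

Lemma regular_right_gt (w : Om) (s u z : R) : regular_path w -> 0 <= u ->
  z < `|Y u w - s| -> exists2 e, 0 < e & forall v, u <= v < u + e -> z < `|Y v w - s|.
Proof.
move=> [_ rw] u0 zu.
have cv : `|Y v w - s| @[v --> u^'+] --> `|Y u w - s|.
  apply: cvg_norm; apply: cvgB; last exact: cvg_cst.
  apply: cvgB; first exact: rw.
  apply: cvgM; first exact: cvg_cst.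
  exact: cvg_at_right_filter cvg_id.
have /cvgrPdist_lt/(_ (`|Y u w - s| - z)) := cv.
rewrite subr_gt0 => /(_ zu) [e e0 he].
exists e => // v /andP[]; rewrite le_eqVlt => /predU1P[<-//|uv] ve.
have := he v; rewrite /ball_/= => /(_ _ uv); rewrite ltr0_norm; last by lra.
by move=> /(_ ltac:(lra)); rewrite ltr_norml; lra.
Qed.

(** A strict exceedance at [u < T] persists on an interval to the right of [u], which contains a
    grid point; [u = T] is a grid point itself. *)
Lemma sup_grid (s T z : R) (w : Om) : regular_path w -> 0 <= s -> 0 <= T ->
  (exists2 u, 0 <= u <= T & z < `|Y (s + u) w - Y s w|) ->
  exists n j, (j <= 2 ^ n)%N /\ z < `|Y (s + j%:R * T / (2 ^ n)%:R) w - Y s w|.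
Proof.
move=> rw s0 T0 [u /andP[u0 uT] zu].
move: uT; rewrite le_eqVlt => /predU1P[uE|uT].
  exists 0%N, 1%N; split => //.
  by rewrite expn0 mul1r divr1 -uE.
have [e e0 he] := regular_right_gt rw (addr_ge0 s0 u0) zu.
have uv : u < Num.min T (u + e) by rewrite lt_min uT ltrDl.
have T0' : 0 < T by exact: le_lt_trans uT.
have mT : Num.min T (u + e) <= T by rewrite ge_min lexx.
have [n [j [jn h1 h2]]] := dyadic_between T0' u0 uv mT.
exists n, j; split => //; apply: he.
move: h2; rewrite lt_min => /andP[_ h2]; lra.
Qed.

(** The dyadic grids are nested, so the grid events increase; the uniform bound passes to their
    union, which contains the continuous-time event on regular paths. *)
Lemma ottaviani (s T x eta : R) : 0 <= s -> 0 <= T ->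
  (forall n j, (j <= 2 ^ n)%N ->
     outer_le P [set w | x < `|Y (j%:R * T / (2 ^ n)%:R) w|] 2^-1) ->
  outer_le P [set w | x < `|Y T w|] eta ->
  outer_le P [set w | exists2 u, 0 <= u <= T & 2 * x < `|Y (s + u) w - Y s w|] (2 * eta).
Proof.
move=> s0 T0 hN hT; apply: outer_le_regular.
pose E n := [set w | exists2 j, (j <= 2 ^ n)%N &
  2 * x < `|Y (s + j%:R * T / (2 ^ n)%:R) w - Y s w|].
have := @outer_le_bigcup_nd _ _ _ P E (2 * eta).
have EU : [set w | regular_path w /\ exists2 u, 0 <= u <= T & 2 * x < `|Y (s + u) w - Y s w|]
    `<=` \bigcup_n E n.
  by move=> w [rw /(sup_grid rw s0 T0)[n [j [jn h]]]]; exists n => //; exists j.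
move=> h; apply: outer_leW EU (lexx _) (h _ _ _).
- move=> n; rewrite (_ : E n = \bigcup_(j in `I_(2 ^ n).+1)
    [set w | 2 * x < `|Y (s + j%:R * T / (2 ^ n)%:R) w - Y s w|]); last first.
    by apply/seteqP; split => w [j jn h']; exists j.
  by apply: bigcup_measurable => j _; exact: measurable_norm_gt (measurable_centred_incr _ _ _ _).
- apply/nondecreasing_seqP => n; apply/subsetPset => w [j jn h'].
  exists (2 * j)%N; first by rewrite expnS leq_mul2l.
  rewrite expnS !natrM (_ : 2%:R * j%:R * T / (2%:R * (2 ^ n)%:R) = j%:R * T / (2 ^ n)%:R)//.
  by field; rewrite ?pnatr_eq0 -?lt0n ?expn_gt0.
- move=> n; have N0 : (0 < 2 ^ n)%N by rewrite expn_gt0.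
  apply: (le_trans (ottaviani_grid hX s0 T0 N0 (hN n))).
  have /outer_leP h' := hT; rewrite EFinM lee_pmul2l//; apply: h'.
  exact: measurable_norm_gt (measurable_centred _ _ _).
Qed.

Lemma stationary_norm_gt (s h c x e : R) : 0 <= s -> 0 <= h ->
  outer_le P [set w | x < `|Y h w - c|] e ->
  outer_le P [set w | x < `|Y (s + h) w - Y s w - c|] e.
Proof.
move=> s0 h0.
have mf (f : Om -> R) : measurable_fun setT f -> measurable [set w : Om | x < `|f w - c|].
  by move=> mf; apply: measurable_norm_gt; apply: measurable_funB.
have mB : measurable [set z : R | x < `|z - c|].
  have mf' : measurable_fun setT (fun z : R => `|z - c|).
    by apply: measurableT_comp => //; apply: measurable_funB.
  have := mf' measurableT `]x, +oo[%classic (measurable_itv _).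
  by rewrite setTI; congr measurable; apply/seteqP; split => z /=; rewrite in_itv/= andbT.
move=> /outer_leP-/(_ (mf _ (measurable_centred _ _ _))) H.
apply/outer_leP; first exact: mf (measurable_centred_incr _ _ _ _).
by have := centred_stationary mu hX s0 h0 mB => /= ->.
Qed.

(** Only the sum of [Y t] and the independent remainder [Y T - Y t] is controlled, so [Y t]
    concentrates around a constant that is not identified here. *)
Lemma centred_concentration (t T D eta : R) : 0 <= t <= T -> 0 < eta ->
  outer_le P [set w | D < `|Y T w|] eta ->
  exists c, outer_le P [set w | D < `|Y t w - c|] (2 * eta).
Proof.
move=> /andP[t0 tT] eta0 hT.
pose U w := Y t w - Y 0 w; pose V w := Y T w - Y t w.
have UV (B B' : set R) : measurable B -> measurable B' ->
     (P (U @^-1` B `&` V @^-1` B') = P (U @^-1` B) * P (V @^-1` B'))%E.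
  move=> mB mB'.
  pose tt (i : nat) : R := if i is i'.+1 then (if i' is 0%N then t else T) else 0.
  pose BB (i : nat) := if i is 0%N then B else B'.
  have tt0 : 0 <= tt 0%N by [].
  have ttS i : tt i <= tt i.+1 by case: i => [//|[//|i]] /=.
  have mBB i : measurable (BB i) by case: i.
  have := centred_independent mu hX 2 tt0 ttS mBB.
  rewrite big_ord_recl big_ord1 /= => <-; congr (P _).
  apply/seteqP; split => w /=.
    by move=> [h1 h2] [|[|]].
  by move=> h; split; [exact: (h 0%N)|exact: (h 1%N)].
have T0 : 0 <= T by exact: le_trans tT.
have hUV : outer_le P [set w | D < `|U w + V w|] eta.
  have := @stationary_norm_gt 0 T 0 D eta (lexx 0) T0.
  rewrite (_ : [set w | D < `|Y T w - 0|] = [set w | D < `|Y T w|]); last first.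
    by apply/seteqP; split => w /=; rewrite subr0.
  move=> /(_ hT).
  have E w : Y (0 + T) w - Y 0 w - 0 = U w + V w by rewrite /U /V add0r; ring.
  rewrite (_ : [set w | _] = [set w | D < `|U w + V w|])//.
  by apply/seteqP; split => w /=; rewrite E.
have [||c hc] := @indep_concentration _ _ _ P U V D eta _ _ UV eta0 hUV.
- exact: measurable_centred_incr.
- exact: measurable_centred_incr.
exists c; apply/outer_leP.
  by apply: measurable_norm_gt; apply: measurable_funB => //; exact: measurable_centred.
have mU : measurable [set w | D < `|U w - c|].
  by apply: measurable_norm_gt; apply: measurable_funB => //; exact: measurable_centred_incr.
have /outer_leP -/(_ mU) {}hc := hc; apply: le_trans hc.
have mB : measurable [set z : R | D < `|z - c|].
  have mf' : measurable_fun setT (fun z : R => `|z - c|).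
    by apply: measurableT_comp => //; apply: measurable_funB.
  have := mf' measurableT `]D, +oo[%classic (measurable_itv _).
  by rewrite setTI; congr measurable; apply/seteqP; split => z /=; rewrite in_itv/= andbT.
by have := centred_stationary mu hX (lexx 0) t0 mB; rewrite add0r => /= <-.
Qed.

(* The centring constants are almost additive along the grid and almost vanish
   at its end, hence they are bounded by a multiple of [D]. *)
Lemma grid_tight (T D eta : R) (N : nat) : 0 <= T -> (0 < N)%N -> 0 < eta <= 10^-1 ->
  outer_le P [set w | D < `|Y T w|] eta -> forall j, (j <= N)%N ->
  outer_le P [set w | 14 * D < `|Y (j%:R * T / N%:R) w|] (2 * eta).
Proof.
move=> T0 N0 /andP[eta0 eta1] hT.
pose t (j : nat) := j%:R * T / N%:R.
have NR : (0 : R) < N%:R by rewrite ltr0n.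
have t0 j : 0 <= t j by rewrite /t divr_ge0// mulr_ge0.
have tN : t N = T by rewrite /t mulrAC divff ?mul1r// gt_eqF.
have tT j : (j <= N)%N -> 0 <= t j <= T.
  move=> jN; rewrite t0 -tN /t ler_wpM2r ?invr_ge0// ler_wpM2r// ler_nat//.
have tD i j : t (i + j)%N = t i + t j by rewrite /t natrD !mulrDl.
have D0 : 0 <= D.
  have [w /= /negP] := outer_le_ex hT ltac:(lra).
  by rewrite -leNgt; exact: le_trans.
have [c hc] : exists c : nat -> R, forall j, (j <= N)%N ->
    outer_le P [set w | D < `|Y (t j) w - c j|] (2 * eta).
  suff /choice[c hc] : forall j, exists c : R, (j <= N)%N ->
    outer_le P [set w | D < `|Y (t j) w - c|] (2 * eta) by exists c.
  move=> j; have [jN|] := boolP (j <= N)%N; last by exists 0.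
  have [c hc] := centred_concentration (tT j jN) eta0 hT.
  by exists c.
(* The three bad events have total probability at most [6 * eta < 1]; at an outcome avoiding them
   each variable is within [D] of its constant, and the increments add up exactly. *)
have cD i j : (i + j <= N)%N -> `|c (i + j)%N - c i - c j| <= 3 * D.
  move=> ijN; have iN : (i <= N)%N by lia. have jN : (j <= N)%N by lia.
  have := outer_leU (outer_leU (hc _ iN) (hc _ ijN)) (stationary_norm_gt (t0 i) (t0 j) (hc _ jN)).
  rewrite -tD => /outer_le_ex[|w]; first lra.
  move=> /not_orP[/not_orP[/negP h1 /negP h2] /negP h3].
  rewrite -!leNgt !ler_norml in h1 h2 h3 *; lra.
have cN : `|c N| <= 2 * D.
  have := outer_leU (hc _ (leqnn N)) hT; rewrite -tN.
  move=> /outer_le_ex[|w]; first lra.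
  move=> /not_orP[/negP h1 /negP h2].
  rewrite -!leNgt !ler_norml in h1 h2 *; lra.
(* At the index [jmax] maximizing [|c j|], either [jmax] or [N - jmax] can be doubled within the
   grid. In the first case [2 * |c jmax| <= |c jmax| + 3 * D]; in the second [|c jmax| <= 2 * D + 3
   * D + (|c jmax| + 3 * D) / 2], whence 13. *)
have cB : forall j, (j <= N)%N -> `|c j| <= 13 * D.
  pose jmax := [arg max_(j > (ord0 : 'I_N.+1)) `|c j|]%O.
  have jmaxP j : (j <= N)%N -> `|c j| <= `|c jmax|.
    move=> jN; rewrite /jmax; case: arg_maxP => //= i _ /(_ (inord j) isT).
    by rewrite inordK// ltnS.
  suff h : `|c jmax| <= 13 * D by move=> j jN; exact: le_trans (jmaxP j jN) h.
  have half j : (j + j <= N)%N -> 2 * `|c j| <= `|c jmax| + 3 * D.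
    move=> jj; have := cD _ _ jj; have := jmaxP _ jj.
    have -> : 2 * `|c j| = `|2 * c j| by rewrite normrM ger0_norm.
    rewrite !ler_norml => *; lra.
  have jN : (jmax <= N)%N by rewrite -ltnS.
  have [h|h] := leqP (jmax + jmax) N.
    have := half _ h; lra.
  have h' : ((N - jmax) + (N - jmax) <= N)%N by lia.
  have := half _ h'; have := cD jmax (N - jmax)%N.
  rewrite subnKC// => /(_ (leqnn _)).
  move: cN; rewrite -[`|c jmax|]/(`|c (nat_of_ord jmax)|).
  have n1 := ler_normB (c N) (c (N - jmax)%N).
  have n2 := ler_normB (c N - c (N - jmax)%N) (c N - c jmax - c (N - jmax)%N).
  rewrite (_ : c N - c (N - jmax)%N - (c N - c jmax - c (N - jmax)%N) = c jmax) in n2; last by ring.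
  lra.
move=> j jN; apply: outer_leW (hc j jN) => // w /= h.
have := ler_normD (Y (t j) w - c j) (c j); rewrite subrK => h'.
have := cB j jN; rewrite -/(t j) in h; lra.
Qed.

(** At every grid time [14 * D] is exceeded with probability at most [2 * eta <= 1/2], as
    Ottaviani's inequality requires; its factor 2 gives 28. *)
Lemma levy_maximal_inequality (s T D eta : R) : 0 <= s -> 0 <= T -> 0 < eta <= 10^-1 ->
  outer_le P [set w | D < `|Y T w|] eta ->
  outer_le P [set w | exists2 u, 0 <= u <= T & 28 * D < `|Y (s + u) w - Y s w|] (2 * eta).
Proof.
move=> s0 T0 eta01 hT.
have D0 : 0 <= D.
  have [|w /= /negP] := outer_le_ex hT; first lra.
  by rewrite -leNgt; exact: le_trans.
have := @ottaviani s T (14 * D) eta s0 T0.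
rewrite (_ : 2 * (14 * D) = 28 * D); last by ring.
apply; last by apply: outer_leW hT => // w /=; lra.
move=> n j jn; have N0 : (0 < 2 ^ n)%N by rewrite expn_gt0.
by apply: outer_leW (grid_tight T0 N0 eta01 hT jn) => //; lra.
Qed.

End levy.

(** * Convergence in law *)

Section limits_at_infinity.
Context {R : realType}.

Lemma cvg_pinfty_leP (u : R -> R) (l : R) :
  u T @[T --> +oo] --> l <->
  (forall e, 0 < e -> exists T0, forall T, T0 < T -> `|u T - l| <= e).
Proof.
split=> [/cvgrPdist_le h e e0|h].
  have [T0 [_ hT]] := h e e0; exists T0 => T TT0.
  by rewrite distrC; exact: hT.
apply/cvgrPdist_le => e e0; have [T0 hT] := h e e0.
exists T0; split; first exact: num_real.
by move=> T TT0; rewrite distrC; exact: hT.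
Qed.

Lemma cvge_pinfty_leP (u : R -> \bar R) (l : \bar R) :
  (forall T, u T \is a fin_num) -> l \is a fin_num ->
  (u T @[T --> +oo] --> l) <->
  (forall e, 0 < e -> exists T0, forall T, T0 < T -> `|fine (u T) - fine l| <= e).
Proof.
move=> fu fl; rewrite -cvg_pinfty_leP -[in X in X <-> _](fineK fl); split=> [|h].
  by move/fine_cvgP => [_].
by apply/fine_cvgP; split => //; exact: nearW.
Qed.

End limits_at_infinity.

Section convergence_in_law.
Context d1 d2 (Om1 : measurableType d1) (Om2 : measurableType d2) (R : realType).
Variables (P : probability Om1 R) (Q : probability Om2 R).

Lemma cvg_in_lawP (V : topologicalType) (Y : R -> Om1 -> V) (Z : Om2 -> V) :
  cvg_in_law P Q Y Z <->
  forall f : V -> R, continuous f -> (exists M, forall v, `|f v| <= M) ->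
    forall e, 0 < e -> exists T0, forall T, T0 < T ->
      `|fine 'E_P[f \o Y T] - fine 'E_Q[f \o Z]| <= e.
Proof.
split=> h f cf fM; have [M hM] := fM.
  by apply/cvge_pinfty_leP; [move=> T| |exact: h];
    apply: (@bounded_expectation_fin_num _ _ _ _ _ M) => w; exact: hM.
apply/cvge_pinfty_leP; [move=> T| |exact: h];
  apply: (@bounded_expectation_fin_num _ _ _ _ _ M) => w; exact: hM.
Qed.

(** A continuous cutoff, 0 for [|x| <= u] and 1 for [|x| >= v]: the bounded test function that turns
    convergence in law into tail estimates. *)
Definition ramp (u v x : R) : R := Num.max 0 (Num.min 1 ((`|x| - u) / (v - u))).

Lemma continuous_ramp u v : continuous (ramp u v).
Proof.
move=> x; apply: (@continuous_max _ _ (fun=> 0) (fun x => Num.min 1 ((`|x| - u) / (v - u)))).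
  exact: cvg_cst.
apply: (@continuous_min _ _ (fun=> 1) (fun x => (`|x| - u) / (v - u))).
  exact: cvg_cst.
apply: cvgM; last exact: cvg_cst.
by apply: cvgB; [exact: norm_continuous|exact: cvg_cst].
Qed.

Lemma ramp_ge0 u v x : 0 <= ramp u v x.
Proof. by rewrite /ramp le_max lexx. Qed.

Lemma ramp_le1 u v x : ramp u v x <= 1.
Proof. by rewrite /ramp ge_max ler01 ge_min lexx. Qed.

Lemma ramp_norm_le1 u v x : `|ramp u v x| <= 1.
Proof. by rewrite ger0_norm ?ramp_ge0// ramp_le1. Qed.

Lemma ramp1 u v x : u < v -> v <= `|x| -> ramp u v x = 1.
Proof.
move=> uv vx; rewrite /ramp (min_idPl _) ?(max_idPr _)//.
by rewrite ler_pdivlMr ?mul1r; lra.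
Qed.

Lemma ramp0 u v x : u < v -> `|x| <= u -> ramp u v x = 0.
Proof.
move=> uv xu; rewrite /ramp (max_idPl _)// ge_min; apply/orP; right.
by rewrite ler_pdivrMr ?mul0r; lra.
Qed.

Lemma prob_le_expectation_ramp d (Om : measurableType d) (P0 : probability Om R)
    (V : Om -> R) (u v : R) : measurable_fun setT V -> u < v ->
  (P0 [set w | v < `|V w|]%R <= 'E_P0[ramp u v \o V])%E.
Proof.
move=> mV uv; have mA := @measurable_norm_gt _ Om R V v mV.
rewrite -(expectation_indic P0 mA); apply: le_expectation_nomeas => w /=.
rewrite indicE; case: (boolP (w \in _)); last by rewrite ramp_ge0.
by rewrite inE/= => h; rewrite ramp1// ltW.
Qed.

Lemma expectation_ramp_le_prob d (Om : measurableType d) (P0 : probability Om R)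
    (V : Om -> R) (u v : R) : measurable_fun setT V -> u < v ->
  ('E_P0[ramp u v \o V] <= P0 [set w | u < `|V w|]%R)%E.
Proof.
move=> mV uv; have mA := @measurable_norm_gt _ Om R V u mV.
rewrite -(expectation_indic P0 mA); apply: le_expectation_nomeas => w /=.
rewrite indicE; case: (boolP (w \in _)); first by rewrite ramp_le1.
by rewrite notin_setE /= => /negP; rewrite -leNgt => h; rewrite ramp0.
Qed.

Lemma random_variable_tight d (Om : measurableType d) (P0 : probability Om R)
    (V : Om -> R) (eta : R) : measurable_fun setT V -> 0 < eta ->
  exists2 K : R, 0 < K & outer_le P0 [set w | K < `|V w|] eta.
Proof.
move=> mV eta0; pose A (n : nat) := [set w | n%:R < `|V w|]%R.
have mA n : measurable (A n) by exact: measurable_norm_gt.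
have A0 : \bigcap_n A n = set0.
  apply/seteqP; split => w //= /(_ (Num.truncn `|V w|).+1 I).
  by rewrite /A/= ltNge (ltW (truncnS_gt _)).
have : P0 (A n) @[n --> \oo] --> P0 (\bigcap_n A n).
  apply: nonincreasing_cvg_mu => //.
  - by rewrite (le_lt_trans (probability_le1 P0 (mA _)))// ltry.
  - exact: bigcapT_measurable.
  - move=> m n mn; apply/subsetPset => w; rewrite /A/=; apply: le_lt_trans.
    by rewrite ler_nat.
rewrite A0 measure0 => /fine_cvgP[fA] /cvgrPdist_le /(_ _ eta0)[n _ /(_ n.+1 (leqnSn _))].
rewrite sub0r normrN => h; exists n.+1%:R => //.
apply/outer_leP; first exact: (mA n.+1).
have fin : P0 (A n.+1) \is a fin_num by rewrite fin_num_measure.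
rewrite -[leLHS](fineK fin) lee_fin; exact: le_trans (ler_norm _) h.
Qed.

Variables (V : R -> Om1 -> R) (Z : Om2 -> R).
Hypotheses (mV : forall T, measurable_fun setT (V T)) (mZ : measurable_fun setT Z).
Hypothesis VZ : cvg_in_law P Q V Z.

Lemma cvg_in_law_tight (eta : R) : 0 < eta -> exists K T0 : R, 0 < K /\
  forall T, T0 < T -> outer_le P [set w | K < `|V T w|] eta.
Proof.
move=> eta0; have eta2 : 0 < eta / 2 by rewrite divr_gt0.
have [K K0 hK] := random_variable_tight Q mZ eta2.
have KK : K < K + 1 by rewrite ltrDl.
have bd : exists M, forall v, `|ramp K (K + 1) v| <= M.
  by exists 1 => v; exact: ramp_norm_le1.
have [T0 hT] := (cvg_in_lawP V Z).1 VZ _ (@continuous_ramp K (K + 1)) bd _ eta2.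
exists (K + 1), T0; split; first by rewrite addr_gt0.
move=> T /hT h; apply/outer_leP; first exact: measurable_norm_gt.
apply: (le_trans (prob_le_expectation_ramp P (mV T) KK)).
have fP := @bounded_expectation_fin_num _ _ _ P (ramp K (K + 1) \o V T) 1 (fun w => ramp_norm_le1 _ _ _).
have fQ := @bounded_expectation_fin_num _ _ _ Q (ramp K (K + 1) \o Z) 1 (fun w => ramp_norm_le1 _ _ _).
have mKZ := measurable_norm_gt K mZ.
have := expectation_ramp_le_prob Q mZ KK; have /outer_leP -/(_ mKZ) hK' := hK.
move=> /le_trans/(_ hK'); rewrite -(fineK fP) -(fineK fQ) !lee_fin.
by move: h; rewrite ler_norml; lra.
Qed.

(** A lower bound on the size of [V T], dual to tightness: it prevents the scale at an early time
    from greatly exceeding the scale at a later one. *)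
Lemma cvg_in_law_nondegenerate : ~ {ae Q, forall w, Z w = 0} ->
  exists s0 eta T0 : R, [/\ 0 < s0, 0 < eta &
    forall T, T0 < T -> ~ outer_le P [set w | s0 < `|V T w|] eta].
Proof.
move=> Z0.
have [s [s0 hs]] : exists s, 0 < s /\ (0 < Q [set w | 2 * s < `|Z w|]%R)%E.
  apply: contrapT => /forallNP hs; apply: Z0.
  have hN n : Q [set w | n.+1%:R^-1 < `|Z w|]%R = 0%E.
    have := hs (n.+1%:R^-1 / 2) => /not_andP[|/negP].
      by rewrite divr_gt0// invr_gt0.
    by rewrite -leNgt mulrC divfK// measure_le0 => /eqP.
  have neg : Q.-negligible (\bigcup_n [set w | n.+1%:R^-1 < `|Z w|]).
    apply: negligible_bigcup => n; apply/negligibleP; last exact: hN.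
    exact: measurable_norm_gt.
  apply: negligibleS neg => w /= /eqP; rewrite -normr_gt0 => Zw.
  have [n hn] : exists n : nat, n.+1%:R^-1 < `|Z w|.
    have := near_infty_natSinv_lt (PosNum Zw) => -[n _ h].
    by exists n; apply: (h n) => /=.
  by exists n.
pose p := fine (Q [set w | 2 * s < `|Z w|]%R).
have fp : Q [set w | 2 * s < `|Z w|]%R \is a fin_num.
  by rewrite fin_num_measure//; exact: measurable_norm_gt.
have p0 : 0 < p by rewrite -lte_fin fineK.
have ss : s < 2 * s by lra.
have bd : exists M, forall v, `|ramp s (2 * s) v| <= M.
  by exists 1 => v; exact: ramp_norm_le1.
(* The expected ramp of [Z] is at least [p], so that of [V T] is eventually at least [2 * p / 3],
   more than [p / 2]. *)
have p3 : 0 < p / 3 by rewrite divr_gt0.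
have [T0 hT] := (cvg_in_lawP V Z).1 VZ _ (@continuous_ramp s (2 * s)) bd _ p3.
exists s, (p / 2), T0; split; [by []|by rewrite divr_gt0|].
move=> T /hT h; have mA := measurable_norm_gt s (mV T).
move=> /outer_leP -/(_ mA) hA.
have fP := @bounded_expectation_fin_num _ _ _ P (ramp s (2 * s) \o V T) 1 (fun w => ramp_norm_le1 _ _ _).
have fQ := @bounded_expectation_fin_num _ _ _ Q (ramp s (2 * s) \o Z) 1 (fun w => ramp_norm_le1 _ _ _).
have := le_trans (expectation_ramp_le_prob P (mV T) ss) hA.
have := prob_le_expectation_ramp Q mZ ss.
rewrite -(fineK fP) -(fineK fQ) -(fineK fp) -/p !lee_fin.
by move: h; rewrite ler_norml; lra.
Qed.

End convergence_in_law.

(** * Linear growth bound *)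

Section real_estimates.
Context {R : realType}.

Lemma bernoulli_le (x : R) (n : nat) : 0 <= x -> 1 + n%:R * x <= (1 + x) ^+ n.
Proof.
move=> x0; elim: n => [|n ih]; first by rewrite mul0r addr0 expr0.
rewrite exprS -natr1; have n0 : 0 <= n%:R :> R by [].
have : (1 + x) * (1 + n%:R * x) <= (1 + x) * (1 + x) ^+ n by rewrite ler_wpM2l//; lra.
have := mulr_ge0 n0 (mulr_ge0 x0 x0); nra.
Qed.

Lemma pow_exceeds (r K : R) : 1 < r -> exists n : nat, K < r ^+ n.
Proof.
move=> r1; have r10 : 0 < r - 1 by lra.
exists (Num.truncn (K / (r - 1))).+1; set n := _.+1.
have h : K < n%:R * (r - 1) by rewrite -ltr_pdivrMr//; exact: truncnS_gt.
have := @bernoulli_le (r - 1) n (ltW r10); rewrite (_ : 1 + (r - 1) = r); [lra|ring].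
Qed.

Lemma geometric_small (q K e : R) : 0 <= q < 1 -> 0 < e ->
  exists n0 : nat, forall n, (n0 <= n)%N -> K * q ^+ n <= e.
Proof.
move=> /andP[]; rewrite le_eqVlt => /predU1P[<- _|q0 q1] e0.
  by exists 1%N => n n1; rewrite expr0n; case: n n1 => //= n _; rewrite mulr0 ltW.
have q1' : 1 < q^-1 by rewrite invf_gt1.
have [n0 hn0] := pow_exceeds (`|K| / e) q1'.
exists n0 => n n0n; apply: (@le_trans _ _ (`|K| * q ^+ n0)).
  apply: (@le_trans _ _ (`|K| * q ^+ n)).
    by apply: ler_wpM2r; [rewrite exprn_ge0// ltW|exact: ler_norm].
  by apply: ler_wpM2l => //; apply: ler_wiXn2l; rewrite ?ltW.
rewrite -ler_pdivlMr ?exprn_gt0// -exprVn.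
by rewrite ltr_pdivrMr// in hn0; rewrite mulrC ltW.
Qed.

End real_estimates.

Section levy.
Context d (Om : measurableType d) (R : realType) (P : probability Om R).
Variables (X : R -> {RV P >-> R}) (mu : R).
Hypothesis hX : levy_process P X.
Local Notation Y := (centred X mu).

Lemma regular_centred0 w : regular_path X w -> Y 0 w = 0.
Proof. by move=> [w0 _]; rewrite /centred w0 mulr0 subrr. Qed.

(* With probability at least [4/5] the [N] independent increments over steps of
   length [T] are all at most [2 x], so that each one exceeds [2 x] with
   probability of order [1 / N]. *)
Lemma increment_tail (T x : R) (N : nat) : 0 <= T -> (0 < N)%N ->
  outer_le P [set w | exists2 u, 0 <= u <= N%:R * T & x < `|Y (0 + u) w - Y 0 w|] 5^-1 ->
  outer_le P [set w | 2 * x < `|Y T w|] N%:R^-1.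
Proof.
move=> T0 N0 hN.
pose t (i : nat) := i%:R * T.
have t0 : 0 <= t 0%N by rewrite /t mul0r.
have tS i : t i <= t i.+1 by rewrite /t ler_wpM2r// ler_nat.
pose B (_ : nat) : set R := [set z | `|z| <= 2 * x].
have mB i : measurable (B i).
  rewrite (_ : B i = `[- (2 * x), 2 * x]%classic) //.
  by apply/seteqP; split => z; rewrite /B /= in_itv/= ler_norml.
have mA : measurable [set w | 2 * x < `|Y T w|].
  exact: measurable_norm_gt (measurable_centred _ _ _).
have fA : P [set w | (2 * x < `|Y T w|)%R] \is a fin_num by rewrite fin_num_measure.
pose q := fine (P [set w | (2 * x < `|Y T w|)%R]).
have q0 : 0 <= q by rewrite fine_ge0.
have q1 : q <= 1 by rewrite -lee_fin fineK// probability_le1.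
have stepE (i : nat) : P [set w | B i (Y (t i.+1) w - Y (t i) w)%R] = (1 - q)%:E.
  have ti0 : 0 <= t i by rewrite /t mulr_ge0.
  have -> : t i.+1 = t i + T by rewrite /t -natr1 mulrDl mul1r.
  rewrite (centred_stationary mu hX ti0 T0 (mB i)).
  rewrite (_ : [set w | _] = ~` [set w | 2 * x < `|Y T w|]); last first.
    by apply/seteqP; split => w; rewrite /B /=; [move=> h; apply/negP; rewrite -leNgt|
      move=> /negP; rewrite -leNgt].
  by rewrite (probability_setC P mA) EFinB -/q fineK.
have := centred_independent mu hX N t0 tS mB.
under eq_bigr do rewrite stepE.
rewrite prodEFin big_const_ord iter_mulr_1 => prodE.
have ge : ((4 / 5)%:E <= P [set w | forall i, (i < N)%N -> B i (Y (t i.+1) w - Y (t i) w)%R])%E.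
  have [C [mC AC PC]] := hN.
  apply: (@le_trans _ _ (P (~` C))).
    rewrite (probability_setC P mC).
    have fC : P C \is a fin_num by rewrite fin_num_measure.
    rewrite -(fineK fC) -EFinB lee_fin; move: PC; rewrite -(fineK fC) lee_fin; lra.
  have ms : measurable [set w | forall i, (i < N)%N -> B i (Y (t i.+1) w - Y (t i) w)].
    by apply: (@incr_boxes_measurable _ _ _ _ X mu t N); exists B.
  apply: le_measure; rewrite ?inE//; first exact: measurableC.
  move=> w /= nC i iN; rewrite /B /=.
  have hw u : 0 <= u <= N%:R * T -> `|Y u w - Y 0 w| <= x.
    move=> uT; rewrite leNgt; apply/negP => h; apply: nC; apply: AC.
    by exists u => //; rewrite add0r.
  have h1 : 0 <= t i <= N%:R * T by rewrite /t mulr_ge0//= ler_wpM2r// ler_nat ltnW.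
  have h2 : 0 <= t i.+1 <= N%:R * T by rewrite /t mulr_ge0//= ler_wpM2r// ler_nat.
  have := ler_normB (Y (t i.+1) w - Y 0 w) (Y (t i) w - Y 0 w).
  rewrite (_ : Y (t i.+1) w - Y 0 w - (Y (t i) w - Y 0 w) = Y (t i.+1) w - Y (t i) w); last by ring.
  have := hw _ h1; have := hw _ h2; lra.
rewrite prodE lee_fin in ge.
apply/outer_leP => //; rewrite -(fineK fA) -/q lee_fin.
have NR : (0 : R) < N%:R by rewrite ltr0n.
rewrite -[N%:R^-1]mul1r ler_pdivlMr// mulrC.
(* From [(1 - q) ^ N >= 4/5], [(1 - q) ^ N * (1 + q) ^ N <= 1] and Bernoulli's
   [1 + N * q <= (1 + q) ^ N] it follows that [N * q <= 1/4]. *)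
have b := bernoulli_le N q0.
have h1 : (1 - q) ^+ N * (1 + q) ^+ N <= 1.
  rewrite -exprMn exprn_ile1//; nra.
have h2 : 0 <= (1 - q) ^+ N by rewrite exprn_ge0//; lra.
have h3 : 0 <= N%:R * q by rewrite mulr_ge0.
nra.
Qed.

Variable a : R -> R.
Hypothesis a_gt0 : forall T, 0 < T -> 0 < a T.
Hypothesis tight : forall eta, 0 < eta -> exists K T0 : R, 0 < K /\
  forall T, T0 < T -> outer_le P [set w | K < `|Y T w / a T|] eta.

Lemma sup_tight (eta : R) : 0 < eta -> exists L T0 : R, [/\ 0 < L, 0 < T0 &
  forall T s, T0 <= T -> 0 <= s ->
  outer_le P [set w | exists2 u, 0 <= u <= T & L * a T < `|Y (s + u) w - Y s w|] eta].
Proof.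
move=> eta0; pose eta' := Num.min (eta / 2) 10^-1.
have eta'0 : 0 < eta' <= 10^-1.
  by rewrite /eta' lt_min ge_min lexx orbT andbT; apply/andP; split; lra.
have eta'1 : 2 * eta' <= eta.
  have : eta' <= eta / 2 by rewrite /eta' ge_min lexx.
  by lra.
have [K [T0 [K0 hK]]] := tight (andP eta'0).1.
exists (28 * K), (Num.max T0 0 + 1); split; [lra| |].
  have : 0 <= Num.max T0 0 by rewrite le_max lexx orbT.
  lra.
move=> T s TT0 s0.
have h1 : T0 <= Num.max T0 0 by rewrite le_max lexx.
have h2 : 0 <= Num.max T0 0 by rewrite le_max lexx orbT.
have T0' : 0 <= T by lra.
have aT : 0 < a T by apply: a_gt0; lra.
have hT : outer_le P [set w | K * a T < `|Y T w|] eta'.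
  have TT : T0 < T by lra.
  apply: outer_leW (hK T TT) => // w /=.
  by rewrite normrM normfV (gtr0_norm aT) ltr_pdivlMr.
have := levy_maximal_inequality hX s0 T0' eta'0 hT.
apply: outer_leW => // w /=; by rewrite mulrA.
Qed.

Hypothesis nondeg : exists s0 eta T0 : R, [/\ 0 < s0, 0 < eta &
    forall T, T0 < T -> ~ outer_le P [set w | s0 < `|Y T w / a T|] eta].

(** If [a t] were more than [L / s0] times [a T] with [t <= T], the maximal bound [L * a T] on
    [0, T] would keep [|Y t| / a t] below [s0] outside a small event, against the nondegeneracy of
    the limit. *)
Lemma scale_almost_monotone : exists C T0 : R, [/\ 0 < C, 0 < T0 &
  forall t T, T0 <= t -> t <= T -> a t <= C * a T].
Proof.
have [s0 [eta [T1 [s00 eta0 hs]]]] := nondeg.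
have [L [T0 [L0 T00 hL]]] := sup_tight eta0.
pose T2 := Num.max T0 (T1 + 1).
have h1 : T0 <= T2 by rewrite le_max lexx.
have h2 : T1 + 1 <= T2 by rewrite le_max lexx orbT.
exists (L / s0), T2; split; [by rewrite divr_gt0|lra|] => t T T2t tT.
have at0 : 0 < a t by apply: a_gt0; lra.
have aT0 : 0 < a T by apply: a_gt0; lra.
rewrite leNgt; apply/negP => h; apply: (hs t); first lra.
apply: (outer_le_regular hX).
have T0T : T0 <= T by lra.
apply: outer_leW (hL T 0 T0T (lexx _)) => // w /= [rw hw].
exists t; first by lra.
rewrite add0r regular_centred0// subr0.
move: hw; rewrite normrM normfV (gtr0_norm at0) ltr_pdivlMr//.
apply: le_lt_trans; rewrite mulrAC ltr_pdivrMr// in h.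
by rewrite (mulrC s0) ltW.
Qed.

(** Growth of the scale along powers of two: [r1 > 1] makes it unbounded there, and almost
    monotonicity carries this to all large times; [r2 < 2] makes it sublinear. *)
Hypothesis doubling : exists (r1 r2 : R) (m0 : nat), [/\ 1 < r1, 0 < r2 < 2 &
  forall m, (m0 <= m)%N -> r1 * a (2 ^ m)%:R <= a (2 ^ m.+1)%:R <= r2 * a (2 ^ m)%:R].

Lemma exp2_gt0 (m : nat) : (0 : R) < (2 ^ m)%:R.
Proof. by rewrite ltr0n expn_gt0. Qed.

Lemma scale_unbounded (K : R) : exists2 T0 : R, 0 < T0 & forall T, T0 <= T -> K < a T.
Proof.
have [C [T0 [C0 T00 hC]]] := scale_almost_monotone.
have [r1 [r2 [m0 [r11 _ hd]]]] := doubling.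
have lo k : r1 ^+ k * a (2 ^ m0)%:R <= a (2 ^ (m0 + k))%:R.
  elim: k => [|k ih]; first by rewrite expr0 mul1r addn0.
  have /andP[h _] := hd (m0 + k)%N (leq_addr _ _).
  rewrite addnS exprS -mulrA; apply: le_trans h; rewrite ler_wpM2l//; lra.
have am0 : 0 < a (2 ^ m0)%:R by apply: a_gt0; exact: exp2_gt0.
have [k hk] := pow_exceeds (C * `|K| / a (2 ^ m0)%:R) r11.
have [n0 hn0] := exp2_gt T0.
pose m := (m0 + (k + n0))%N.
exists (2 ^ m)%:R; first exact: exp2_gt0.
move=> T mT; have T0m : T0 <= (2 ^ m)%:R.
  apply: (le_trans (ltW hn0)); rewrite ler_nat leq_exp2l// /m; lia.
have h1 := hC _ _ T0m mT.
have h2 := lo (k + n0)%N.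
have h3 : r1 ^+ k <= r1 ^+ (k + n0) by rewrite ler_weXn2l ?leq_addr// ltW.
rewrite ltr_pdivrMr// in hk.
have h4 : C * `|K| < C * a T.
  apply: lt_le_trans h1; apply: lt_le_trans hk _; apply: le_trans h2.
  by rewrite ler_wpM2r// ltW.
rewrite ltr_pM2l// in h4; exact: le_lt_trans (ler_norm _) h4.
Qed.

(** Take [N = 2 ^ n] blocks of length [T = b ^ n] with [b = 2 ^ r]. The horizon [N * T] is
    [2 ^ (r.+1 * n)], where the scale is at most [C * r2 ^ (r.+1 * n) = C * q ^ n * b ^ n] with
    [q < 1]. The tail bound for one block then has probability [2 ^ -n] at a level [o(b ^ n)], and
    Ottaviani's inequality doubles both. *)
Lemma increments_geometric : exists2 b : nat, (1 < b)%N & forall de : R, 0 < de ->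
  exists n1 : nat, forall n s, (n1 <= n)%N -> 0 <= s ->
  outer_le P [set w | exists2 u, 0 <= u <= (b ^ n)%:R &
    de * (b ^ n)%:R < `|Y (s + u) w - Y s w|] (2 / (2 ^ n)%:R).
Proof.
have [r1 [r2 [m0 [r11 /andP[r20 r22] hd]]]] := doubling.
(* One extra doubling per unit of [n] pays for the number of blocks; since [r2 < 2], for large [r]
   the scale over [r.+1] doublings still grows less than time over [r]. *)
have [r hr] : exists r : nat, r2 ^+ r.+1 < 2 ^+ r.
  have r2h : 1 < 2 / r2 by rewrite ltr_pdivlMr ?mul1r.
  have [r hr] := pow_exceeds r2 r2h.
  exists r; rewrite exprS; move: hr; rewrite expr_div_n ltr_pdivlMr ?exprn_gt0//.
(* [r = 0] would mean [r2 < 1], whereas [1 < r1 <= r2]; hence [b > 1]. *)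
have r0 : (0 < r)%N.
  rewrite lt0n; apply/eqP => r0; move: hr; rewrite r0 expr1 expr0 => r2lt.
  have := hd m0 (leqnn _); have am0 := a_gt0 (exp2_gt0 m0).
  move=> /andP[h1 h2]; have := le_trans h1 h2; rewrite ler_pM2r//; lra.
have up k : a (2 ^ (m0 + k))%:R <= r2 ^+ k * a (2 ^ m0)%:R.
  elim: k => [|k ih]; first by rewrite expr0 mul1r addn0.
  have /andP[_ h] := hd (m0 + k)%N (leq_addr _ _).
  by rewrite addnS exprS -mulrA; apply: (le_trans h); rewrite ler_pM2l.
have am0 := a_gt0 (exp2_gt0 m0).
pose C := a (2 ^ m0)%:R / r2 ^+ m0.
have C0 : 0 < C by rewrite divr_gt0// exprn_gt0.
have {}up m : (m0 <= m)%N -> a (2 ^ m)%:R <= C * r2 ^+ m.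
  move=> m0m; have := up (m - m0)%N; rewrite subnKC// => /le_trans; apply.
  rewrite /C -[in leRHS](subnKC m0m) exprD le_eqVlt; apply/orP; left; apply/eqP.
  by field; rewrite expf_neq0// gt_eqF.
exists (2 ^ r)%N; first by rewrite -{1}(expn0 2) ltn_exp2l.
move=> de de0.
have five : 0 < 5^-1 :> R by rewrite invr_gt0.
have [L [T0 [L0 T00 hL]]] := sup_tight five.
pose q := r2 ^+ r.+1 / 2 ^+ r.
have q01 : 0 <= q < 1.
  rewrite /q divr_ge0 ?exprn_ge0 ?ltW//= ltr_pdivrMr ?mul1r ?exprn_gt0//.
have [n2 hn2] := geometric_small (4 * L * C) q01 de0.
have [n3 hn3] := exp2_gt T0.
exists (n2 + n3 + m0)%N => n s hn s0.
pose T : R := ((2 ^ r) ^ n)%:R.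
pose N := (2 ^ n)%N.
have NT : N%:R * T = (2 ^ (r.+1 * n))%:R.
  by rewrite /N /T -natrM -expnM -expnD; congr ((2 ^ _)%:R); lia.
have TT0 : 0 < T by rewrite ltr0n !expn_gt0.
have T0N : T0 <= N%:R * T.
  rewrite NT; apply: (le_trans (ltW hn3)); rewrite ler_nat leq_exp2l//.
  by apply: (@leq_trans n); [clear -hn; lia|exact: leq_pmull].
have NT0 : 0 < N%:R * T by rewrite NT; exact: exp2_gt0.
have hmax := hL (N%:R * T) 0 T0N (lexx _).
have N0 : (0 < N)%N by rewrite expn_gt0.
have htail := increment_tail (ltW TT0) N0 hmax.
have aNT := a_gt0 NT0.
(* The intermediate times lie in the horizon [N * T], where the maximal bound already holds up to
   probability 1/5, below the required 1/2. *)
have half n' j : (j <= 2 ^ n')%N ->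
    outer_le P [set w | 2 * (L * a (N%:R * T)) < `|Y (j%:R * T / (2 ^ n')%:R) w|] 2^-1.
  move=> jn; apply: (outer_le_regular hX).
  have e52 : 5^-1 <= 2^-1 :> R by rewrite lef_pV2 ?posrE//; lra.
  apply: outer_leW e52 hmax => w /= [rw hw].
  have La : 0 < L * a (N%:R * T) by rewrite mulr_gt0.
  exists (j%:R * T / (2 ^ n')%:R); last first.
    by rewrite add0r regular_centred0// subr0; lra.
  rewrite divr_ge0 ?mulr_ge0//= ?(ltW TT0)//.
  rewrite ler_pdivrMr ?exp2_gt0//.
  apply: (@le_trans _ _ ((2 ^ n')%:R * T)); first by rewrite ler_wpM2r ?ler_nat// ltW.
  rewrite mulrC ler_wpM2r// ler_peMl ?(ltW TT0)// ler1n//.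
have := ottaviani hX s0 (ltW TT0) half htail.
apply: outer_leW => // w /= [u uT hu]; exists u => //.
apply: le_lt_trans hu; rewrite NT.
have m0m : (m0 <= r.+1 * n)%N.
  by apply: (@leq_trans n); [clear -hn; lia|exact: leq_pmull].
have hup := up _ m0m.
apply: (@le_trans _ _ (2 * (2 * (L * (C * r2 ^+ (r.+1 * n)))))).
  by rewrite !ler_pM2l.
have n2n : (n2 <= n)%N by clear -hn; lia.
have := hn2 n n2n; rewrite /q expr_div_n -exprM -exprM => hq.
have E : ((2 ^ r) ^ n)%:R = 2 ^+ (r * n) :> R by rewrite -expnM natrX.
rewrite E; have p0 : 0 < 2 ^+ (r * n) :> R by rewrite exprn_gt0.
rewrite mulrA ler_pdivrMr// in hq.
apply: le_trans hq; rewrite le_eqVlt; apply/orP; left; apply/eqP; ring.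
Qed.

(** Peeling: for [u] in [(b ^ n, b ^ n.+1]] the increment is compared with the supremum over a block
    of length [b ^ n.+1], at most [de / 2 * b ^ n] outside a summable family of events. The constant
    [x = de * b ^ n0] pays for [u <= b ^ n0]. The spare factor 2 in [de / (2 * b)] serves the
    backward bound, which uses two forward increments. *)
Lemma linear_growth (de e : R) : 0 < de -> 0 < e -> exists2 x : R, 0 < x & forall s, 0 <= s ->
  outer_le P [set w | exists2 u, 0 <= u & x + de * u < `|Y (s + u) w - Y s w|] e
  /\ outer_le P [set w | exists2 u, 0 <= u <= s & x + de * u < `|Y s w - Y (s - u) w|] e.
Proof.
move=> de0 e0; have [b b1 hb] := increments_geometric.
have bR : (1 : R) < b%:R by rewrite ltr1n.
have de' : 0 < de / (2 * b%:R) by rewrite divr_gt0// mulr_gt0//; lra.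
have [n1 hn1] := hb _ de'.
(* This makes [2 / 2 ^ (n0 + k)] at most [e / 2 ^ k.+1], the share of level [k] in [e]. *)
have [n2 hn2] := exp2_gt (4 / e).
pose n0 := (n1 + n2)%N.
have b0 n : (0 : R) < (b ^ n)%:R by rewrite ltr0n expn_gt0; lia.
have bS n : (b ^ n.+1)%:R = b%:R * (b ^ n)%:R :> R by rewrite expnS natrM.
pose E (s : nat -> R) n := [set w | exists2 u, 0 <= u <= (b ^ n)%:R &
    de / (2 * b%:R) * (b ^ n)%:R < `|Y (s n + u) w - Y (s n) w|].
have hE s : (forall n, 0 <= s n) -> outer_le P (\bigcup_k E s (n0 + k)%N) e.
  move=> s0; apply: outer_le_bigcup => k.
  have n1k : (n1 <= n0 + k)%N by rewrite /n0; lia.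
  apply: outer_leW (hn1 _ _ n1k (s0 (n0 + k)%N)); first by [].
  rewrite /n0 -addnA expnD expnD expnS !natrM.
  have p1 := exp2_gt0 n1; have p2 := exp2_gt0 n2; have p3 := exp2_gt0 k.
  have p1' : (1 : R) <= (2 ^ n1)%:R by rewrite ler1n expn_gt0.
  rewrite ltr_pdivrMr// in hn2.
  rewrite ler_pdivrMr ?mulr_gt0//.
  rewrite (_ : e / (2 * (2 ^ k)%:R) * ((2 ^ n1)%:R * ((2 ^ n2)%:R * (2 ^ k)%:R)) =
    (2 ^ n2)%:R * e / 2 * (2 ^ n1)%:R); last by field; rewrite gt_eqF.
  nra.
have scale u : 0 <= u -> exists k, u <= (b ^ (n0 + k))%:R /\
    2 * (de / (2 * b%:R) * (b ^ (n0 + k))%:R) <= de * (b ^ n0)%:R + de * u.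
  move=> u0.
  have [n hn] : exists n, (u <= (b ^ (n0 + n))%:R).
    have [n hn] := pow_exceeds u bR; exists n.
    apply: (le_trans (ltW hn)); rewrite -natrX ler_nat leq_exp2l//; lia.
  have [k hk kmin] := ex_minnP (ex_intro (fun n => u <= (b ^ (n0 + n))%:R) n hn).
  exists k; split => //.
  have E1 z : 2 * (de / (2 * b%:R) * (b%:R * z)) = de * z by field; rewrite gt_eqF//; lra.
  case: k hk kmin => [_ _|k hk kmin].
    rewrite addn0; have z0 := mulr_gt0 de0 (b0 n0).
    have -> : 2 * (de / (2 * b%:R) * (b ^ n0)%:R) = de * (b ^ n0)%:R / b%:R.
      by field; rewrite gt_eqF//; lra.
    have : de * (b ^ n0)%:R / b%:R <= de * (b ^ n0)%:R.
      by rewrite ler_pdivrMr ?ler_peMr ?ltW//; lra.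
    have := mulr_ge0 (ltW de0) u0; lra.
  rewrite addnS bS E1.
  have : ~~ (u <= (b ^ (n0 + k))%:R).
    by apply/negP => /kmin; rewrite ltnn.
  rewrite -ltNge => hu.
  have : de * (b ^ (n0 + k))%:R <= de * u by rewrite ler_pM2l// ltW.
  have := mulr_gt0 de0 (b0 n0); lra.
exists (de * (b ^ n0)%:R); first by rewrite mulr_gt0.
move=> s s0; split.
  apply: outer_leW (hE (fun=> s) (fun=> s0)) => // w /= [u u0 hu].
  have [k [hk1 hk2]] := scale u u0.
  exists k => //; exists u; first by rewrite u0.
  apply: le_lt_trans hu; apply: le_trans hk2.
  have : 0 < de / (2 * b%:R) * (b ^ (n0 + k))%:R by rewrite mulr_gt0.
  lra.
(* At level [n] both [s] and [s - u] are reached from the base point [s - b ^ n], cut off at 0. It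
   does not depend on [u], so one forward event per level suffices. *)
pose s' n := Num.max (s - (b ^ n)%:R) 0.
have s'0 n : 0 <= s' n by rewrite le_max lexx orbT.
apply: outer_leW (hE s' s'0) => // w /= [u /andP[u0 us] hu].
have [k [hk1 hk2]] := scale u u0.
exists k => //; set n := (n0 + k)%N in hk1 hk2 *.
have s'1 : s - (b ^ n)%:R <= s' n by rewrite le_max lexx.
have s'2 : s' n <= s - u.
  by rewrite ge_max subr_ge0 us andbT lerD2l lerN2.
apply: contrapT => nE.
have hw v : 0 <= v <= (b ^ n)%:R -> `|Y (s' n + v) w - Y (s' n) w| <= de / (2 * b%:R) * (b ^ n)%:R.
  by move=> hv; rewrite leNgt; apply/negP => h; apply: nE; exists v.
have h1 : 0 <= s - s' n <= (b ^ n)%:R by lra.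
have h2 : 0 <= s - u - s' n <= (b ^ n)%:R by lra.
have := hw _ h1; have := hw _ h2.
rewrite !(addrC (s' n)) !subrK => l1 l2.
have := ler_normB (Y s w - Y (s' n) w) (Y (s - u) w - Y (s' n) w).
rewrite (_ : Y s w - Y (s' n) w - (Y (s - u) w - Y (s' n) w) = Y s w - Y (s - u) w); last by ring.
lra.
Qed.

End levy.

Section scale.
Context {R : realType}.

(** The ratio [a (2 * T) / a T] tends to [rho = 2 ^ (1 / alpha)], which lies in (1, 2) because
    [alpha > 1]; [r1] and [r2] are the midpoints of (1, rho) and (rho, 2), and [e] is the relative
    error that they allow. *)
Lemma slowly_varying_doubling (alpha : R) (l a : R -> R) :
  1 < alpha -> slowly_varying l ->
  (forall T : R, 0 < T -> 0 < a T /\ a T = T `^ alpha^-1 * l T) ->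
  exists (r1 r2 : R) (m0 : nat), [/\ 1 < r1, 0 < r2 < 2 &
  forall m, (m0 <= m)%N -> r1 * a (2 ^ m)%:R <= a (2 ^ m.+1)%:R <= r2 * a (2 ^ m)%:R].
Proof.
move=> alpha1 [_ hl] ha.
pose rho : R := 2 `^ alpha^-1.
have alpha0 : 0 < alpha by lra.
have pow2_gt1 (r : R) : 0 < r -> 1 < 2 `^ r :> R.
  move=> r0; have := @gt0_ltr_powR R r r0 1 2.
  by rewrite powR1; apply; rewrite ?nnegrE// ltr1n.
have rho1 : 1 < rho by apply: pow2_gt1; rewrite invr_gt0.
have rho2 : rho < 2.
  have ainv : alpha^-1 < 1 by rewrite invf_lt1.
  have : 1 < 2 `^ (1 - alpha^-1) :> R by apply: pow2_gt1; lra.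
  have : 2 = rho * 2 `^ (1 - alpha^-1) :> R.
    rewrite -powRD; last by apply/implyP => _; rewrite pnatr_eq0.
    by rewrite addrC subrK powRr1.
  by nra.
have /cvg_pinfty_leP hl2 := hl 2 ltac:(by []).
pose e := Num.min ((rho - 1) / (2 * rho)) ((2 - rho) / (2 * rho)).
have e0 : 0 < e.
  by rewrite lt_min !divr_gt0 ?mulr_gt0//; lra.
have e1 : e * (2 * rho) <= rho - 1.
  by rewrite -ler_pdivlMr ?mulr_gt0 ?ge_min ?lexx//; lra.
have e2 : e * (2 * rho) <= 2 - rho.
  by rewrite -ler_pdivlMr ?mulr_gt0 ?ge_min ?lexx ?orbT//; lra.
have [T0 hT0] := hl2 _ e0.
have [m0 hm0] := exp2_gt T0.
exists ((1 + rho) / 2), ((rho + 2) / 2), m0; split; [lra|lra|move=> m m0m].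
have m2 : (0 : R) < (2 ^ m)%:R by exact: exp2_gt0.
have Tm : T0 < (2 ^ m)%:R.
  by apply: (lt_le_trans hm0); rewrite ler_nat leq_exp2l.
have := hT0 _ Tm.
have [am amE] := ha _ m2; have [am1 amE1] := ha _ (exp2_gt0 _ m.+1).
move: am1 amE1; rewrite expnS natrM => am1 amE1.
have lm : 0 < l (2 ^ m)%:R.
  by move: am; rewrite amE pmulr_rgt0// powR_gt0.
have -> : l (2 * (2 ^ m)%:R) / l (2 ^ m)%:R = a (2 * (2 ^ m)%:R) / (rho * a (2 ^ m)%:R).
  rewrite amE1 amE powRM//.
  have p1 : (2 ^ m)%:R `^ alpha^-1 != 0 :> R by rewrite gt_eqF// powR_gt0.
  have p2 : rho != 0 by rewrite gt_eqF//; lra.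
  have p3 : l (2 ^ m)%:R != 0 by rewrite gt_eqF.
  by rewrite -/rho; field; rewrite p1 p2 p3.
set A1 := a (2 * _) in am1 *; set A0 := a (2 ^ m)%:R in am *.
have rA : 0 < rho * A0 by rewrite mulr_gt0//; lra.
rewrite ler_norml lerBlDr lerBrDr => /andP[].
rewrite ler_pdivlMr// ler_pdivrMr// => h1 h2.
have := ler_pM2r am; nra.
Qed.

End scale.

(** * Mixing convergence *)

Section uniform_continuity.
Context {R : realType} (V : pseudoMetricType R).

(** A Heine-Cantor statement in which only [u] is confined to the compact set: the perturbed point
    [v] may leave it. *)
Lemma continuous_near_compact (f : V -> R) (K : set V) (e : R) :
  continuous f -> compact K -> 0 < e ->
  exists2 de, 0 < de & forall u v, K u -> ball u de v -> `|f v - f u| <= e.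
Proof.
move=> cf /compact_near_coveringP cK e0.
pose Q (de : R) (u : V) := forall v, ball u de v -> `|f v - f u| <= e.
have : \forall de \near (0 : R)^'+, K `<=` Q de.
  apply: cK => x Kx.
  have e2 : 0 < e / 2 by rewrite divr_gt0.
  have /cvgrPdist_lt/(_ _ e2) := cf x.
  move=> /nbhs_ballP[r /= r0 hr].
  have r2 : 0 < r / 2 by rewrite divr_gt0.
  exists (ball x (r / 2), [set de | 0 < de < r / 2]); first split => /=.
  - exact: nbhsx_ballx.
  - by near=> de; apply/andP; split; near: de; [exact: nbhs_right_gt|exact: nbhs_right_lt].
  move=> [u de] /= [xu /andP[de0 der]] v uv.
  have h1 : `|f x - f u| < e / 2.
    by apply: hr; apply: le_ball xu; lra.
  have h2 : `|f x - f v| < e / 2.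
    apply: hr; apply: (@le_ball _ _ _ (r / 2 + de)); first lra.
    exact: ball_triangle uv.
  rewrite (_ : f v - f u = (f x - f u) - (f x - f v)); last by ring.
  by rewrite (le_trans (ler_normB _ _))//; lra.
move=> [r /= r0 hr]; exists (r / 2); first by rewrite divr_gt0.
move=> u v Ku; apply: (hr (r / 2)) => //=; last by rewrite divr_gt0.
by rewrite sub0r normrN gtr0_norm ?divr_gt0//; lra.
Unshelve. all: by end_near. Qed.

End uniform_continuity.

Section expectations.
Context d (Om : measurableType d) (R : realType) (P : probability Om R).
Implicit Types (F G : Om -> R) (A B : set Om).

Lemma fine_expectationD F G (M N : R) :
  measurable_fun setT F -> (forall w, `|F w| <= M) ->
  measurable_fun setT G -> (forall w, `|G w| <= N) ->
  fine 'E_P[F \+ G] = fine 'E_P[F] + fine 'E_P[G].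
Proof.
move=> mF FM mG GN; rewrite expectationD ?fineD//.
- exact: bounded_expectation_fin_num FM.
- exact: bounded_expectation_fin_num GN.
- exact: bounded_Lfun1 FM.
- exact: bounded_Lfun1 GN.
Qed.

Lemma indic_norm_le1 A w : `|\1_A w| <= 1 :> R.
Proof. by rewrite indicE; case: (_ \in _); rewrite ?normr1 ?normr0. Qed.

Lemma integral_mrestr A (mA : measurable A) (f : Om -> \bar R) :
  measurable_fun setT f -> (forall w, 0 <= f w)%E ->
  (\int[mrestr P mA]_w f w = \int[P]_(w in A) f w)%E.
Proof.
move=> mf f0; rewrite -(setUv A) ge0_integral_setU//=.
- rewrite [X in (_ + X)%E](_ : _ = 0%E) ?adde0; last first.
    apply: null_set_integral => //; first exact: measurableC.
      exact: measurable_funTS.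
    by rewrite /= /mrestr setICl measure0.
  apply: eq_measure_integral => B mB BA.
  by rewrite /= /mrestr setIidl.
- exact: measurableC.
- exact: measurable_funTS.
- by apply/disj_setPS; rewrite setICr.
Qed.

End expectations.

Section change_of_space.
Context d1 d2 (Om1 : measurableType d1) (Om2 : measurableType d2) (R : realType).
Variables (P : probability Om1 R) (Q : probability Om2 R).

(** The hypothesis says that the law of [V] under [P] restricted to [A] is [k] times the law of [Z].
    It serves both independence, with [k = P A], and the passage from a product space to a
    factor. *)
Lemma fine_expectation_transfer (V : Om1 -> R) (Z : Om2 -> R) (A : set Om1) (k M : R)
    (h : R -> R) : measurable A -> measurable_fun setT V -> measurable_fun setT Z ->
  (forall B, measurable B -> P (A `&` V @^-1` B) = (k%:E * Q (Z @^-1` B))%E) ->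
  0 <= k -> measurable_fun setT h -> (forall x, `|h x| <= M) ->
  fine 'E_P[fun w => \1_A w * h (V w)] = k * fine 'E_Q[h \o Z].
Proof.
move=> mA mV mZ hVZ k0 mh hM.
pose fV : {RV P >-> R} := HB.pack V (isMeasurableFun.Build _ _ _ _ V mV).
pose fZ : {RV Q >-> R} := HB.pack Z (isMeasurableFun.Build _ _ _ _ Z mZ).
have key (g : R -> R) (N : R) : measurable_fun setT g -> (forall x, 0 <= g x) ->
    (forall x, `|g x| <= N) ->
    fine 'E_P[fun w => \1_A w * g (V w)] = k * fine 'E_Q[g \o Z].
  move=> mg g0 gN.
  have fQ := @bounded_expectation_fin_num _ _ _ Q (g \o Z) N (fun w => gN _).
  have fk : k%:E \is a fin_num by [].
  rewrite -[k]/(fine k%:E) -(fineM fk fQ); congr fine.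
  rewrite unlock.
  have mgE : measurable_fun setT (EFin \o g) by exact/measurable_EFinP.
  transitivity (\int[P]_(w in A) (EFin \o g \o V) w)%E.
    rewrite [RHS]integral_mkcond; apply: eq_integral => w _.
    rewrite patchE indicE; case: ifPn => wA; first by rewrite mul1r.
    by rewrite mul0r.
  rewrite -(integral_mrestr P mA); [|exact: measurableT_comp|by move=> w; rewrite lee_fin].
  transitivity (\int[pushforward (mrestr P mA) fV]_y (EFin \o g) y)%E.
    by rewrite ge0_integral_pushforward//; move=> y _; rewrite lee_fin.
  pose kn := NngNum k0.
  rewrite (eq_measure_integral (mscale kn (distribution Q fZ))).
    rewrite ge0_integral_mscale//; last by move=> y _; rewrite lee_fin.
    congr (_ * _)%E; rewrite ge0_integral_pushforward//.
    by move=> y _; rewrite lee_fin.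
  move=> B mB _; change (P (V @^-1` B `&` A) = (k%:E * Q (Z @^-1` B))%E).
  by rewrite setIC hVZ.
(* A signed [h] is shifted to the nonnegative [h + M], and the constant [M] is then subtracted. *)
have M0 : 0 <= M by apply: le_trans (hM 0).
have mhM : measurable_fun setT (fun x => h x + M) by apply: measurable_funD.
have h1 := key (fun x => h x + M) (M + M) mhM.
have h2 := key (cst M) M (measurable_cst _).
have mI : measurable_fun setT (\1_A : Om1 -> R) by exact: measurable_indic.
have b1 w : `|(\1_A w : R) * h (V w)| <= M.
  by rewrite normrM -[leRHS]mul1r ler_pM//; exact: indic_norm_le1.
have b2 w : `|(\1_A w : R) * M| <= M.
  by rewrite normrM (ger0_norm M0) ler_piMl//; exact: indic_norm_le1.
have m1 : measurable_fun setT (fun w => (\1_A w : R) * h (V w)).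
  by apply: measurable_funM => //; exact: measurableT_comp.
have m2 : measurable_fun setT (fun w => (\1_A w : R) * M) by apply: measurable_funM.
have m3 : measurable_fun setT (h \o Z) by exact: measurableT_comp.
have := fine_expectationD P m1 b1 m2 b2.
rewrite (_ : _ \+ _ = (fun w => \1_A w * (h (V w) + M))); last first.
  by apply/funext => w /=; rewrite mulrDr.
rewrite h1; last 2 first.
- by move=> x; have := hM x; rewrite ler_norml; lra.
- by move=> x; rewrite (le_trans (ler_normD _ _))// lerD// ger0_norm.
rewrite h2; last 2 first.
- by [].
- by move=> x; rewrite ger0_norm.
have -> : (fun x => h x + M) \o Z = (h \o Z) \+ (cst M \o Z) by [].
have b3 w : `|(h \o Z) w| <= M by exact: hM.
have b4 w : `|(cst M \o Z) w| <= M by rewrite ger0_norm.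
have m4 : measurable_fun setT (cst M \o Z) by exact: measurable_cst.
by rewrite (fine_expectationD Q m3 b3 m4 b4); lra.
Qed.

End change_of_space.

Section mixing.
Context d1 d2 (Om1 : measurableType d1) (Om2 : measurableType d2) (R : realType).
Variables (P : probability Om1 R) (Q : probability Om2 R).
Variables (zeta : R -> Om1 -> R) (Z : Om2 -> R).
Hypotheses (mzeta : forall T, measurable_fun setT (zeta T)) (mZ : measurable_fun setT Z).
Hypothesis zetaZ : cvg_in_law P Q zeta Z.

(* Renyi mixing: the convergence in law is unaffected by conditioning on [A]. *)
Definition mixing_event (A : set Om1) : Prop := measurable A /\
  forall g : R -> R, continuous g -> (exists M, forall x, `|g x| <= M) ->
  forall e, 0 < e -> exists T0, forall T, T0 < T ->
    `|fine 'E_P[fun w => \1_A w * g (zeta T w)] - fine (P A) * fine 'E_Q[g \o Z]| <= e.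

Let m1 A (g : R -> R) T : measurable A -> continuous g ->
  measurable_fun setT (fun w => (\1_A w : R) * g (zeta T w)).
Proof.
move=> mA cg; apply: measurable_funM; first exact: measurable_indic.
by apply: measurableT_comp => //; exact: continuous_measurable_fun.
Qed.

Let b1 A (g : R -> R) M T w : (forall x, `|g x| <= M) ->
  `|(\1_A w : R) * g (zeta T w)| <= M.
Proof.
by move=> gM; rewrite normrM -[leRHS]mul1r ler_pM//; exact: indic_norm_le1.
Qed.

Lemma mixing_lambda_system : lambda_system setT mixing_event.
Proof.
split => //.
- split => // g cg [M gM] e e0.
  have [T0 hT0] := (cvg_in_lawP _ _ _ _).1 zetaZ g cg (ex_intro _ M gM) e e0.
  exists T0 => T /hT0; rewrite probability_setT mul1r.
  rewrite (_ : (fun w => _) = g \o zeta T)//.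
  by apply/funext => w /=; rewrite indicT mul1r.
- move=> A B BA [mA hA] [mB hB]; split; first exact: measurableD.
  move=> g cg gM e e0; have [M hM] := gM.
  have e2 : 0 < e / 2 by rewrite divr_gt0.
  have [T1 hT1] := hA g cg gM _ e2; have [T2 hT2] := hB g cg gM _ e2.
  exists (Num.max T1 T2) => T; rewrite gt_max => /andP[/hT1 h1 /hT2 h2].
  have mD : measurable (A `\` B) by exact: measurableD.
  have E1 : fine 'E_P[fun w => \1_A w * g (zeta T w)] =
      fine 'E_P[fun w => \1_(A `\` B) w * g (zeta T w)] + fine 'E_P[fun w => \1_B w * g (zeta T w)].
    rewrite -(fine_expectationD P (m1 T mD cg) (fun w => b1 _ _ _ hM) (m1 T mB cg) (fun w => b1 _ _ _ hM)).
    congr (fine 'E_P[_]); apply/funext => w /=; rewrite -mulrDl; congr (_ * _).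
    rewrite !indicE in_setD; have [wB|wB] := boolP (w \in B).
      by rewrite (_ : w \in A)/= ?add0r//; apply/mem_set/BA/set_mem.
    by rewrite andbT addr0.
  have E2 : fine (P A) = fine (P (A `\` B)) + fine (P B).
    rewrite -fineD ?fin_num_measure//; congr fine.
    rewrite -measureU//; last by apply/seteqP; split => w //= [[]].
    congr (P _); apply/seteqP; split => w /=; last by have := BA w; tauto.
    by have [] := pselect (B w); tauto.
  move: h1 h2; rewrite E1 E2 mulrDl !ler_norml; lra.
- move=> F ndF mF; have mFn n : measurable (F n) by have [] := mF n.
  have mU : measurable (\bigcup_n F n) by exact: bigcupT_measurable.
  split => // g cg gM e e0; have [M hM] := gM.
  have M0 : 0 <= M by apply: le_trans (hM 0).
  pose U := \bigcup_n F n.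
  have cvgP : P (F n) @[n --> \oo] --> P U by exact: nondecreasing_cvg_mu.
  have fPU : P U \is a fin_num by rewrite fin_num_measure.
  have e4 : 0 < e / (4 * (M + 1)) by rewrite divr_gt0// mulr_gt0//; lra.
  (* [n] is fixed before the time threshold: the error made in replacing the union by [F n] is
     uniform in [T]. *)
  have [n hn] : exists n, fine (P U) - fine (P (F n)) <= e / (4 * (M + 1)).
    rewrite -(fineK fPU) in cvgP; move: cvgP => /fine_cvgP[_ /cvgrPdist_le /(_ _ e4)[n _ hn]].
    by exists n; apply: le_trans (ler_norm _) (hn n (leqnn n)).
  have PD : fine (P (U `\` F n)) = fine (P U) - fine (P (F n)).
    rewrite measureD//; last by rewrite (le_lt_trans (probability_le1 P mU))// ltry.
    have -> : U `&` F n = F n by apply/setIidr => w Fw; exists n.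
    by rewrite fineB// fin_num_measure.
  have mD : measurable (U `\` F n) by exact: measurableD.
  have e2 : 0 < e / 4 by rewrite divr_gt0.
  have [T0 hT0] := (mF n).2 g cg gM _ e2.
  exists T0 => T /hT0 h1.
  have h2 : `|fine 'E_P[fun w => \1_U w * g (zeta T w)] -
      fine 'E_P[fun w => \1_(F n) w * g (zeta T w)]| <= 0 + 2 * M * (e / (4 * (M + 1))).
    apply: (@expectation_approx _ _ _ _ _ _ _ _ _ (U `\` F n)) => //.
    + exact: m1.
    + by move=> w; exact: b1.
    + by move=> w; exact: b1.
    + apply/outer_leP => //; rewrite -[leLHS]fineK ?fin_num_measure// lee_fin PD//.
    + move=> w; rewrite !indicE => hw.
      have -> : (w \in U) = (w \in F n).
        apply/idP/idP => /set_mem wU; last by apply/mem_set; exists n.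
        by apply/mem_set; apply: contrapT => nF; apply: hw.
      by rewrite subrr normr0.
  have hEZ : `|fine 'E_Q[g \o Z]| <= M.
    have := @le_fine_expectation _ _ _ Q (g \o Z) (cst M) M M (fun w => hM _).
    rewrite expectation_cst => /(_ _ _) hi.
    have := @le_fine_expectation _ _ _ Q (cst (- M)) (g \o Z) M M.
    rewrite expectation_cst => /(_ _ _) lo.
    rewrite ler_norml lo/= ?hi//.
    + by move=> w /=; rewrite ger0_norm.
    + by move=> w /=; have := hM (Z w); rewrite ler_norml => /andP[].
    + by move=> w /=; rewrite normrN ger0_norm.
    + by move=> w /=; have := hM (Z w); rewrite ler_norml => /andP[].
  have h3 : `|(fine (P U) - fine (P (F n))) * fine 'E_Q[g \o Z]| <= (e / (4 * (M + 1))) * M.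
    rewrite normrM ler_pM// ger0_norm// -PD fine_ge0//.
  have h4 : e / (4 * (M + 1)) * M <= e / 4.
    rewrite mulrAC ler_pdivrMr ?mulr_gt0//; last lra.
    rewrite (_ : e / 4 * (4 * (M + 1)) = e * (M + 1)); last by field.
    by rewrite ler_wpM2l ?ltW//; lra.
  move: h1 h2 h3; rewrite mulrBl !ler_norml -/U; lra.
Qed.

End mixing.

Lemma continuous_pair (T U V : topologicalType) (f : T -> U) (g : T -> V) :
  continuous f -> continuous g -> continuous (fun x => (f x, g x)).
Proof.
move=> cf cg x; apply: (@cvg_pair _ _ _ _ (nbhs (f x)) (nbhs (g x))).
  exact: cf.
exact: cg.
Qed.

Section finite_sums.
Context d (Om : measurableType d) (R : realType) (P : probability Om R).

Lemma fine_expectation_sum (I : finType) (F : I -> Om -> R) (M : R) :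
  (forall i, measurable_fun setT (F i)) -> (forall i w, `|F i w| <= M) ->
  fine 'E_P[fun w => \sum_i F i w] = \sum_i fine 'E_P[F i].
Proof.
move=> mF FM.
suff h (r : seq I) : [/\ measurable_fun setT (fun w => \sum_(i <- r) F i w),
    exists N, forall w, `|\sum_(i <- r) F i w| <= N &
    fine 'E_P[fun w => \sum_(i <- r) F i w] = \sum_(i <- r) fine 'E_P[F i]].
  by have [] := h (index_enum I).
elim: r => [|i r [mr [N hN] ih]].
  rewrite (_ : (fun w => _) = cst 0); last by apply/funext => w; rewrite big_nil.
  split; [exact: measurable_cst|by exists 0 => w; rewrite big_nil normr0|].
  by rewrite expectation_cst big_nil.
have E : (fun w => \sum_(j <- i :: r) F j w) = F i \+ (fun w => \sum_(j <- r) F j w).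
  by apply/funext => w; rewrite big_cons.
split.
- by rewrite E; apply: measurable_funD.
- exists (M + N) => w; rewrite big_cons (le_trans (ler_normD _ _))// lerD//.
- by rewrite E big_cons (fine_expectationD P (mF i) (FM i) mr hN) ih.
Qed.

Lemma disjoint_cells_sum (T : Type) (I : finType) (C : I -> set T) (phi : I -> R) (w : T) (i : I) :
  (forall j, C j w -> j = i) -> C i w -> \sum_j (\1_(C j) w : R) * phi j = phi i.
Proof.
move=> Cj Ci; rewrite (bigD1 i)//= big1 ?addr0.
  by rewrite indicE (mem_set Ci) mul1r.
move=> j ji; rewrite indicE memNset ?mul0r// => /Cj jE.
by rewrite jE eqxx in ji.
Qed.

Lemma empty_cells_sum (T : Type) (I : finType) (C : I -> set T) (phi : I -> R) (w : T) :
  (forall j, ~ C j w) -> \sum_j (\1_(C j) w : R) * phi j = 0.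
Proof. by move=> Cj; rewrite big1// => j _; rewrite indicE memNset ?mul0r. Qed.

Lemma cvg_finite_sum (I : finType) (a : I -> R -> R) (b : I -> R) :
  (forall i e, 0 < e -> exists T0 : R, forall T, T0 < T -> `|a i T - b i| <= e) ->
  forall e : R, 0 < e -> exists T0 : R, forall T, T0 < T ->
    `|\sum_i a i T - \sum_i b i| <= e.
Proof.
move=> ab e e0; have n0 : 0 < #|I|.+1%:R :> R by rewrite ltr0n.
have e'0 : 0 < e / #|I|.+1%:R by rewrite divr_gt0.
have [t ht] := choice (fun i => ab i _ e'0).
exists (\sum_i `|t i|) => T hT; rewrite -sumrB.
apply: (le_trans (ler_norm_sum _ _ _)).
apply: (@le_trans _ _ (\sum_(i : I) e / #|I|.+1%:R)).
  apply: ler_sum => i _; apply: ht; apply: le_lt_trans hT.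
  rewrite (bigD1 i)//=; apply: (le_trans (ler_norm _)).
  by rewrite lerDl sumr_ge0.
rewrite sumr_const -[leLHS]mulr_natr mulrAC ler_pdivrMr// ler_pM2l// ler_nat.
exact: leqnSn.
Qed.

End finite_sums.

Section product_space.
Context d1 d2 (Om1 : measurableType d1) (Om2 : measurableType d2) (R : realType).
Variables (P : probability Om1 R) (Q : probability Om2 R).

Lemma outer_le_fst (A : set Om1) (e : R) :
  outer_le P A e -> outer_le (P \x Q)%E (fst @^-1` A : set (Om1 * Om2)) e.
Proof.
move=> [B [mB AB PB]]; exists (B `*` setT); split.
- exact: measurableX.
- by move=> [w w'] /= /AB.
- rewrite [leLHS](_ : _ = (P B * Q setT)%E); last exact: product_measure1E.
  by rewrite probability_setT mule1.
Qed.

Lemma outer_le_snd (A : set Om2) (e : R) :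
  outer_le Q A e -> outer_le (P \x Q)%E (snd @^-1` A : set (Om1 * Om2)) e.
Proof.
move=> [B [mB AB PB]]; exists (setT `*` B); split.
- exact: measurableX.
- by move=> [w w'] /= /AB.
- rewrite [leLHS](_ : _ = (P setT * Q B)%E); last exact: product_measure1E.
  by rewrite probability_setT mul1e.
Qed.

Lemma fine_expectation_product (C : set Om1) (Z : Om2 -> R) (h : R -> R) (M : R) :
  measurable C -> measurable_fun setT Z -> measurable_fun setT h ->
  (forall x, `|h x| <= M) ->
  fine 'E_(P \x Q)%E[fun z : Om1 * Om2 => \1_C z.1 * h (Z z.2)] =
  fine (P C) * fine 'E_Q[h \o Z].
Proof.
move=> mC mZ mh hM.
have fC : P C \is a fin_num by rewrite fin_num_measure.
have mA : measurable (fst @^-1` C : set (Om1 * Om2)).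
  by have := @measurable_fst _ _ Om1 Om2 measurableT _ mC; rewrite setTI.
rewrite -(@fine_expectation_transfer _ _ _ _ _ (P \x Q)%E Q (Z \o snd) Z
  (fst @^-1` C) (fine (P C)) M)//.
- exact: measurableT_comp.
- move=> B mB; rewrite fineK//.
  have mZB : measurable (Z @^-1` B) by rewrite -[_ @^-1` _]setTI; exact: mZ.
  by rewrite -(product_measure1E P Q mC mZB).
- by rewrite fine_ge0.
Qed.

End product_space.

Section slutsky.
Context d1 d2 (Om1 : measurableType d1) (Om2 : measurableType d2) (R : realType).
Variables (P : probability Om1 R) (Q : probability Om2 R).
Variables (zeta : R -> Om1 -> R) (Z : Om2 -> R).
Hypotheses (mzeta : forall T, measurable_fun setT (zeta T)) (mZ : measurable_fun setT Z).
Hypothesis zetaZ : cvg_in_law P Q zeta Z.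

(* [U1, U2] need not be measurable: it is enough that they are localized by
   finitely many disjoint mixing events. *)
Lemma slutsky_mixing (V : pseudoMetricType R) (Psi : R * R * R -> V)
    (U1 U2 : Om1 -> R) (W : R -> Om1 -> V) :
  continuous Psi ->
  (forall eta : R, 0 < eta -> exists K : R, outer_le P [set w | K < `|U1 w| \/ K < `|U2 w|] eta) ->
  (forall de eta : R, 0 < de -> 0 < eta -> exists (I : finType) (C : I -> set Om1) (u1 u2 : I -> R),
     [/\ forall i, mixing_event P Q zeta Z (C i),
         forall w i j, C i w -> C j w -> i = j &
         outer_le P [set w | ~ exists i, [/\ C i w, `|U1 w - u1 i| < de & `|U2 w - u2 i| < de]] eta]) ->
  (forall de eta : R, 0 < de -> 0 < eta -> exists T0 : R, forall T, T0 < T ->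
     outer_le P [set w | ~ ball (Psi (U1 w, U2 w, zeta T w)) de (W T w)] eta) ->
  cvg_in_law P (P \x Q)%E W (fun z => Psi (U1 z.1, U2 z.1, Z z.2)).
Proof.
move=> cPsi hU hcells hW; apply/cvg_in_lawP => f cf [M hM] e e0.
have M0 : 0 <= M by exact: le_trans (hM (Psi (0, 0, 0))).
pose eta := e / (80 * (M + 1)).
have eta0 : 0 < eta by rewrite divr_gt0// mulr_gt0//; lra.
have etaM : 80 * (M * eta) <= e.
  rewrite (_ : 80 * (M * eta) = e * (M / (M + 1))); last by rewrite /eta; field; lra.
  by rewrite ler_piMr ?ltW// ltr_pdivrMr ?mul1r; lra.
have e20 : 0 < e / 20 by rewrite divr_gt0.
have [K1 hK1] := hU _ eta0.
have [K2 [T2 [_ hK2]]] := cvg_in_law_tight mzeta mZ zetaZ eta0.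
have [K3 _ hK3] := random_variable_tight Q mZ eta0.
pose K := Num.max K1 (Num.max K2 K3).
have K1K : K1 <= K by rewrite /K le_max lexx.
have K2K : K2 <= K by rewrite /K !le_max lexx orbT.
have K3K : K3 <= K by rewrite /K !le_max lexx !orbT.
pose J := `[- K, K]%classic : set R.
have JP (x : R) : ~ (K < `|x|) -> J x.
  by move=> /negP; rewrite -leNgt /J/= in_itv/= ler_norml.
pose cube := J `*` J `*` J : set (R * R * R).
have ccube : compact cube by do 2 (apply: compact_setX; last exact: segment_compact); exact: segment_compact.
have cKV : compact (Psi @` cube).
  by apply: continuous_compact => //; exact: continuous_subspaceT.
(* [d1'] is the accuracy needed for [W T], [d2'] the fineness needed for the cells; both moduli are
   taken on compact sets that are left with small probability only. *)
have [d1' d10 hd1] := continuous_near_compact cf cKV e20.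
have cfP : continuous (f \o Psi) by move=> z; apply: continuous_comp; [exact: cPsi|exact: cf].
have [d2' d20 hd2] := continuous_near_compact cfP ccube e20.
have [I [C [u1 [u2 [mixC disjC covC]]]]] := hcells _ _ d20 eta0.
have [T3 hT3] := hW _ _ d10 eta0.
pose g i (z : R) := f (Psi (u1 i, u2 i, z)).
have cg i : continuous (g i).
  have ct : continuous (fun z : R => (u1 i, u2 i, z)).
    by apply: continuous_pair => z; [exact: cvg_cst|exact: cvg_id].
  by move=> z; exact: (cvg_comp _ _ (ct z) (cfP _)).
have mg i : measurable_fun setT (g i) by exact: continuous_measurable_fun.
have gM i z : `|g i z| <= M by exact: hM.
(* [U1] and [U2] are frozen at the values attached to their cell, so the expectation is a finite sum
   to which mixing applies term by term; [H] is its limit, realized on the product space. *)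
pose G T w := \sum_i (\1_(C i) w : R) * g i (zeta T w).
pose H (z : Om1 * Om2) := \sum_i (\1_(C i) z.1 : R) * g i (Z z.2).
have mC i : measurable (C i) by have [] := mixC i.
have sumM (T : Type) (D : I -> set T) (phi : I -> R) (w : T) :
    (forall i j, D i w -> D j w -> i = j) -> (forall i, `|phi i| <= M) ->
    `|\sum_i (\1_(D i) w : R) * phi i| <= M.
  move=> dD phiM; have [[i Di]|nD] := pselect (exists i, D i w).
    by rewrite (disjoint_cells_sum _ _ Di)// => j Dj; exact: dD.
  by rewrite empty_cells_sum ?normr0// => j Dj; apply: nD; exists j.
have mG T : measurable_fun setT (G T).
  apply: measurable_sum => i; apply: measurable_funM; first exact: measurable_indic.
  exact: measurableT_comp.
have mH : measurable_fun setT H.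
  apply: measurable_sum => i; apply: measurable_funM.
    apply: measurableT_comp; first exact: measurable_indic.
    exact: measurable_fst.
  by apply: measurableT_comp => //; apply: measurableT_comp => //; exact: measurable_snd.
have GM T w : `|G T w| <= M by apply: sumM => // i j; exact: disjC.
have HM z : `|H z| <= M.
  by rewrite /H; apply: (sumM _ (fun i => C i)) => // i j; exact: disjC.
have bC i T w : `|(\1_(C i) w : R) * g i (zeta T w)| <= M.
  by rewrite normrM -[leRHS]mul1r ler_pM//; exact: indic_norm_le1.
have EG T : fine 'E_P[G T] = \sum_i fine 'E_P[fun w => \1_(C i) w * g i (zeta T w)].
  rewrite /G (@fine_expectation_sum _ _ _ P I (fun i w => \1_(C i) w * g i (zeta T w)) M)//.
  move=> i; apply: measurable_funM; first exact: measurable_indic.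
  exact: measurableT_comp.
have EH : fine 'E_(P \x Q)%E[H] = \sum_i fine (P (C i)) * fine 'E_Q[g i \o Z].
  rewrite /H (@fine_expectation_sum _ _ _ (P \x Q)%E I (fun i z => \1_(C i) z.1 * g i (Z z.2)) M).
  - by apply: eq_bigr => i _; exact: (@fine_expectation_product _ _ _ _ _ P Q _ _ _ M).
  - move=> i; apply: measurable_funM.
      apply: measurableT_comp; first exact: measurable_indic.
      exact: measurable_fst.
    by apply: measurableT_comp => //; apply: measurableT_comp => //; exact: measurable_snd.
  - by move=> i z; rewrite normrM -[leRHS]mul1r ler_pM//; exact: indic_norm_le1.
have [|T4 hT4] := @cvg_finite_sum R I (fun i T => fine 'E_P[fun w => \1_(C i) w * g i (zeta T w)])
  (fun i => fine (P (C i)) * fine 'E_Q[g i \o Z]) _ _ e20.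
  move=> i e' e'0; have [_ /(_ (g i) (cg i) (ex_intro _ M (gM i)) e' e'0)] := mixC i.
  by [].
have close (w1 w2 z : R) i : J w1 -> J w2 -> J z -> `|w1 - u1 i| < d2' -> `|w2 - u2 i| < d2' ->
    `|g i z - f (Psi (w1, w2, z))| <= e / 20.
  move=> J1 J2 Jz b1 b2; apply: (hd2 (w1, w2, z) (u1 i, u2 i, z)) => //.
  by split; [split|exact: ballxx].
have hH : `|fine 'E_(P \x Q)%E[f \o (fun z => Psi (U1 z.1, U2 z.1, Z z.2))]
     - fine 'E_(P \x Q)%E[H]| <= e / 20 + 2 * M * (eta + eta + eta).
  apply: (expectation_approx mH _ HM M0 (ltW e20)
    (outer_leU (outer_leU (outer_le_fst Q hK1) (outer_le_snd P hK3)) (outer_le_fst Q covC))).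
    by move=> z; exact: hM.
  move=> [w w'] /= /not_orP[/not_orP[/not_orP[n1 n2] n3] /contrapT[i [Ci b1 b2]]].
  rewrite /H /= (disjoint_cells_sum (fun i => g i (Z w')) _ Ci); last by move=> j Cj; exact: disjC Cj Ci.
  rewrite distrC; apply: close => //; apply: JP => ?; [apply: n1|apply: n2|apply: n3];
    exact: le_lt_trans _ (_ : K < _).
exists (Num.max T2 (Num.max T3 T4)) => T; rewrite !gt_max => /and3P[TT2 TT3 TT4].
have hG : `|fine 'E_P[f \o W T] - fine 'E_P[G T]| <= e / 10 + 2 * M * (eta + eta + eta + eta).
  have e10 : 0 <= e / 10 by rewrite divr_ge0 ?ltW.
  apply: (expectation_approx (mG T) _ (GM T) M0 e10
    (outer_leU (outer_leU (outer_leU hK1 (hK2 T TT2)) covC) (hT3 T TT3))).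
    by move=> z; exact: hM.
  move=> w /= /not_orP[/not_orP[/not_orP[/not_orP[n1 n2] n3] /contrapT[i [Ci b1 b2]]] /contrapT bW].
  rewrite /G /= (disjoint_cells_sum (fun i => g i (zeta T w)) _ Ci); last by move=> j Cj; exact: disjC Cj Ci.
  have J1 : J (U1 w) by apply: JP => ?; apply: n1; exact: le_lt_trans _ (_ : K < _).
  have J2 : J (U2 w) by apply: JP => ?; apply: n2; exact: le_lt_trans _ (_ : K < _).
  have J3 : J (zeta T w) by apply: JP => ?; apply: n3; exact: le_lt_trans _ (_ : K < _).
  have := close _ _ _ i J1 J2 J3 b1 b2.
  have mem : (Psi @` cube) (Psi (U1 w, U2 w, zeta T w)) by exists (U1 w, U2 w, zeta T w).
  have := hd1 _ _ mem bW; rewrite !ler_norml; lra.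
have := hT4 T TT4; rewrite -EG -EH; move: hG hH etaM.
rewrite !ler_norml; lra.
Qed.

End slutsky.

(** * Supremum under negative drift *)

Section negative_drift.
Context {R : realType}.
Variables (x : R -> R) (c de : R).
Hypotheses (x0 : x 0 = 0) (de0 : 0 < de).
Hypothesis xc : forall t : R, 0 <= t -> x s @[s --> t^'+] --> x t.
Hypothesis xl : forall t : R, 0 <= t -> x t <= c - de * t.

(* The supremum over all times is already approached on [0, t]. *)
Definition sup_reached (x : R -> R) (t : R) : Prop :=
  forall s e : R, 0 <= s -> 0 < e -> exists2 r, 0 <= r <= t & x s - e < x r.

Definition path_sup (x : R -> R) : R := sup [set x t | t in [set t : R | 0 <= t]].

(** Stated through approach rather than attainment, because a path with a downward jump may approach
    its supremum only as a left limit. *)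
Definition path_argsup (x : R -> R) : R := inf [set t : R | 0 <= t /\ sup_reached x t].

Let S := path_sup x.
Let g := path_argsup x.
(** Beyond it the path is below -1, hence below its initial value; adding 1 to [c] keeps the horizon
    positive when [c = 0]. *)
Definition drift_horizon : R := (c + 1) / de.
Let T1 := drift_horizon.

Lemma drift_const_ge0 : 0 <= c.
Proof. by have := xl (lexx 0); rewrite x0 mulr0 subr0. Qed.

Lemma drift_horizon_gt0 : 0 < drift_horizon.
Proof. by have c0 := drift_const_ge0; rewrite divr_gt0//; lra. Qed.

Lemma path_bounded t : 0 <= t -> x t <= c.
Proof. by move=> t0; have := xl t0; have := mulr_ge0 (ltW de0) t0; lra. Qed.

Lemma path_after_horizon t : T1 < t -> x t < 0.
Proof.
move=> Tt; have h0 := drift_horizon_gt0; have t0 : 0 <= t by rewrite /T1 in Tt; lra.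
by move: Tt; rewrite /T1 /drift_horizon ltr_pdivrMr//; have := xl t0; lra.
Qed.

Lemma path_sup_ub t : 0 <= t -> x t <= path_sup x.
Proof.
move=> t0; apply: ub_le_sup; last by exists t.
by exists c; apply/ubP => _ [s s0 <-]; exact: path_bounded.
Qed.

Lemma path_sup_le b : (forall t, 0 <= t -> x t <= b) -> path_sup x <= b.
Proof.
move=> xb; apply: sup_le_ub; first by exists (x 0), 0 => /=.
by apply/ubP => _ [s s0 <-]; exact: xb.
Qed.

Lemma path_sup_adherent (e : R) : 0 < e -> exists2 s, 0 <= s & path_sup x - e < x s.
Proof.
move=> e0; apply: contrapT => h.
have : path_sup x <= path_sup x - e; last lra.
apply: path_sup_le => t t0; rewrite leNgt; apply/negP => ht; apply: h; by exists t.
Qed.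

Lemma path_sup_bounds : 0 <= path_sup x <= c.
Proof.
by rewrite path_sup_le ?andbT; [rewrite -x0; exact: path_sup_ub|exact: path_bounded].
Qed.

Lemma sup_reached_horizon : sup_reached x T1.
Proof.
move=> s e s0 e0; have h0 := drift_horizon_gt0.
have [sT|Ts] := leP s T1; first by exists s; [rewrite s0|lra].
by exists 0; [rewrite lexx ltW|rewrite x0; have := path_after_horizon Ts; lra].
Qed.

Lemma sup_reachedW t t' : t <= t' -> sup_reached x t -> sup_reached x t'.
Proof.
move=> tt' ht s e s0 e0; have [r /andP[r0 rt] hr] := ht s e s0 e0.
by exists r => //; rewrite r0 (le_trans rt).
Qed.

Let reached_nonempty : [set t : R | 0 <= t /\ sup_reached x t] !=set0.
Proof. by exists T1; split; [exact/ltW/drift_horizon_gt0|exact: sup_reached_horizon]. Qed.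

Let reached_lb : lbound [set t : R | 0 <= t /\ sup_reached x t] 0.
Proof. by move=> t []. Qed.

Lemma path_argsup_bounds : 0 <= path_argsup x <= T1.
Proof.
apply/andP; split; first exact: lb_le_inf reached_nonempty reached_lb.
apply: ge_inf; first by exists 0.
by split; [exact/ltW/drift_horizon_gt0|exact: sup_reached_horizon].
Qed.

Lemma path_argsup_le t : 0 <= t -> sup_reached x t -> path_argsup x <= t.
Proof. by move=> t0 ht; apply: ge_inf; [exists 0|split]. Qed.

(** The infimum is attained by right continuity: if the path stayed [e] below some value on [0, g],
    it would stay [e / 2] below it slightly beyond [g], where there are times at which the supremum
    has been reached. *)
Lemma sup_reached_argsup : sup_reached x (path_argsup x).
Proof.
move=> s e s0 e0; apply: contrapT => h; have /andP[g0 _] := path_argsup_bounds.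
have hr (r : R) : 0 <= r <= g -> x r <= x s - e.
  by move=> rg; rewrite leNgt; apply/negP => hr; apply: h; exists r.
have e2 : 0 < e / 2 by rewrite divr_gt0.
have /cvgrPdist_lt/(_ _ e2)[d /= d0 hd] := xc g0.
have hinf : has_inf [set t : R | 0 <= t /\ sup_reached x t].
  by split; [exact: reached_nonempty|exists 0].
have [t [t0 ht] tg] := inf_adherent d0 hinf.
have [r /andP[r0 rt] hxr] := ht s (e / 2) s0 e2.
have [rg|gr] := leP r g.
  by have := hr r; rewrite r0 rg => /(_ isT); lra.
have := hd r; rewrite /= ltr0_norm; last by rewrite subr_lt0.
have rgd : - (g - r) < d.
  rewrite /g /path_argsup; move: tg; rewrite /g /path_argsup in gr *; lra.
move=> /(_ rgd gr); rewrite ltr_norml => /andP[h1 _].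
have := hr g; rewrite g0 lexx => /(_ isT); rewrite -/g in h1 *; lra.
Qed.

Let xM T : exists M, forall t, 0 <= t <= T -> x t <= M.
Proof. by exists c => t /andP[t0 _]; exact: path_bounded. Qed.

Lemma majorant_le_sup T t : 0 <= t <= T -> concave_majorant T x t <= path_sup x.
Proof.
move=> tT; have h := concave_majorant_le (xM T) (@concave_on_affine R T (path_sup x) 0) _ tT.
rewrite mul0r addr0 in h; apply: h => s /andP[s0 _].
by rewrite mul0r addr0; exact: path_sup_ub.
Qed.

Lemma majorant_sup_eventually T : T1 < T -> majorant_sup T x = path_sup x.
Proof.
move=> TT; have h0 := drift_horizon_gt0; have T0 : 0 <= T by rewrite /T1 in TT; lra.
apply/eqP; rewrite eq_le; apply/andP; split.
  apply: sup_le_ub; first by exists (concave_majorant T x 0), 0 => //=; rewrite in_itv/= lexx.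
  by apply/ubP => _ [t /= + <-]; rewrite in_itv/=; exact: majorant_le_sup.
apply: path_sup_le => t t0.
have key (r : R) : 0 <= r <= T -> x r <= majorant_sup T x.
  move=> rT; apply: le_trans (le_concave_majorant (xM T) rT) _.
  apply: ub_le_sup; last by exists r => //=; rewrite in_itv/=.
  exists (path_sup x); apply/ubP => _ [s /= + <-]; rewrite in_itv/=.
  exact: majorant_le_sup.
have [tT|Tt] := leP t T; first by apply: key; rewrite t0.
apply: (@le_trans _ _ (x 0)); last by apply: key; rewrite lexx.
by rewrite x0 ltW//; apply: path_after_horizon; apply: lt_trans Tt.
Qed.

(** Up to some [t'] between [t] and the argsup the path stays [e] below its supremum. The line from
    [path_sup x - e] at time 0 to [path_sup x] at time [t'] is therefore above the path, and it is
    still below the supremum at [t]. *)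
Lemma majorant_lt_before T t : 0 <= t <= T -> t < path_argsup x ->
  concave_majorant T x t < path_sup x.
Proof.
move=> /andP[t0 tT] tg; pose t' := (t + path_argsup x) / 2.
have tt' : t < t' by rewrite /t'; lra.
have t'g : t' < path_argsup x by rewrite /t'; lra.
have t'0 : 0 < t' by lra.
have : ~ sup_reached x t'.
  by move=> ht'; have := path_argsup_le (ltW t'0) ht'; lra.
move=> /existsNP[s] /existsNP[e] /not_implyP[s0] /not_implyP[e0 h].
have hr (r : R) : 0 <= r <= t' -> x r <= path_sup x - e.
  move=> rt'; apply: (@le_trans _ _ (x s - e)); last by have := path_sup_ub s0; lra.
  by rewrite leNgt; apply/negP => hr; apply: h; exists r.
have tT' : 0 <= t <= T by rewrite t0.
have := concave_majorant_le (xM T) (@concave_on_affine R T (path_sup x - e) (e / t')) _ tT'.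
move=> /(_ _)/le_lt_trans; apply; last first.
  have : e / t' * t < e / t' * t' by rewrite ltr_pM2l// divr_gt0.
  by rewrite divfK ?gt_eqF//; lra.
move=> u /andP[u0 uT]; have [ut'|t'u] := leP u t'.
  have := hr u; rewrite u0 ut' => /(_ isT).
  have : 0 <= e / t' * u by rewrite mulr_ge0// divr_ge0// ltW.
  lra.
have := path_sup_ub u0.
have : e / t' * t' <= e / t' * u by rewrite ler_pM2l ?ltW// divr_gt0.
by rewrite divfK ?gt_eqF//; lra.
Qed.

(** The path comes close to its supremum at times within [d] to the left of the argsup. A deficit
    [eta] there would make the majorant drop by at least [eta / 2] over such a short interval, and
    by concavity keep that slope up to [T], exceeding the finite drop [W]. *)
Lemma majorant_at_argsup T : T1 < T -> concave_majorant T x (path_argsup x) = path_sup x.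
Proof.
move=> TT; have h0 := drift_horizon_gt0; have /andP[g0 gT1] := path_argsup_bounds.
have gT : path_argsup x < T by rewrite /T1 in TT gT1; lra.
have T0 : 0 <= T by lra.
have gT' : 0 <= path_argsup x <= T by rewrite g0 ltW.
apply/eqP; rewrite eq_le majorant_le_sup//= leNgt; apply/negP => lt.
have [eta etaE] : exists eta : R, eta = path_sup x - concave_majorant T x (path_argsup x).
  by eexists.
have eta0 : 0 < eta by lra.
have [W [W1 WE]] : exists W : R, 1 <= W /\
    concave_majorant T x (path_argsup x) - concave_majorant T x T <= W.
  exists (Num.max 1 (concave_majorant T x (path_argsup x) - concave_majorant T x T)).
  by rewrite !le_max !lexx orbT.
have [d [d0 dE]] : exists d : R, 0 < d /\ d * W < (T - path_argsup x) * (eta / 2).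
  exists ((T - path_argsup x) * (eta / 4) / W).
  rewrite divfK; last by rewrite gt_eqF//; lra.
  by split; [rewrite divr_gt0 ?mulr_gt0//; lra|rewrite ltr_pM2l; lra].
(* If [path_argsup x - d] is positive, the path stays some [e1] below the value at some [s1] up to
   that time, so a point closer to the supremum than [e1] must come later; otherwise every [r] is
   late enough. *)
have [r /andP[r0 rg] [gr xr]] : exists2 r : R, 0 <= r <= path_argsup x &
    path_argsup x - d <= r /\ path_sup x - eta / 2 < x r.
  have eta2 : 0 < eta / 4 by rewrite divr_gt0.
  have [gd|dg] := leP (path_argsup x - d) 0.
    have [s s0 hs] := path_sup_adherent eta2.
    have [r /andP[r0 rg] hr] := sup_reached_argsup s0 eta2.
    exists r; [by rewrite r0|lra].
  have : ~ sup_reached x (path_argsup x - d).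
    by move=> h; have := path_argsup_le (ltW dg) h; lra.
  move=> /existsNP[s1] /existsNP[e1] /not_implyP[s10] /not_implyP[e10 h].
  have [e [e_0 e_1 e_2]] : exists e : R, [/\ 0 < e, e <= eta / 4 & e <= e1 / 4].
    exists (Num.min (eta / 4) (e1 / 4)); rewrite lt_min !ge_min !lexx orbT eta2.
    by split => //; rewrite divr_gt0.
  have [s s0 hs] := path_sup_adherent e_0.
  have [r /andP[r0 rg] hr] := sup_reached_argsup s0 e_0.
  exists r; first by rewrite r0.
  split; last lra.
  rewrite leNgt; apply/negP => rd; apply: h; exists r; first by rewrite r0 ltW.
  by have := path_sup_ub s10; lra.
have rT : 0 <= r <= T by lra.
have := le_concave_majorant (xM T) rT.
have /concave_onP := concave_on_concave_majorant (xM T).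
move=> /(_ r (path_argsup x) T r0 rg (ltW gT) (lexx _)).
move: etaE WE; move: (concave_majorant T x (path_argsup x)) (concave_majorant T x T)
  (concave_majorant T x r) => Cg CT Cr etaE WE h1 h2.
have h3 : (T - path_argsup x) * (path_sup x - eta / 2) <= (T - path_argsup x) * Cr.
  by rewrite ler_pM2l; lra.
have h4 : (path_argsup x - r) * (Cg - CT) <= (path_argsup x - r) * W.
  by rewrite ler_wpM2l//; lra.
have h5 : (path_argsup x - r) * W <= d * W by rewrite ler_wpM2r//; lra.
move: dE h3; rewrite etaE; lra.
Qed.

Lemma majorant_argmax_eventually T : T1 < T -> majorant_argmax T x = path_argsup x.
Proof.
move=> TT; have h0 := drift_horizon_gt0; have /andP[g0 gT1] := path_argsup_bounds.
have gT : path_argsup x <= T by rewrite /T1 in TT gT1; lra.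
have mem : [set t | t \in `[0, T] /\ concave_majorant T x t = majorant_sup T x]
    (path_argsup x).
  split; first by rewrite in_itv/= g0.
  by rewrite majorant_at_argsup// majorant_sup_eventually.
have lb : lbound [set t | t \in `[0, T] /\ concave_majorant T x t = majorant_sup T x]
    (path_argsup x).
  move=> t []; rewrite in_itv/= majorant_sup_eventually// => tT Ct.
  by rewrite leNgt; apply/negP => /(majorant_lt_before tT); rewrite Ct ltxx.
apply/eqP; rewrite eq_le; apply/andP; split.
  by apply: ge_inf => //; exists (path_argsup x).
by apply: lb_le_inf => //; exists (path_argsup x).
Qed.

End negative_drift.

(** * Mixing of the events generated by the path *)

Section levy_mixing.
Context d1 d2 (Om1 : measurableType d1) (Om2 : measurableType d2) (R : realType).
Variables (P : probability Om1 R) (Q : probability Om2 R).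
Variables (X : R -> {RV P >-> R}) (mu : R).
Hypothesis hX : levy_process P X.
Local Notation Y := (centred X mu).
Variables (a : R -> R) (Z : Om2 -> R).
Let zeta (T : R) (w : Om1) : R := Y T w / a T.
Hypothesis mZ : measurable_fun setT Z.
Hypothesis zetaZ : cvg_in_law P Q zeta Z.
Hypothesis a_oo : forall K : R, exists2 T0 : R, 0 < T0 & forall T, T0 <= T -> K < a T.

Lemma measurable_scaled (T : R) : measurable_fun setT (zeta T).
Proof. by apply: measurable_funM => //; exact: measurable_centred. Qed.

(** [Y T - Y (t n)] is independent of [A], and the difference [Y (t n)] from [Y T] vanishes after
    division by [a T]. Replacing [zeta] by [zeta'] is thus harmless both with and without the
    indicator of [A]. *)
Lemma mixing_past (t : nat -> R) (n : nat) (A : set Om1) :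
  0 <= t 0%N -> (forall i, t i <= t i.+1) -> <<s incr_boxes X mu t n >> A ->
  mixing_event P Q zeta Z A.
Proof.
move=> t0 tS sA.
have [mA _] := block_independence hX t0 tS (lexx (t n)) sA measurableT.
split => // g cg [M hM] e e0.
have M0 : 0 <= M by exact: le_trans (hM 0).
have mg : measurable_fun setT g by exact: continuous_measurable_fun.
pose eta := e / (40 * (M + 1)).
have eta0 : 0 < eta by rewrite divr_gt0// mulr_gt0//; lra.
have etaM : 40 * (M * eta) <= e.
  rewrite (_ : 40 * (M * eta) = e * (M / (M + 1))); last by rewrite /eta; field; lra.
  by rewrite ler_piMr ?ltW// ltr_pdivrMr ?mul1r; lra.
have e10 : 0 < e / 10 by rewrite divr_gt0.
have [K [T1 [_ hK]]] := cvg_in_law_tight measurable_scaled mZ zetaZ eta0.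
have [de de0 hde] := continuous_near_compact cg (@segment_compact R (- K) K) e10.
have [K' K'0 hK'] := random_variable_tight P (measurable_centred X mu (t n)) eta0.
have [T2 T20 hT2] := a_oo (K' / de).
have [T3 hT3] := (cvg_in_lawP _ _ _ _).1 zetaZ g cg (ex_intro _ M hM) _ e10.
exists (Num.max (Num.max T1 (t n)) (Num.max T2 T3)) => T.
rewrite !gt_max => /andP[/andP[TT1 Ttn] /andP[TT2 TT3]].
have aT := hT2 _ (ltW TT2).
have aT0 : 0 < a T by apply: lt_trans aT; rewrite divr_gt0.
pose zeta' w := (Y T w - Y (t n) w) / a T.
have mz' : measurable_fun setT zeta'.
  by apply: measurable_funM => //; exact: measurable_centred_incr.
have bad := outer_leU (hK T TT1) hK'.
have close w : ~ (([set w | K < `|zeta T w|] `|` [set w | K' < `|Y (t n) w|]) w) ->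
    `|g (zeta T w) - g (zeta' w)| <= e / 10.
  move=> /not_orP[/= /negP n1 /negP n2]; rewrite -!leNgt in n1 n2.
  rewrite distrC; apply: hde; first by rewrite /= in_itv/= -ler_norml.
  rewrite /ball/= /zeta /zeta' -mulrBl opprB addrC subrK normrM normfV (gtr0_norm aT0).
  rewrite ltr_pdivrMr//; apply: (le_lt_trans n2).
  by rewrite mulrC -ltr_pdivrMr.
have bA (z : Om1 -> R) w : `|(\1_A w : R) * g (z w)| <= M.
  by rewrite normrM -[leRHS]mul1r ler_pM//; exact: indic_norm_le1.
have mAz (z : Om1 -> R) : measurable_fun setT z ->
    measurable_fun setT (fun w => (\1_A w : R) * g (z w)).
  by move=> mz; apply: measurable_funM; [exact: measurable_indic|exact: measurableT_comp].
have h1 : `|fine 'E_P[fun w => \1_A w * g (zeta T w)] - fine 'E_P[fun w => \1_A w * g (zeta' w)]|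
    <= e / 10 + 2 * M * (eta + eta).
  apply: (expectation_approx (mAz _ mz') (bA _) (bA _) M0 (ltW e10) bad) => w /close h.
  by rewrite -mulrBr normrM; apply: le_trans h; rewrite ler_piMl//; exact: indic_norm_le1.
have h2 : `|fine 'E_P[g \o zeta T] - fine 'E_P[g \o zeta']| <= e / 10 + 2 * M * (eta + eta).
  have mgz : measurable_fun setT (g \o zeta') by exact: measurableT_comp.
  by apply: (expectation_approx mgz _ _ M0 (ltW e10) bad) => w; [exact: hM|exact: hM|exact: close].
have fA : P A \is a fin_num by rewrite fin_num_measure.
have h3 : fine 'E_P[fun w => \1_A w * g (zeta' w)] = fine (P A) * fine 'E_P[g \o zeta'].
  apply: (@fine_expectation_transfer _ _ _ _ _ P P zeta' zeta' A _ M) => //.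
    move=> B mB; rewrite fineK//.
    have mB' : measurable [set z : R | B (z / a T)].
      have mf : measurable_fun setT (fun z : R => z / a T) by exact: measurable_funM.
      by have := mf measurableT _ mB; rewrite setTI.
    by have [_] := block_independence hX t0 tS (ltW Ttn) sA mB'.
  by rewrite fine_ge0.
have h4 := hT3 T TT3.
have p0 : 0 <= fine (P A) by rewrite fine_ge0.
have p1 : fine (P A) <= 1 by rewrite -lee_fin fineK// probability_le1.
rewrite h3 in h1; move: h1 h2 h4 p0 p1.
move: (fine (P A)) (fine 'E_P[g \o zeta']) (fine 'E_P[g \o zeta T]) (fine 'E_Q[g \o Z]).
move: (fine 'E_P[fun w => \1_A w * g (zeta T w)]) => E1 p E2 E3 E4 h1 h2 h4 p0 p1.
have h5 : `|p * (E2 - E4)| <= e / 5 + 2 * M * (eta + eta).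
  rewrite normrM (ger0_norm p0); apply: (@le_trans _ _ (1 * `|E2 - E4|)).
    by rewrite ler_wpM2r.
  rewrite mul1r; move: h2 h4; rewrite !ler_norml; lra.
move: h1 h5; rewrite mulrBr !ler_norml; lra.
Qed.

Definition dyadic (m i : nat) : R := i%:R / (2 ^ m)%:R.

(** Level [m] has [4 ^ m] steps of length [2 ^ -m] and covers [0, 2 ^ m]: the mesh shrinks while the
    horizon grows, so every dyadic time appears. The levels are nested, which makes their union a
    pi-system. *)
Definition past_level (m : nat) : set (set Om1) := <<s incr_boxes X mu (dyadic m) (4 ^ m) >>.

Definition past : set (set Om1) := \bigcup_m past_level m.

Lemma dyadic_ge0 m i : 0 <= dyadic m i.
Proof. by rewrite divr_ge0. Qed.

Lemma dyadicS m i : dyadic m i <= dyadic m i.+1.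
Proof. by rewrite ler_wpM2r ?invr_ge0// ler_nat. Qed.

Lemma dyadic_refine m k i : dyadic (m + k) (i * 2 ^ k) = dyadic m i.
Proof.
by rewrite /dyadic expnD !natrM -mulf_div divff ?mulr1// pnatr_eq0 -lt0n expn_gt0.
Qed.

Lemma past_levelS m : past_level m `<=` past_level m.+1.
Proof.
apply: smallest_sub; first exact: smallest_sigma_algebra.
move=> _ [B mB <-].
suff : @measurable _ (g_sigma_algebraType (incr_boxes X mu (dyadic m.+1) (4 ^ m.+1)))
    [set w | forall i, (i < 4 ^ m)%N -> B i (Y (dyadic m i.+1) w - Y (dyadic m i) w)] by [].
rewrite (_ : [set w | _] = \bigcap_(i in `I_(4 ^ m))
  [set w | B i (Y (dyadic m i.+1) w - Y (dyadic m i) w)])//.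
apply: bigcap_measurableType => i /= im.
have refine j : dyadic m.+1 (j * 2) = dyadic m j by rewrite -(dyadic_refine m 1) addn1.
have le (j : nat) : (j <= 4 ^ m)%N -> (j * 2 <= 4 ^ m.+1)%N.
  by move=> jm; rewrite expnS mulnC leq_mul.
have h1 := @partial_sum_measurable_boxes _ _ _ _ X mu (dyadic m.+1) _ _ (le _ im).
have h2 := @partial_sum_measurable_boxes _ _ _ _ X mu (dyadic m.+1) _ _ (le _ (ltnW im)).
have := measurable_funB h1 h2 => /(_ measurableT _ (mB i)).
rewrite setTI !refine.
have E w : Y (dyadic m i.+1) w - Y (dyadic m.+1 0) w - (Y (dyadic m i) w - Y (dyadic m.+1 0) w)
  = Y (dyadic m i.+1) w - Y (dyadic m i) w by ring.
by congr measurable; apply/seteqP; split => w /=; rewrite E.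
Qed.

Lemma past_level_le m k : past_level m `<=` past_level (m + k).
Proof.
elim: k => [|k ih]; first by rewrite addn0.
by rewrite addnS; apply: subset_trans ih _; exact: past_levelS.
Qed.

Lemma setI_closed_past : setI_closed past.
Proof.
move=> A B [m _ sA] [n _ sB]; exists (m + n)%N => //.
have sA' : past_level (m + n) A by exact: past_level_le.
have sB' : past_level (m + n) B by rewrite addnC; exact: past_level_le.
have mI := @measurableI _ (g_sigma_algebraType (incr_boxes X mu (dyadic (m + n)) (4 ^ (m + n)))).
exact: mI.
Qed.

Lemma mixing_past_sigma A : <<s past >> A -> mixing_event P Q zeta Z A.
Proof.
suff : <<s past >> `<=` mixing_event P Q zeta Z by apply.
apply: (lambda_system_subset setI_closed_past
  (mixing_lambda_system measurable_scaled zetaZ)) => //.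
move=> B [m _ sB]; apply: mixing_past sB; first exact: dyadic_ge0.
exact: dyadicS.
Qed.

Lemma past_measurable_increment m j :
  @measurable_fun _ _ (g_sigma_algebraType past) R setT
    (fun w => X (dyadic m j) w - X 0 w).
Proof.
(* The time [j / 2 ^ m] reappears at level [m + j] with index [j * 2 ^ j], which is within the
   horizon of that level. *)
have hj : (j * 2 ^ j <= 4 ^ (m + j))%N.
  rewrite expnD; apply: (@leq_trans (4 ^ j)); last by rewrite leq_pmull// expn_gt0.
  rewrite (_ : 4 = 2 * 2)%N// expnMn leq_mul2r; apply/orP; right.
  exact/ltnW/ltn_expl.
have h := @partial_sum_measurable_boxes _ _ _ _ X mu (dyadic (m + j)) _ _ hj.
have mY : @measurable_fun _ _ (g_sigma_algebraType past) R setT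
    (fun w => Y (dyadic m j) w - Y 0 w).
  move=> _ B mB; rewrite setTI; apply: sub_sigma_algebra; exists (m + j)%N => //.
  have := h measurableT _ mB; rewrite setTI dyadic_refine.
  by rewrite /past_level /dyadic mul0r.
rewrite (_ : (fun w => _) = (fun w => (Y (dyadic m j) w - Y 0 w) + mu * dyadic m j)); last first.
  by apply/funext => w; rewrite /centred; ring.
exact: measurable_funD.
Qed.

(** A description through countably many times of a bound on the supremum, and in [reach_event] of
    [sup_reached]. [X 0] is subtracted because [past] contains increments only. *)
Definition le_event (c : R) : set Om1 :=
  [set w | forall m j, X (dyadic m j) w - X 0 w <= c].

Definition reach_event (t : R) : set Om1 :=
  [set w | forall m j k, exists m' j', dyadic m' j' <= t /\
     X (dyadic m j) w - k.+1%:R^-1 < X (dyadic m' j') w].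

Lemma le_event_past c : <<s past >> (le_event c).
Proof.
suff : @measurable _ (g_sigma_algebraType past) (le_event c) by [].
rewrite (_ : le_event c = \bigcap_m \bigcap_j [set w | X (dyadic m j) w - X 0 w <= c]).
  apply: bigcapT_measurable => m; apply: bigcapT_measurable => j.
  have := past_measurable_increment m j measurableT (measurable_itv `]-oo, c]).
  by rewrite setTI; congr measurable; apply/seteqP; split => w /=; rewrite in_itv.
by apply/seteqP; split => w /=; [move=> h m _ j _; exact: h|move=> h m j; exact: h].
Qed.

Lemma reach_event_past t : <<s past >> (reach_event t).
Proof.
suff : @measurable _ (g_sigma_algebraType past) (reach_event t) by [].
rewrite (_ : reach_event t = \bigcap_m \bigcap_j \bigcap_k \bigcup_m'
   \bigcup_(j' in [set j' | dyadic m' j' <= t])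
   [set w | X (dyadic m j) w - k.+1%:R^-1 < X (dyadic m' j') w]).
  apply: bigcapT_measurable => m; apply: bigcapT_measurable => j.
  apply: bigcapT_measurable => k; apply: bigcupT_measurable => m'.
  apply: bigcup_measurable => j' _.
  have := measurable_funB (past_measurable_increment m' j') (past_measurable_increment m j).
  move=> /(_ measurableT _ (measurable_itv `]- k.+1%:R^-1, +oo[)).
  rewrite setTI; congr measurable; apply/seteqP; split => w /=; rewrite in_itv/= andbT;
    move: (k.+1%:R^-1 : R) => z h; lra.
apply/seteqP; split => w /=.
  move=> h m _ j _ k _; have [m' [j' [h1 h2]]] := h m j k.
  by exists m' => //; exists j'.
by move=> h m j k; have [m' _ [j' h1 h2]] := h m I j I k I; exists m', j'.
Qed.

Section regular.
Variables (w : Om1) (c de : R).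
Hypotheses (rw : regular_path X w) (de0 : 0 < de).
Hypothesis drift : forall t : R, 0 <= t -> X t w <= c - de * t.
Let x t := X t w.

Lemma dyadic_right_approx (u e d : R) : 0 <= u -> 0 < e -> 0 < d ->
  exists m j, u <= dyadic m j < u + d /\ x u - e < x (dyadic m j).
Proof.
move=> u0 e0 d0; have [_ xc] := rw.
have /cvgrPdist_lt/(_ _ e0)[r /= r0 hr] := xc u u0.
pose v := u + Num.min r d.
have uv : u < v by rewrite /v ltrDl lt_min r0.
have [p hp] := exp2_gt v.
have p0 : (0 : R) < (2 ^ p)%:R by exact: exp2_gt0.
have [n [j [_ h1 h2]]] := dyadic_between p0 u0 uv (ltW hp).
have E : dyadic n (j * 2 ^ p) = j%:R * (2 ^ p)%:R / (2 ^ n)%:R by rewrite /dyadic natrM.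
exists n, (j * 2 ^ p)%N; rewrite E.
have vd : v <= u + d by rewrite /v lerD2l ge_min lexx orbT.
have vr : v <= u + r by rewrite /v lerD2l ge_min lexx.
split; first by rewrite (ltW h1)/=; exact: lt_le_trans h2 vd.
have := hr (j%:R * (2 ^ p)%:R / (2 ^ n)%:R).
rewrite /ball_/= ltr0_norm; last by rewrite subr_lt0.
move=> /(_ ltac:(lra) h1); rewrite ltr_norml /x; lra.
Qed.

Let x0 : x 0 = 0. Proof. by have [] := rw. Qed.

Lemma le_eventP b : le_event b w <-> path_sup x <= b.
Proof.
split=> [h|h m j].
  apply: path_sup_le => // u u0; apply/ler_addgt0Pr => e e0.
  have [m [j [_ hx]]] := dyadic_right_approx u0 e0 ltr01.
  have := h m j; rewrite -/(x _) -/(x 0) x0 subr0; lra.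
rewrite -/(x _) -/(x 0) x0 subr0; apply: le_trans h.
exact: (path_sup_ub de0 drift (dyadic_ge0 m j)).
Qed.

(** The time bound is itself dyadic: an approximating time equal to it can be kept, and an earlier
    one is replaced by a dyadic time to its right that does not pass the bound. *)
Lemma reach_eventP m i : reach_event (dyadic m i) w <-> sup_reached x (dyadic m i).
Proof.
split=> [h s e s0 e0|h m' j k].
  have e2 : 0 < e / 2 by rewrite divr_gt0.
  have [m1 [j1 [_ hx]]] := dyadic_right_approx s0 e2 ltr01.
  have [k hk] : exists k : nat, k.+1%:R^-1 < e / 2.
    have := near_infty_natSinv_lt (PosNum e2) => -[k _ hk].
    by exists k; apply: (hk k) => /=.
  have [m2 [j2 [h1 h2]]] := h m1 j1 k.
  exists (dyadic m2 j2); first by rewrite dyadic_ge0.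
  by move: hx h2 hk; rewrite /x; move: (k.+1%:R^-1 : R) => z *; lra.
have k0 : 0 < k.+1%:R^-1 :> R by rewrite invr_gt0.
have [r /andP[r0 rt] hr] := h _ _ (dyadic_ge0 m' j) k0.
move: rt; rewrite le_eqVlt => /predU1P[rE|rt].
  by exists m, i; split => //; rewrite -rE.
have e0 : 0 < x r - (x (dyadic m' j) - k.+1%:R^-1) by rewrite subr_gt0.
have d0 : 0 < dyadic m i - r by rewrite subr_gt0.
have [m1 [j1 [/andP[_ h1] h2]]] := dyadic_right_approx r0 e0 d0.
exists m1, j1; split; first lra.
by move: h2; rewrite /x; move: (k.+1%:R^-1 : R) => z *; lra.
Qed.

End regular.

Definition layer (E : nat -> set Om1) (i : nat) : set Om1 :=
  E i `\` (if i is i'.+1 then E i' else set0).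

Lemma layer_inj (E : nat -> set Om1) i j w : {homo E : m n / (m <= n)%N >-> m `<=` n} ->
  layer E i w -> layer E j w -> i = j.
Proof.
move=> Em [Ei nEi] [Ej nEj]; apply/eqP; rewrite eqn_leq; apply/andP; split.
  rewrite leqNgt; apply/negP => ji; case: i ji Ei nEi => // i ji _; apply.
  exact: (Em j i ji).
rewrite leqNgt; apply/negP => ij; case: j ij Ej nEj => // j ij _; apply.
exact: (Em i j ij).
Qed.

Lemma layer_past (E : nat -> set Om1) i : (forall i, <<s past >> (E i)) -> <<s past >> (layer E i).
Proof.
move=> mE; suff : @measurable _ (g_sigma_algebraType past) (layer E i) by [].
apply: measurableD; first exact: mE.
by case: i => [|i]; [exact: measurable0|exact: mE].
Qed.

Lemma layer_ex (E : nat -> set Om1) (w : Om1) n : E n w ->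
  exists2 i, (i <= n)%N & layer E i w.
Proof.
elim: n => [E0|n ih En]; first by exists 0%N => //; split.
have [/ih[i ilen hi]|nE] := pselect (E n w); first by exists i => //; exact: leqW.
by exists n.+1.
Qed.

(* The cells are the preimages of the squares of a dyadic grid under the
   supremum and its time. *)
Lemma sup_cells (de : R) : 0 < de ->
  (forall eta : R, 0 < eta -> exists c : R, outer_le P
     [set w | ~ (regular_path X w /\ forall t : R, 0 <= t -> X t w <= c - de * t)] eta) ->
  forall r eta : R, 0 < r -> 0 < eta -> exists (I : finType) (C : I -> set Om1) (u1 u2 : I -> R),
     [/\ forall i, mixing_event P Q zeta Z (C i),
         forall w i j, C i w -> C j w -> i = j &
         outer_le P [set w | ~ exists i, [/\ C i w, `|path_sup (X^~ w) - u1 i| < r &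
            `|path_argsup (X^~ w) - u2 i| < r]] eta].
Proof.
move=> de0 hdrift r eta r0 eta0; have [c hc] := hdrift _ eta0.
have [p hp] := exp2_gt r^-1.
have q0 : (0 : R) < (2 ^ p)%:R by exact: exp2_gt0.
have qr : (2 ^ p)%:R^-1 < r by rewrite invf_plt ?posrE.
pose A (i : nat) := le_event (dyadic p i).
pose B (i : nat) := reach_event (dyadic p i).
have dyW m n : (m <= n)%N -> dyadic p m <= dyadic p n.
  by move=> mn; rewrite /dyadic ler_wpM2r ?invr_ge0// ler_nat.
have Am : {homo A : m n / (m <= n)%N >-> m `<=` n}.
  by move=> m n mn w h m' j; apply: (le_trans (h m' j)); exact: dyW.
have Bm : {homo B : m n / (m <= n)%N >-> m `<=` n}.
  move=> m n mn w h m' j k; have [m1 [j1 [h1 h2]]] := h m' j k.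
  by exists m1, j1; split => //; apply: (le_trans h1); exact: dyW.
have [N hN] : exists N : nat, `|c| + `|drift_horizon c de| <= dyadic p N.
  exists (Num.truncn ((`|c| + `|drift_horizon c de|) * (2 ^ p)%:R)).+1.
  by rewrite /dyadic ler_pdivlMr//; exact/ltW/truncnS_gt.
exists ('I_N.+1 * 'I_N.+1)%type, (fun ij : 'I_N.+1 * 'I_N.+1 => layer A ij.1 `&` layer B ij.2),
  (fun ij : 'I_N.+1 * 'I_N.+1 => dyadic p ij.1), (fun ij : 'I_N.+1 * 'I_N.+1 => dyadic p ij.2); split.
- move=> [i j]; apply: mixing_past_sigma.
  have mI := @measurableI _ (g_sigma_algebraType past).
  apply: mI; apply: layer_past => k; [exact: le_event_past|exact: reach_event_past].
- move=> w [i j] [i' j'] /= [h1 h2] [h3 h4]; congr (_, _); apply: val_inj => /=.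
    exact: layer_inj Am h1 h3.
  exact: layer_inj Bm h2 h4.
apply: outer_leW (lexx _) hc => w /= h [rw hw]; apply: h.
have /andP[S0 Sc] := path_sup_bounds (proj1 rw) de0 hw.
have /andP[g0 gT] := path_argsup_bounds (proj1 rw) de0 hw.
(* Layer 0 forces [z = 0]; any other layer confines [z] to an interval of length [2 ^ -p < r]. *)
have gap (E : nat -> set Om1) (z : R) i : 0 <= z -> (forall i, E i w <-> z <= dyadic p i) ->
    layer E i w -> `|z - dyadic p i| < r.
  move=> z0 hE [/hE zi nz]; rewrite distrC ger0_norm ?subr_ge0//.
  case: i zi nz => [zi _|i zi nz].
    by rewrite /dyadic mul0r sub0r; lra.
  have : ~ (z <= dyadic p i) by move=> /hE.
  move=> /negP; rewrite -ltNge => zi'.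
  have : dyadic p i.+1 = dyadic p i + (2 ^ p)%:R^-1 by rewrite /dyadic -natr1 mulrDl mul1r.
  lra.
have hA i : A i w <-> path_sup (X^~ w) <= dyadic p i by exact: (le_eventP rw de0 hw).
have hB i : B i w <-> path_argsup (X^~ w) <= dyadic p i.
  split=> [/(reach_eventP rw) hr|gi].
    by apply: path_argsup_le => //; exact: dyadic_ge0.
  apply/(reach_eventP rw); apply: sup_reachedW gi _.
  exact: (sup_reached_argsup (proj1 rw) de0 (proj2 rw) hw).
have AN : A N w.
  by apply/hA; apply: (le_trans Sc); apply: le_trans hN; apply: (le_trans (ler_norm _)); rewrite lerDl.
have BN : B N w.
  by apply/hB; apply: (le_trans gT); apply: le_trans hN; apply: (le_trans (ler_norm _)); rewrite lerDr.
have [i iN Li] := layer_ex AN; have [j jN Lj] := layer_ex BN.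
exists (Ordinal (iN : (i < N.+1)%N), Ordinal (jN : (j < N.+1)%N)); split => //=.
  exact: gap S0 hA Li.
exact: gap g0 hB Lj.
Qed.

End levy_mixing.

(** * Scaling limits *)

Section scaling_limits.
Context (d1 d2 : measure_display) (Om1 : measurableType d1) (Om2 : measurableType d2)
  (R : realType) (P : probability Om1 R) (Q : probability Om2 R).
Variables (X : R -> {RV P >-> R}) (mu : R).
Hypothesis hX : levy_process P X.
Local Notation Y := (centred X mu).
Variable a : R -> R.
Hypothesis a_gt0 : forall T : R, 0 < T -> 0 < a T.
Hypothesis a_oo : forall K : R, exists2 T0 : R, 0 < T0 & forall T, T0 <= T -> K < a T.
Hypothesis supY : forall eta : R, 0 < eta -> exists L T0 : R, [/\ 0 < L, 0 < T0 &
  forall T s, T0 <= T -> 0 <= s ->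
  outer_le P [set w | exists2 u, 0 <= u <= T & L * a T < `|Y (s + u) w - Y s w|] eta].
Hypothesis linY : forall de e : R, 0 < de -> 0 < e -> exists2 x : R, 0 < x & forall s, 0 <= s ->
  outer_le P [set w | exists2 u, 0 <= u & x + de * u < `|Y (s + u) w - Y s w|] e
  /\ outer_le P [set w | exists2 u, 0 <= u <= s & x + de * u < `|Y s w - Y (s - u) w|] e.
Let k : R := Num.sqrt (1 + mu ^+ 2).

Lemma majorant_estimates (r eta : R) : 0 < r -> 0 < eta ->
  exists2 T0 : R, 0 < T0 & forall T, T0 < T -> outer_le P [set w | ~
    [/\ `|(majorant_length T (X^~ w) - k * T) / a T - mu / k * (Y T w / a T)| < r,
        `|(concave_majorant T (X^~ w) T - mu * T) / a T - Y T w / a T| < r &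
        0 < mu -> `|(majorant_sup T (X^~ w) - mu * T) / a T - Y T w / a T| < r]] eta.
Proof.
move=> r0 eta0; have eta3 : 0 < eta / 3 by rewrite divr_gt0.
have [L [T1 [L0 T10 hL]]] := supY eta3.
(* [th] is chosen after [L]: the variation error takes at most half of [r], [5 + th] is at most 6,
   and for positive drift the supremum bound applies. *)
have [th [th0 th1 thL thmu]] : exists th : R, [/\ 0 < th, th <= 1, 3 * th * L <= r / 2 &
    0 < mu -> th <= mu].
  pose m := if 0 < mu then mu else 1.
  have m0 : 0 < m by rewrite /m; case: ifP.
  have rL : 0 < r / (6 * L) by rewrite divr_gt0// mulr_gt0.
  exists (Num.min (Num.min 1 m) (r / (6 * L))); split.
  - by rewrite !lt_min ltr01 m0.
  - by rewrite !ge_min lexx.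
  - rewrite (_ : r / 2 = 3 * (r / (6 * L)) * L); last by field; rewrite gt_eqF.
    by rewrite ler_pM2r// ler_pM2l// ge_min lexx orbT.
  - by move=> mu0; rewrite !ge_min /m mu0 lexx orbT.
have [x x0 hx] := linY th0 eta3.
(* [x] depends on [th] only, so for large [T] the error [6 * x] falls below half of [r * a T]. *)
have [T2 T20 hT2] := a_oo (12 * x / r).
exists (Num.max T1 T2); first by rewrite lt_max T10.
move=> T; rewrite gt_max => /andP[TT1 TT2].
have T0 : 0 < T by lra.
have aT := hT2 _ (ltW TT2).
have aT0 := a_gt0 T0.
rewrite ltr_pdivrMr// in aT.
have [_ bad3] := hx T (ltW T0).
have [bad2 _] := hx 0 (lexx _).
have bad := outer_leU (outer_leU (hL T 0 (ltW TT1) (lexx _)) bad2) bad3.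
apply: (outer_le_regular hX).
rewrite (_ : eta = eta / 3 + eta / 3 + eta / 3); last by field.
apply: outer_leW (lexx _) bad => w [rw h]; apply: contrapT => /not_orP[/not_orP[n1 n2] n3]; apply: h.
have y0 := regular_centred0 mu rw.
have yA (t : R) : 0 <= t <= T -> `|Y t w| <= L * a T.
  move=> tT; rewrite leNgt; apply/negP => h; apply: n1; exists t => //.
  by rewrite add0r y0 subr0.
have ye (t : R) : 0 <= t <= T -> Y t w <= x + th * t.
  move=> /andP[t0 _]; rewrite leNgt; apply/negP => h; apply: n2; exists t => //.
  by rewrite add0r y0 subr0; apply: lt_le_trans h (ler_norm _).
have yT (t : R) : 0 <= t <= T -> Y t w <= Y T w + x + th * (T - t).
  move=> /andP[t0 tT]; rewrite leNgt; apply/negP => h; apply: n3; exists (T - t); first lra.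
  rewrite subKr distrC; apply: lt_le_trans (ler_norm _).
  by rewrite ltrBrDr addrC addrA.
have yE (t : R) : Y t w = X t w - mu * t by [].
have gE (t : R) : concave_majorant T (X^~ w) t - mu * t = concave_majorant T (X^~ w) t - mu * t by [].
have x00 : X 0 w = 0 by have [] := rw.
have dist (A B b : R) : `|A - b * a T| < r * a T -> B = b -> `|A / a T - B| < r.
  move=> h ->; rewrite -(@mulfK _ (a T) _ b) ?gt_eqF// -mulrBl normrM.
  by rewrite [`|(a T)^-1|]gtr0_norm ?invr_gt0// ltr_pdivrMr.
have YaT : Y T w / a T * a T = Y T w by rewrite divfK// gt_eqF.
have small : 3 * th * (L * a T) + (5 + th) * x < r * a T.
  have h1 : 3 * th * L * a T <= r * a T / 2 by rewrite [leRHS]mulrAC ler_pM2r.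
  have h2 : th * x <= x by rewrite ger_pMl.
  rewrite mulrA [(5 + th) * x]mulrDl; move: h1 h2 aT; rewrite [a T * r]mulrC.
  by move: (3 * th * L * a T) (th * x) (r * a T) => p q A h1 h2 aT; lra.
have xr : x < r * a T by move: aT; rewrite [a T * r]mulrC; move: (r * a T) => A aT; lra.
split.
- apply: (dist _ _ (mu / k * (Y T w / a T))) => //.
  have := @majorant_length_approx _ mu k T (L * a T) x th (X^~ w) (concave_majorant T (X^~ w))
    (fun t => Y t w) (fun t => concave_majorant T (X^~ w) t - mu * t) T0 (ltW x0) (ltW th0) x00
    erefl erefl yE gE yA ye yT.
  by rewrite -(mulrA (mu / k)) YaT opprD addrA => h; exact: le_lt_trans h small.
- apply: (dist _ _ (Y T w / a T)) => //; rewrite YaT.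
  have := @majorant_end _ mu T (L * a T) x th (X^~ w) (concave_majorant T (X^~ w))
    (fun t => Y t w) (fun t => concave_majorant T (X^~ w) t - mu * t) T0 erefl yE gE yA yT.
  rewrite yE ltr_norml.
  by move: (concave_majorant T _ T) (X T w) (mu * T) (r * a T) xr => A B D E xr; lra.
- move=> mu0; apply: (dist _ _ (Y T w / a T)) => //; rewrite YaT.
  have := @majorant_sup_drift _ mu T (L * a T) x th (X^~ w) (concave_majorant T (X^~ w))
    (fun t => Y t w) (fun t => concave_majorant T (X^~ w) t - mu * t) T0 erefl yE gE yA yT
    (thmu mu0).
  rewrite yE ltr_norml.
  by move: (majorant_sup T _) (X T w) (mu * T) (r * a T) xr => A B D E xr; lra.
Qed.

(* The negative drift beats the linear bound on the centred process. *)
Lemma linear_drift (eta : R) : mu < 0 -> 0 < eta -> exists c : R, outer_le P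
  [set w | ~ (regular_path X w /\ forall t : R, 0 <= t -> X t w <= c - - mu / 2 * t)] eta.
Proof.
move=> mu0 eta0; have de0 : 0 < - mu / 2 by lra.
have [x x0 hx] := linY de0 eta0; exists x.
have [bad _] := hx 0 (lexx _).
apply: (outer_le_regular hX).
apply: outer_leW (lexx _) bad => w [rw h]; apply: contrapT => n; apply: h; split=> // t t0.
rewrite leNgt; apply/negP => lt; apply: n; exists t => //.
rewrite add0r (regular_centred0 mu rw) subr0; have := ler_norm (Y t w).
have tm : centred X mu t w = X t w - mu * t by [].
by rewrite tm; move: (`|_|) => A; lra.
Qed.

Variable Z : Om2 -> R.
Let zeta (T : R) (w : Om1) : R := Y T w / a T.
Hypothesis mZ : measurable_fun setT Z.
Hypothesis zetaZ : cvg_in_law P Q zeta Z.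
Let mzeta := measurable_scaled X mu a.

(** The mixing form of Slutsky's theorem is used with constant [U1], [U2] and one cell, the whole
    space; the limit on the product space depends on the second factor only and is then read
    there. *)
Lemma majorant_cvg_positive_drift : 0 < mu ->
  cvg_in_law P Q
    (fun T w => ((majorant_length T (X^~ w) - k * T) / a T,
                 (majorant_sup T (X^~ w) - mu * T) / a T,
                 (concave_majorant T (X^~ w) T - mu * T) / a T))
    (fun w' => (mu / k * Z w', Z w', Z w')).
Proof.
move=> mu0.
set W := (X in cvg_in_law _ _ X _).
pose G (r : R) : R * R * R := (mu / k * r, r, r).
have cG : continuous G.
  apply: continuous_pair; first apply: continuous_pair.
  - exact: mulrl_continuous.
  - by move=> r; exact: cvg_id.
  - by move=> r; exact: cvg_id.
have h : cvg_in_law P (P \x Q)%E W (fun z => G (Z z.2)).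
  apply: (@slutsky_mixing _ _ _ _ _ P Q zeta Z mzeta mZ zetaZ _
    (fun z : R * R * R => G z.2) (fun=> 0) (fun=> 0)).
  - by move=> z; apply: (@cvg_comp _ _ _ (fun z : R * R * R => z.2) G); [exact: cvg_snd|exact: cG].
  - move=> eta eta0; exists 0.
    apply: outer_leW (ltW eta0) (outer_le_negligible (negligible_set0 P)) => w /=.
    by rewrite normr0 ltxx => -[].
  - move=> de eta de0 eta0; exists unit, (fun=> setT), (fun=> 0), (fun=> 0); split.
    + by move=> _; have [_ + _ _] := mixing_lambda_system mzeta zetaZ.
    + by move=> w [] [].
    + apply: outer_leW (ltW eta0) (outer_le_negligible (negligible_set0 P)) => w [].
      by exists tt; rewrite subr0 normr0.
  - move=> r eta r0 eta0; have [T0 _ hT] := majorant_estimates r0 eta0.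
    exists T0 => T /hT; apply: outer_leW => // w + [h1 h2 h3]; apply; have := h3 mu0.
    by split; [split|]; rewrite /ball/= distrC.
apply/cvg_in_lawP => f cf fM e e0.
have [T0 hT0] := (cvg_in_lawP _ _ _ _).1 h f cf fM e e0.
have [M hM] := fM.
exists T0 => T /hT0.
have mfG : measurable_fun setT (f \o G).
  by apply: continuous_measurable_fun => r; apply: continuous_comp; [exact: cG|exact: cf].
have := @fine_expectation_product _ _ _ _ _ P Q setT Z (f \o G) M measurableT mZ mfG
  (fun x => hM (G x)).
rewrite probability_setT mul1r => <-.
rewrite (_ : (fun z : Om1 * Om2 => _) = f \o (fun z => G (Z z.2)))//.
by apply/funext => z; rewrite indicT /= mul1r.
Qed.

Hypothesis mu_lt0 : mu < 0.
Let de_gt0 : 0 < - mu / 2. Proof. by have := mu_lt0; lra. Qed.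

Lemma majorant_sup_cvg : P.-negligible [set w | ~
  (majorant_sup T (X^~ w) @[T --> +oo] --> path_sup (X^~ w) /\
   majorant_argmax T (X^~ w) @[T --> +oo] --> path_argsup (X^~ w))].
Proof.
apply: outer_le_negligible0 => e e0; have [c hc] := linear_drift mu_lt0 e0.
apply: outer_leW (lexx _) hc => w /= + [[x0 xc] xl]; apply.
have late := nbhs_pinfty_gt (num_real (drift_horizon c (- mu / 2))).
split; apply: cvg_near_cst; apply: filterS late => T TT.
  by rewrite (majorant_sup_eventually x0 de_gt0 xl TT).
by rewrite (majorant_argmax_eventually x0 de_gt0 xc xl TT).
Qed.

(** [U1] and [U2] are the limits of the supremum and its time, almost surely equal to [path_sup] and
    [path_argsup]. Past a horizon common to all good paths these two coordinates are exact, and only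
    the scaled ones are approximated. *)
Lemma majorant_cvg_negative_drift :
  cvg_in_law P (P \x Q)%E
    (fun T w => ((majorant_length T (X^~ w) - k * T) / a T,
                 majorant_sup T (X^~ w),
                 (concave_majorant T (X^~ w) T - mu * T) / a T,
                 majorant_argmax T (X^~ w)))
    (fun z => (mu / k * Z z.2, lim (majorant_sup T (X^~ z.1) @[T --> +oo]), Z z.2,
               lim (majorant_argmax T (X^~ z.1) @[T --> +oo]))).
Proof.
have limN : P.-negligible [set w | ~
    (lim (majorant_sup T (X^~ w) @[T --> +oo]) = path_sup (X^~ w) /\
     lim (majorant_argmax T (X^~ w) @[T --> +oo]) = path_argsup (X^~ w))].
  apply: negligibleS majorant_sup_cvg => w /= + [h1 h2]; apply.
  by split; apply: cvg_lim.
have oN := outer_le_negligible limN.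
apply: (@slutsky_mixing _ _ _ _ _ P Q zeta Z mzeta mZ zetaZ _
  (fun z : R * R * R => (mu / k * z.2, z.1.1, z.2, z.1.2))
  (fun w => lim (majorant_sup T (X^~ w) @[T --> +oo]))
  (fun w => lim (majorant_argmax T (X^~ w) @[T --> +oo]))).
- have c11 : continuous (fun z : R * R * R => z.1.1).
    by move=> z; apply: (@cvg_comp _ _ _ fst fst); exact: cvg_fst.
  have c12 : continuous (fun z : R * R * R => z.1.2).
    by move=> z; apply: (@cvg_comp _ _ _ fst snd); [exact: cvg_fst|exact: cvg_snd].
  have c2 : continuous (fun z : R * R * R => z.2) by move=> z; exact: cvg_snd.
  do ![apply: continuous_pair => //] => z.
  by apply: (@cvg_comp _ _ _ snd ( *%R (mu / k))); [exact: c2|exact: mulrl_continuous].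
- move=> eta eta0; have [c hc] := linear_drift mu_lt0 eta0.
  exists (Num.max c (drift_horizon c (- mu / 2))).
  have := outer_leU hc oN; rewrite addr0; apply: outer_leW => // w /= h.
  apply: contrapT => /not_orP[/contrapT[[x0 _] xl] /contrapT[e1 e2]]; move: h.
  have /andP[p0 pc] := path_sup_bounds x0 de_gt0 xl.
  have /andP[q0 qc] := path_argsup_bounds x0 de_gt0 xl.
  by rewrite e1 e2 !ger0_norm// !gt_max !ltNge pc qc /= andbF => -[].
- move=> r eta r0 eta0.
  have [I [C [u1 [u2 [mixC dC hC]]]]] := sup_cells hX mZ zetaZ a_oo de_gt0
    (fun eta eta0 => linear_drift mu_lt0 eta0) r0 eta0.
  exists I, C, u1, u2; split=> //.
  have := outer_leU hC oN; rewrite addr0; apply: outer_leW => // w /= h.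
  by apply: contrapT => /not_orP[/contrapT + /contrapT[e1 e2]]; rewrite -e1 -e2.
- move=> r eta r0 eta0; have eta2 : 0 < eta / 2 by rewrite divr_gt0.
  have [T0 _ hT] := majorant_estimates r0 eta2.
  have [c hc] := linear_drift mu_lt0 eta2.
  exists (Num.max T0 (drift_horizon c (- mu / 2))) => T; rewrite gt_max => /andP[/hT h TT].
  have := outer_leU (outer_leU h hc) oN; rewrite addr0 -splitr; apply: outer_leW => // w /= n.
  apply: contrapT => /not_orP[/not_orP[/contrapT[h1 h2 _] /contrapT[[x0 xc] xl]] /contrapT[e1 e2]].
  apply: n; rewrite e1 e2 (majorant_sup_eventually x0 de_gt0 xl TT).
  rewrite (majorant_argmax_eventually x0 de_gt0 xc xl TT).
  by split; [split; [split|]|]; rewrite /ball/= ?subrr ?normr0// distrC.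
Qed.

End scaling_limits.

Theorem theorem1p6 (R : realType)
    (d : measure_display) (Om : measurableType d) (P : probability Om R)
    (X : R -> {RV P >-> R}) (mu : R)
    (d' : measure_display) (Om' : measurableType d') (P' : probability Om' R)
    (alpha : R) (S : R -> {RV P' >-> R}) (l a : R -> R) :
  levy_process P X ->
  P.-integrable [set: Om] (EFin \o X 1) -> ('E_P[X 1%R] = mu%:E)%E -> mu != 0 ->
  1 < alpha <= 2 -> stable_process P' alpha S ->
  slowly_varying l ->
  (forall T : R, 0 < T -> 0 < a T /\ a T = T `^ alpha^-1 * l T) ->
  cvg_in_law P P' (fun T w => (X T w - mu * T) / a T) (S 1) ->
  let C (T : R) (w : Om) : R -> R := concave_majorant T (X^~ w) in
  let Upsilon (T : R) (w : Om) : R := majorant_length T (X^~ w) in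
  let supC (T : R) (w : Om) : R := majorant_sup T (X^~ w) in
  let gamma (T : R) (w : Om) : R := majorant_argmax T (X^~ w) in
  let k : R := Num.sqrt (1 + mu ^+ 2) in
  (0 < mu ->
    cvg_in_law P P'
      (fun T w => ((Upsilon T w - k * T) / a T,
                   (supC T w - mu * T) / a T,
                   (C T w T - mu * T) / a T))
      (fun w' => (mu / k * S 1 w', S 1 w', S 1 w')))
  /\
  (mu < 0 ->
    {ae P, forall w, cvg (supC T w @[T --> +oo]) /\
                     cvg (gamma T w @[T --> +oo])} /\
    let supX_oo (w : Om) : R := lim (supC T w @[T --> +oo]) in
    let gamma_oo (w : Om) : R := lim (gamma T w @[T --> +oo]) in
    cvg_in_law P (P \x P')%E
      (fun T w => ((Upsilon T w - k * T) / a T,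
                   supC T w,
                   (C T w T - mu * T) / a T,
                   gamma T w))
      (fun ww' => (mu / k * S 1 ww'.2, supX_oo ww'.1, S 1 ww'.2,
                   gamma_oo ww'.1))).
Proof.
move=> hX _ _ mu0 alpha1 hS hl ha cvgX C Upsilon supC gamma k.
have [a1 _] := andP alpha1.
have a_gt0 (T : R) : 0 < T -> 0 < a T by move=> /ha[].
pose zeta T w := centred X mu T w / a T.
have mzeta : forall T : R, measurable_fun setT (zeta T) := measurable_scaled X mu a.
have mZ : measurable_fun setT (S 1) by exact: measurable_funPT.
have zetaZ : cvg_in_law P P' zeta (S 1) by [].
have Z0 : ~ {ae P', forall w, S 1 w = 0}.
  by move=> h; apply: (stable_nondegenerate hS); exists 0.
have tight := cvg_in_law_tight mzeta mZ zetaZ.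
have nondeg := cvg_in_law_nondegenerate mzeta mZ zetaZ Z0.
have doubling := slowly_varying_doubling a1 hl ha.
have a_oo := scale_unbounded hX a_gt0 tight nondeg doubling.
have supY := sup_tight hX a_gt0 tight.
have linY := linear_growth hX a_gt0 tight doubling.
split=> [mu_gt0|mu_lt0]; first exact: majorant_cvg_positive_drift.
split; last exact: majorant_cvg_negative_drift.
apply: negligibleS (majorant_sup_cvg hX linY mu_lt0) => w /= + [h1 h2]; apply.
by split; [exact: cvgP h1|exact: cvgP h2].
Qed.
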